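(* A unitary Haar matrix $U_N$ converges in traffic distribution and satisfies the factorization property. Let $\tau^0[T]=\lim_{N\to\infty}\tau_N^0[T(U_N)]$ for $*$-test graphs $T$ in one variable $x$. The support of $\tau^0$ is the set of $*$-test graphs $T$ such that each edge belongs to a unique simple cycle of $T$, and each simple cycle of $T$ is oriented and of even length with edges labeled $x$ and $x^*$ alternately. For such a graph $T$, $$\tau^0[T]=\prod_{i=1}^L(-1)^{k_i/2-1}c_{k_i/2-1},$$ where $k_1,\dots,k_L$ are the lengths of the $L$ simple cycles of $T$ and $c_k=\frac{(2k)!}{(k+1)!\,k!}$ is the $k$-th Catalan number.
   Context: A unitary Haar matrix is Haar distributed on the unitary group of size $N$. A $*$-test graph in one variable $x$ is $T=(V,E,\varepsilon)$, where $(V,E)$ is a finite connected directed graph (loops and multiple edges allowed, $V\ne\emptyset$, $E$ possibly empty) and $\varepsilon:E\to\{1,*\}$, edge $e$ having label $x^{\varepsilon(e)}$. For a random matrix $A_N$, $$\tau_N^0[T(A_N)]=\mathbb E\Big[\frac1N\sum_{\phi:V\to\{1,\dots,N\}\text{ injective}}\ \prod_{e=(v,w)\in E}A_N^{\varepsilon(e)}(\phi(w),\phi(v))\Big],$$ where $e=(v,w)$ goes from $v$ to $w$; $\mathrm{Tr}[T(A_N)]$ denotes the sum over all (not necessarily injective) maps $\phi$, without expectation and without the factor $1/N$, and $\tau_N[T(A_N)]=\mathbb E[\frac1N\mathrm{Tr}\,T(A_N)]$. $A_N$ converges in traffic distribution if $\tau[T]:=\lim_N\tau_N[T(A_N)]$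 exists for every $*$-test graph $T$ (equivalently $\lim_N\tau_N^0[T(A_N)]$ exists for every $T$). It satisfies the factorization property if moreover $\mathbb E[\prod_{k=1}^K\frac1N\mathrm{Tr}\,T_k(A_N)]\to\prod_{k=1}^K\tau[T_k]$ for all $K\ge2$ and all $*$-test graphs $T_1,\dots,T_K$. A simple cycle of $T$ is a subgraph consisting of a closed path with no repetition of vertices (orientation disregarded; loops are cycles of length one and two edges with the same two distinct endpoints form a cycle of length two); it is oriented if its edges can be followed around the cycle in the sense of their orientation. *)

(* Defs.v *)
From mathcomp Require Import all_boot all_order all_algebra.
From mathcomp Require Import complex.
From mathcomp Require Import all_classical all_reals all_analysis.

Set Implicit Arguments.
Unset Strict Implicit.
Unset Printing Implicit Defensive.

Import Order.TTheory GRing.Theory Num.Theory.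
Import numFieldNormedType.Exports.

Local Open Scope classical_set_scope.
Local Open Scope ring_scope.
Local Open Scope complex_scope.
Local Open Scope sesquilinear_scope.

Section random_matrices.
Context {R : realType} {d : measure_display} {Omega : measurableType d}.

Definition complex_expectation (P : probability Omega R) (X : Omega -> R[i]) :
    R[i] :=
  (\int[P]_(w in setT) complex.Re (X w))%R
  +i* (\int[P]_(w in setT) complex.Im (X w))%R.

(* The Borel sigma-algebra of N x N complex matrices, generated by the real and
   imaginary parts of the entries. *)
Definition mx_coordinate_sets (N : nat) : set (set 'M[R[i]]_N) :=
  [set B | exists i j (S : set R), measurable S /\
     (B = [set A : 'M[R[i]]_N | S (complex.Re (A i j))] \/
      B = [set A : 'M[R[i]]_N | S (complex.Im (A i j))])].

Definition mx_borel (N : nat) : set (set 'M[R[i]]_N) :=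
  <<s @mx_coordinate_sets N >>.

Definition random_matrix (N : nat) (U : Omega -> 'M[R[i]]_N) : Prop :=
  forall B, mx_borel B -> measurable (U @^-1` B).

(* The Haar probability measure of a compact group is its (unique) probability
   measure invariant under left translations. *)
Definition unitary_haar (P : probability Omega R) (N : nat)
    (U : Omega -> 'M[R[i]]_N) : Prop :=
  [/\ random_matrix U,
      forall w, U w \is unitarymx
    & forall V : 'M[R[i]]_N, V \is unitarymx ->
      forall B, mx_borel B ->
        P [set w | B (V *m U w)] = P [set w | B (U w)]].

End random_matrices.

Definition adjacent (V E : finType) (src tgt : E -> V) : rel V :=
  fun u v => [exists e, ((src e == u) && (tgt e == v))
                     || ((src e == v) && (tgt e == u))].

(* Edge [e] goes from [src e] to [tgt e]; its label is x^* when [star e] holds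
   and x otherwise. *)
Record testGraph := TestGraph {
  vertex : finType;
  edge : finType;
  src : edge -> vertex;
  tgt : edge -> vertex;
  star : edge -> bool;
  vertex_gt0 : (0 < #|vertex|)%N;
  connectedT : forall u v : vertex, connect (adjacent src tgt) u v
}.

Section traces.
Context {R : realType}.

Definition edge_weight (N : nat) (A : 'M[R[i]]_N) (T : testGraph)
    (phi : {ffun vertex T -> 'I_N}) : R[i] :=
  \prod_(e : edge T)
    (if star e then A ^t* else A) (phi (tgt e)) (phi (src e)).

Definition Tr (N : nat) (A : 'M[R[i]]_N) (T : testGraph) : R[i] :=
  \sum_(phi : {ffun vertex T -> 'I_N}) edge_weight A phi.

Definition Tr_inj (N : nat) (A : 'M[R[i]]_N) (T : testGraph) : R[i] :=
  \sum_(phi : {ffun vertex T -> 'I_N} | injectiveb phi) edge_weight A phi.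

End traces.

Section traffics.
Context {R : realType} {d : nat -> measure_display}.
Context {Omega : forall N, measurableType (d N)}.
Variables (P : forall N, probability (Omega N) R).
Variables (A : forall N, Omega N -> 'M[R[i]]_N).

(* The values of sequences to be taken to the limit are typed in (R[i])^o, which
   carries the norm topology of R[i]. *)
Definition tau_ (T : testGraph) (N : nat) : (R[i])^o :=
  complex_expectation (P N) (fun w => N%:R^-1 * Tr (A w) T).

Definition tau0_ (T : testGraph) (N : nat) : (R[i])^o :=
  complex_expectation (P N) (fun w => N%:R^-1 * Tr_inj (A w) T).

Definition tau_prod_ (K : nat) (T : 'I_K -> testGraph) (N : nat) : (R[i])^o :=
  complex_expectation (P N)
    (fun w => \prod_(k < K) (N%:R^-1 * Tr (A w) (T k))).

Definition tau (T : testGraph) : R[i] := limn (tau_ T).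
Definition tau0 (T : testGraph) : R[i] := limn (tau0_ T).

Definition converges_in_traffic_distribution : Prop :=
  forall T : testGraph, cvgn (tau_ T).

Definition factorization_property : Prop :=
  forall (K : nat) (T : 'I_K -> testGraph), (2 <= K)%N ->
    tau_prod_ T @ \oo --> (\prod_(k < K) tau (T k) : (R[i])^o).

End traffics.

Section simple_cycles.
Variable T : testGraph.

(* A closed path v_0 e_0 v_1 e_1 ... v_(k-1) e_(k-1) v_0 is the sequence of the
   pairs (v_i, e_i); [path.cycle] also relates the last pair to the first one,
   so that k = 1 is a loop at v_0. *)
Implicit Types (s : seq (vertex T * edge T)) (C : {set edge T}).

Definition joins (e : edge T) (u v : vertex T) : bool :=
  ((src e == u) && (tgt e == v)) || ((src e == v) && (tgt e == u)).

Definition simple_closed_path s : bool :=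
  [&& s != [::], uniq (unzip1 s), uniq (unzip2 s)
    & path.cycle (fun p q => joins p.2 p.1 q.1) s].

Definition oriented_path s : bool :=
  path.cycle (fun p q => (src p.2 == p.1) && (tgt p.2 == q.1)) s.

Definition alternating_path s : bool :=
  path.cycle (fun p q => star p.2 != star q.2) s.

(* A simple cycle is determined, as a subgraph, by its set of edges, whose
   cardinality is its length. *)
Definition simple_cycle C : Prop :=
  exists s, simple_closed_path s /\ C = [set e in unzip2 s].

Definition oriented_alternating_cycle C : Prop :=
  exists s, [/\ simple_closed_path s, C = [set e in unzip2 s],
    oriented_path s, ~~ odd #|C| & alternating_path s].

Definition oriented_alternating_cactus : Prop :=
  (forall e : edge T, exists! C, simple_cycle C /\ e \in C) /\
  (forall C, simple_cycle C -> oriented_alternating_cycle C).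

End simple_cycles.

Definition catalan (R : realType) (k : nat) : R[i] :=
  ((2 * k)`!)%:R / (k.+1`! * k`!)%:R.

(* Main.v *)
From HB Require Import structures.
Require Import Defs.
From mathcomp Require Import all_boot all_order all_algebra all_fingroup.
From mathcomp Require boolp.
From mathcomp Require Import ring zify.

Set Implicit Arguments.
Unset Strict Implicit.
Unset Printing Implicit Defensive.

Import Order.TTheory GRing.Theory Num.Theory.

Local Open Scope ring_scope.

(** In a moment E[prod_e U^(star e) (t e) (s e)], the sources [s] and targets [t] of
    the edges take values in the indices of the matrix. All the asymptotics come
    from one relation between moments, [loop_equation]: for a starred edge [b],
    [N] times a moment is the sum, over the unstarred edges [a] opposite to [b], of
    the moments without [a] and [b], minus the sum over the other starred edges [x]
    of the moments with the sources of [b] and [x] exchanged. It expresses that the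
    law of [U] does not change under infinitesimal rotations of the rows, and that
    the columns are orthonormal.

    The rank of a graph is its number of vertices minus its number of components.
    Exchanging two sources lowers it by at most one ([graph_rank_swap]), and so does
    removing two opposite edges, so by induction a moment is of order N^(- rank)
    ([moment_decay_rank]). To leading order only the terms that do lower the rank
    remain in the loop equation. The recursion so obtained is solved by [leading], a
    sum over the permutations [g] of the edges that describe a decomposition of the
    graph into closed oriented walks, alternately starred and unstarred. The number
    of edges minus the number of walks is at least the rank; the sum is over those
    [g] for which there is equality, called tight, and the summand is the product
    of (-1)^(k/2-1) c_(k/2-1) over the cycles of [g], of lengths k. Indeed an
    exchange within a cycle of [g] cuts it in two, and the recursion becomes the
    convolution identity of the Catalan numbers ([perm_weight_rec], [leading_rec]).

    A connected graph mapped onto [k] indices has rank [k - 1], and about N^k maps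
    have a given kernel with [k] classes, so after division by [N] each kernel has a
    limit contribution: this is the convergence of [tau_]. The injective maps give
    that the limit [tau0] is [leading] of the graph itself. For the factorization,
    exchanging edges of two graphs with disjoint images does not lower the rank, so
    their moments decorrelate ([moment_decorrelation]), and the pairs of maps whose
    images meet are too few to matter ([trace_decorrelation]).

    It remains to find the tight permutations of a graph. In a tight decomposition
    no walk visits a vertex twice, for it could be cut there into two walks; and
    removing one edge per walk leaves a forest, so that every simple cycle contains
    a whole walk and is equal to it ([simple_cycle_orbit]). Hence the walks are the
    simple cycles, [g] is unique, and the graph is an oriented alternating cactus.
    Conversely, in such a cactus, following the simple cycles gives a tight
    permutation ([cactus_tight]). *)

(** * Catalan numbers and the weights of cycles *)

Section CatalanRecurrence.
Variable F : numFieldType.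

(** The numbers [catalan] of the definitions, over any number field. *)
Definition catalan_number (k : nat) : F :=
  ((2 * k)`!)%:R / (k.+1`! * k`!)%:R.

Definition central_binomial (k : nat) : F := ((2 * k)`!)%:R / (k`! * k`!)%:R.

Lemma catalan_central k :
  catalan_number k = central_binomial k / k.+1%:R.
Proof.
rewrite /catalan_number /central_binomial factS !natrM -!natr1.
have h1 : (k`!)%:R != 0 :> F by rewrite pnatr_eq0 -lt0n fact_gt0.
have h2 : k%:R + 1 != 0 :> F by rewrite natr1 pnatr_eq0.
by field; rewrite h1 h2.
Qed.

Lemma central_binomialS k :
  central_binomial k.+1 = (2 * (2 * k%:R + 1) / (k%:R + 1)) * central_binomial k.
Proof.
rewrite /central_binomial (_ : (2 * k.+1)%N = (2 * k).+2); last by lia.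
rewrite !factS !natrM.
have h1 : (k`!)%:R != 0 :> F by rewrite pnatr_eq0 -lt0n fact_gt0.
have h2 : k%:R + 1 != 0 :> F by rewrite natr1 pnatr_eq0.
rewrite -!natr1 !natrM.
by field; rewrite h1 h2.
Qed.

Lemma catalan_convolution n :
  catalan_number n.+1 =
  \sum_(0 <= i < n.+1) catalan_number i * catalan_number (n - i).
Proof.
(* an antidifference in [i] of the summand, found by Gosper's algorithm *)
pose G (i : nat) : F := central_binomial i * central_binomial (n.+1 - i) *
  (2 * i%:R - n%:R - 1) / (2 * (n%:R + 1) * (n%:R + 2)).
have step i : (0 <= i < n.+1)%N ->
    catalan_number i * catalan_number (n - i) = G i.+1 - G i.
  rewrite ltnS => /= le_in; rewrite /G !catalan_central subSS subSn //.
  have -> : n%:R = i%:R + (n - i)%:R :> F by rewrite -natrD subnKC.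
  set m := (n - i)%N; rewrite !central_binomialS -!natr1.
  have h1 : i%:R + 1 != 0 :> F by rewrite natr1 pnatr_eq0.
  have h2 : m%:R + 1 != 0 :> F by rewrite natr1 pnatr_eq0.
  have h3 : i%:R + m%:R + 1 != 0 :> F by rewrite -natrD natr1 pnatr_eq0.
  have h4 : i%:R + m%:R + 2 != 0 :> F by rewrite -!natrD pnatr_eq0 addn2.
  by field; rewrite h1 h2 h3 h4.
rewrite (eq_big_nat _ _ step) telescope_sumr // /G subnn subn0.
have -> : central_binomial 0 = 1 by rewrite /central_binomial fact0 divr1.
rewrite catalan_central -!natr1.
have h3 : n%:R + 1 != 0 :> F by rewrite natr1 pnatr_eq0.
have h4 : n%:R + 2 != 0 :> F by rewrite -natrD pnatr_eq0 addn2.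
by field; rewrite h3 h4.
Qed.

(** A fixed point has weight 1, so a product over all the orbits of a permutation
    is a product over its nontrivial cycles. *)
Definition cycle_weight (k : nat) : F :=
  (-1) ^+ (k %/ 2 - 1) * catalan_number (k %/ 2 - 1).

Lemma cycle_weight1 : cycle_weight 1 = 1.
Proof. by rewrite /cycle_weight /catalan_number /= expr0 mul1r fact0 divr1. Qed.

Lemma cycle_weight_neq0 k : cycle_weight k != 0.
Proof.
rewrite mulf_neq0 ?signr_eq0 // /catalan_number mulf_neq0 ?invr_eq0 //.
  by rewrite pnatr_eq0 -lt0n fact_gt0.
by rewrite natrM mulf_neq0 // pnatr_eq0 -lt0n fact_gt0.
Qed.

(** The Catalan convolution; the sign of [cycle_weight] turns the sum into a
    difference, as in the loop equation. *)
Lemma cycle_weight_rec p : (0 < p)%N ->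
  cycle_weight (2 * p) = (p == 1%N)%:R -
    \sum_(1 <= q < p) cycle_weight (2 * q) * cycle_weight (2 * (p - q)).
Proof.
case: p => // -[_|p _].
  rewrite /cycle_weight big_geq // subr0 /catalan_number /= expr0 mul1r fact0.
  by rewrite divr1.
rewrite big_add1 /= sub0r /cycle_weight !mulKn // subn1 /= exprS mulN1r mulNr.
congr (- _); rewrite catalan_convolution mulr_sumr.
apply: eq_big_nat => i /andP[_]; rewrite ltnS => le_ip.
by rewrite !mulKn // subSS subSn // !subn1 /= [in RHS]mulrACA -exprD subn0 subSS subnKC.
Qed.

End CatalanRecurrence.

(** * Cutting a cycle of a permutation in two *)

Section OrbitSplitting.
Variables (T : finType) (s : {perm T}) (x : T) (k : nat).
Let n := #|porbit s x|.
Hypotheses (k_gt0 : (0 < k)%N) (lt_kn : (k < n)%N).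
Let y := (s ^+ k)%g x.
Let t := (s * tperm x y)%g.

Lemma porbit_exp_inj i j : (i < n)%N -> (j < n)%N ->
  ((s ^+ i)%g x == (s ^+ j)%g x) = (i == j).
Proof.
move=> lt_in lt_jn; rewrite !permX.
rewrite -(nth_traject s lt_in) -(nth_traject s lt_jn).
by rewrite nth_uniq ?size_traject // uniq_traject_porbit.
Qed.

Lemma porbit_exp_card : (s ^+ n)%g x = x.
Proof. by rewrite permX iter_porbit. Qed.

(** The permutation [t] agrees with [s] except that the arrows of [s] arriving at
    [x] and at [y] are exchanged. The cycle of [x] is thus cut into the arcs from
    [x] to [(s ^+ k.-1) x] and from [y] to [(s ^+ n.-1) x]. *)
Lemma splitting_permE i : (i < n)%N ->
  t ((s ^+ i)%g x) = if i.+1 == k then x else if i.+1 == n then y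
                     else (s ^+ i.+1)%g x.
Proof.
move=> lt_in; rewrite /t permM -[s _]permM -expgSr.
case: eqP => [->|/eqP ik]; first by rewrite tpermR.
case: eqP => [->|/eqP ni]; first by rewrite porbit_exp_card tpermL.
have lt : (i.+1 < n)%N by rewrite ltn_neqAle ni.
rewrite tpermD // eq_sym; last by rewrite porbit_exp_inj.
by rewrite -{2}[x](perm1) -(expg0 s) porbit_exp_inj //; lia.
Qed.

Lemma splitting_iter_left i : (t ^+ i)%g x = (s ^+ (i %% k))%g x.
Proof.
elim: i => [|i IH]; first by rewrite mod0n.
rewrite expgSr permM IH splitting_permE; last first.
  by apply: leq_trans lt_kn; rewrite ltnS ltnW // ltn_pmod.
have le := ltn_pmod i k_gt0.
rewrite -[in RHS](addn1 i) -modnDml addn1.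
case: eqP => [->|ne]; first by rewrite modnn expg0 perm1.
case: eqP => [eq|_]; first by exfalso; lia.
by rewrite [in RHS]modn_small // ltn_neqAle le andbT; apply/eqP.
Qed.

Lemma splitting_iter_right i : (t ^+ i)%g y = (s ^+ (k + i %% (n - k)))%g x.
Proof.
have nk : (0 < n - k)%N by rewrite subn_gt0.
elim: i => [|i IH]; first by rewrite mod0n addn0 expg0 perm1.
have le := ltn_pmod i nk.
rewrite expgSr permM IH splitting_permE; last by lia.
rewrite -[in RHS](addn1 i) -modnDml addn1.
case: eqP => [eq|ne]; first by exfalso; lia.
case: eqP => [eq|ne'].
  rewrite (_ : (i %% (n - k)).+1 = n - k)%N ?modnn ?addn0 //; lia.
by rewrite [in RHS]modn_small ?addnS //; lia.
Qed.

Lemma splitting_porbit_left : porbit t x = [set (s ^+ val i)%g x | i : 'I_k].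
Proof.
apply/setP=> z; apply/porbitP/imsetP => [[i ->]|[i _ ->]].
  exists (Ordinal (ltn_pmod i k_gt0)) => //; exact: splitting_iter_left.
by exists i; rewrite splitting_iter_left modn_small.
Qed.

Lemma splitting_porbit_right :
  porbit t y = [set (s ^+ (k + val i))%g x | i : 'I_(n - k)].
Proof.
have nk : (0 < n - k)%N by rewrite subn_gt0.
apply/setP=> z; apply/porbitP/imsetP => [[i ->]|[i _ ->]].
  exists (Ordinal (ltn_pmod i nk)) => //; exact: splitting_iter_right.
by exists i; rewrite splitting_iter_right modn_small.
Qed.

Lemma card_splitting_left : #|porbit t x| = k.
Proof.
rewrite splitting_porbit_left card_imset ?card_ord // => i j /eqP.
have lt (l : 'I_k) : (l < n)%N := ltn_trans (ltn_ord l) lt_kn.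
by rewrite porbit_exp_inj ?lt // => /eqP/val_inj.
Qed.

Lemma card_splitting_right : #|porbit t y| = (n - k)%N.
Proof.
rewrite splitting_porbit_right card_imset ?card_ord // => i j /eqP.
have lt (l : 'I_(n - k)) : (k + l < n)%N by rewrite -ltn_subRL.
by rewrite porbit_exp_inj ?lt // eqn_add2l => /eqP/val_inj.
Qed.

Lemma splitting_porbit_other z : z \notin porbit s x -> porbit t z = porbit s z.
Proof.
move=> zx.
have tE i : (t ^+ i)%g z = (s ^+ i)%g z.
  elim: i => [|i IH]; first by rewrite !expg0.
  rewrite !expgSr !permM IH.
  have oz j : (s ^+ j)%g z \notin porbit s x.
    by rewrite porbit_sym porbit_perm -porbit_sym.
  have -> : s ((s ^+ i)%g z) = (s ^+ i.+1)%g z by rewrite expgSr permM.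
  rewrite tpermD //; apply: contraNneq (oz i.+1) => <-; first exact: porbit_id.
  exact: mem_porbit.
by apply/setP=> w; apply/porbitP/porbitP => -[i ->]; exists i; rewrite tE.
Qed.

Lemma splitting_left_proper : porbit t x != porbit t y.
Proof.
rewrite eq_porbit_mem splitting_porbit_right; apply/imsetP => -[i _ /eqP].
have lt (l : 'I_(n - k)) : (k + l < n)%N by rewrite -ltn_subRL.
rewrite -{1}[x](perm1) -(expg0 s) porbit_exp_inj ?(ltn_trans k_gt0) ?lt //.
by rewrite eq_sym addn_eq0 -leqn0 leqNgt k_gt0.
Qed.

Lemma splitting_cover z : z \in porbit s x ->
  porbit t z = porbit t x \/ porbit t z = porbit t y.
Proof.
rewrite porbit_traject => /trajectP[i lt_in ->]; rewrite -permX.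
case: (ltnP i k) => [lt_ik|le_ki]; [left|right]; apply/eqP.
  rewrite eq_porbit_mem splitting_porbit_left; apply/imsetP.
  by exists (Ordinal lt_ik).
rewrite eq_porbit_mem splitting_porbit_right; apply/imsetP.
have lt : (i - k < n - k)%N by rewrite ltn_sub2r.
by exists (Ordinal lt) => //=; rewrite subnKC.
Qed.

Lemma splitting_porbits :
  porbits t = porbit t x |: (porbit t y |: (porbits s :\ porbit s x)).
Proof.
apply/setP=> O; rewrite !inE; apply/imsetP/idP => [[z _ ->]|].
  case: (boolP (z \in porbit s x)) => [/splitting_cover[]->|zx].
  - by rewrite eqxx.
  - by rewrite eqxx orbT.
  rewrite splitting_porbit_other // eq_porbit_mem zx imset_f //.
  by rewrite !orbT.
case/or3P => [/eqP->|/eqP->|/andP[+ /imsetP[z _ Oz]]]; first by exists x.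
  by exists y.
by rewrite Oz eq_porbit_mem => zx; exists z; rewrite // splitting_porbit_other.
Qed.

Lemma splitting_notin z : z \in porbit s x ->
  porbit t z \notin porbits s :\ porbit s x.
Proof.
move=> zx; rewrite !inE; apply/andP => -[+ /imsetP[w _ eq_w]].
rewrite eq_w eq_porbit_mem => wx.
move: (splitting_porbit_other wx); rewrite -eq_w => /eqP.
rewrite eq_porbit_mem => wz.
have: z \in porbit s w by rewrite -eq_w porbit_id.
move: zx; rewrite -eq_porbit_mem => /eqP zx.
by rewrite -eq_porbit_mem zx eq_sym eq_porbit_mem (negPf wx).
Qed.

Lemma splitting_prod (F : comRingType) (f : nat -> F) :
  \prod_(O in porbits s) f #|O| =
    f n * \prod_(O in porbits s :\ porbit s x) f #|O| /\
  \prod_(O in porbits t) f #|O| =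
    f k * f (n - k)%N * \prod_(O in porbits s :\ porbit s x) f #|O|.
Proof.
have xx : x \in porbit s x := porbit_id _ _.
have yx : y \in porbit s x := mem_porbit _ _ _.
split; first by rewrite (big_setD1 (porbit s x)) ?imset_f.
rewrite splitting_porbits big_setU1; last first.
  by rewrite !in_setU1 negb_or splitting_left_proper splitting_notin.
rewrite big_setU1 ?splitting_notin //=.
by rewrite card_splitting_left card_splitting_right mulrA.
Qed.

End OrbitSplitting.

(** * The rank of a graph *)

Section EdgeSpan.
Variables (E W : finType).
Implicit Types (s t : E -> W) (A : {set E}) (u w : W).

Definition vertex_vec u : {ffun W -> ('F_2)^o} := [ffun x => (x == u)%:R].

Lemma ffunF2_addrr (v : {ffun W -> ('F_2)^o}) : v + v = 0.
Proof.
by apply/ffunP=> x; rewrite !ffunE; apply: (@addrr_pchar2 'F_2); exact: pchar_Fp.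
Qed.

Lemma ffunF2_oppr (v : {ffun W -> ('F_2)^o}) : - v = v.
Proof. by apply/eqP; rewrite eq_sym -addr_eq0 ffunF2_addrr. Qed.

(** Coefficients in F_2 make the vector of an edge independent of its orientation,
    so that every simple cycle, oriented or not, has edge vectors of sum 0. *)
Definition edge_vec s t (e : E) := vertex_vec (s e) + vertex_vec (t e).

Definition edge_span s t A := (\sum_(e in A) <[edge_vec s t e]>)%VS.

(** The number of vertices minus the number of connected components. *)
Definition graph_rank s t : nat := \dim (edge_span s t [set: E]).

Lemma mem_edge_span s t A e : e \in A -> edge_vec s t e \in edge_span s t A.
Proof. by move=> eA; rewrite memvE (sumv_sup e). Qed.

Lemma edge_spanP s t A (U : {vspace {ffun W -> ('F_2)^o}}) :
  (forall e, e \in A -> edge_vec s t e \in U) -> (edge_span s t A <= U)%VS.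
Proof. by move=> h; apply/subv_sumP => e /h; rewrite memvE. Qed.

Lemma dim_edge_span s t A : (\dim (edge_span s t A) <= #|A|)%N.
Proof.
apply: leq_trans (dimv_leq_sum _ _ _) _; rewrite -sum1_card leq_sum // => e _.
by rewrite dim_vline leq_b1.
Qed.

Lemma graph_rank_loops s t : (forall e, s e = t e) -> graph_rank s t = 0%N.
Proof.
move=> st; apply/eqP; rewrite dimv_eq0 -subv0; apply: edge_spanP => e _.
by rewrite /edge_vec st ffunF2_addrr mem0v.
Qed.

Lemma dim_add_line (U : {vspace {ffun W -> ('F_2)^o}}) v :
  (\dim (U + <[v]>) <= (\dim U).+1)%N.
Proof.
rewrite (leq_trans (dimv_add_leqif _ _).1) // -[(\dim U).+1]addn1 leq_add2l dim_vline leq_b1 //.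
Qed.

(** After the exchange, one more edge between the old sources [s b] and [s x]
    restores the span of both old edges. *)
Lemma graph_rank_swap s t b x :
  (graph_rank s t <= (graph_rank (s \o tperm b x) t).+1)%N.
Proof.
pose v := vertex_vec (s b) + vertex_vec (s x).
apply: leq_trans (dim_add_line (edge_span (s \o tperm b x) t setT) v).
apply/dimvS/edge_spanP => e _.
have mem f : edge_vec (s \o tperm b x) t f \in
    (edge_span (s \o tperm b x) t setT + <[v]>)%VS.
  by apply: (subvP (addvSl _ _)); exact: mem_edge_span.
have vm : v \in (edge_span (s \o tperm b x) t setT + <[v]>)%VS.
  by apply: (subvP (addvSr _ _)); exact: memv_line.
have cancel (p q r : {ffun W -> ('F_2)^o}) : (p + q) + (q + r) = p + r.
  by rewrite addrA -[p + q + q]addrA ffunF2_addrr addr0.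
have [->|ne_eb] := eqVneq e b.
  have -> : edge_vec s t b = v + edge_vec (s \o tperm b x) t b.
    by rewrite /edge_vec /= tpermL cancel.
  exact: rpredD.
have [->|ne_ex] := eqVneq e x.
  have -> : edge_vec s t x = v + edge_vec (s \o tperm b x) t x.
    by rewrite /edge_vec /= tpermR /v [_ (s b) + _]addrC cancel.
  exact: rpredD.
have -> : edge_vec s t e = edge_vec (s \o tperm b x) t e.
  by rewrite /edge_vec /= tpermD 1?eq_sym.
exact: mem.
Qed.

(** A closed walk enters a vertex as often as it leaves it. *)
Lemma sum_edge_vec_porbit s t (g : {perm E}) e : (forall f, t f = s (g f)) ->
  \sum_(f in porbit g e) edge_vec s t f = 0.
Proof.
move=> tsg; rewrite /edge_vec big_split /=.
suff -> : \sum_(f in porbit g e) vertex_vec (t f) =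
          \sum_(f in porbit g e) vertex_vec (s f) by rewrite ffunF2_addrr.
rewrite [RHS](reindex_inj (@perm_inj _ g)); apply: eq_big => f /=.
  by rewrite porbit_sym -(porbit_perm g 1 f) expg1 porbit_sym.
by rewrite tsg.
Qed.

(** The edges left after removing the edge [c O] from each orbit [O] of [g]. *)
Definition cut_orbits (g : {perm E}) (c : {set E} -> E) : {set E} :=
  [set e | e != c (porbit g e)].

Lemma card_cut_orbits (g : {perm E}) c :
  (forall e, c (porbit g e) \in porbit g e) ->
  #|cut_orbits g c| = (#|E| - #|porbits g|)%N.
Proof.
move=> cP; have -> : cut_orbits g c = ~: (c @: porbits g).
  apply/setP => e; rewrite !inE; congr (~~ _); apply/eqP/imsetP.
    by exists (porbit g e) => //; apply: imset_f.
  case=> O /imsetP[f _ ->] ->; congr c; apply/eqP.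
  by rewrite eq_sym eq_porbit_mem.
rewrite cardsCs setCK card_in_imset // => _ _ /imsetP[e _ ->] /imsetP[f _ ->] eq.
apply/eqP; rewrite eq_porbit_mem; have := cP f; rewrite -eq.
by rewrite -eq_porbit_mem => /eqP <-; rewrite porbit_sym.
Qed.

(** In a closed walk, each edge vector is the sum of the others. *)
Lemma edge_span_cut_orbits s t (g : {perm E}) c :
  (forall f, t f = s (g f)) -> (forall e, c (porbit g e) \in porbit g e) ->
  edge_span s t (cut_orbits g c) = edge_span s t setT.
Proof.
move=> tsg cP; apply/eqP; rewrite eqEsubv; apply/andP; split.
  by apply: edge_spanP => e _; apply: mem_edge_span.
apply: edge_spanP => e _.
have [ec|ec] := eqVneq e (c (porbit g e)); last first.
  by apply: mem_edge_span; rewrite inE.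
have := sum_edge_vec_porbit e tsg; rewrite (bigD1 e) ?porbit_id //=.
move/eqP; rewrite addr_eq0 ffunF2_oppr => /eqP ->.
apply: rpred_sum => f /andP[fe nfe]; apply: mem_edge_span; rewrite inE.
move: fe; rewrite -eq_porbit_mem => /eqP ->; rewrite -ec //.
Qed.

(** The least number of transpositions with product [g]. *)
Definition perm_length (g : {perm E}) := (#|E| - #|porbits g|)%N.

Lemma graph_rank_le_perm_length s t (g : {perm E}) :
  (forall f, t f = s (g f)) -> (graph_rank s t <= perm_length g)%N.
Proof.
move=> tsg; pose c (O : {set E}) e := odflt e [pick f in O].
case: (pickP E) => [e0 _|E0]; last first.
  by rewrite graph_rank_loops // => e; have := E0 e.
pose c0 O := c O e0.
have cP e : c0 (porbit g e) \in porbit g e.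
  by rewrite /c0 /c; case: pickP => //= /(_ e); rewrite porbit_id.
rewrite /graph_rank -(edge_span_cut_orbits tsg cP).
by apply: leq_trans (dim_edge_span _ _ _) _; rewrite card_cut_orbits.
Qed.

End EdgeSpan.

Lemma card_porbits_le (E : finType) (g : {perm E}) : (#|porbits g| <= #|E|)%N.
Proof. exact: leq_imset_card. Qed.

Lemma perm_length_mem (E : finType) (g : {perm E}) b x :
  b != x -> x \in porbit g b ->
  perm_length g = (perm_length (g * tperm b x)%g).+1.
Proof.
move=> bx xb; have := porbits_mul_tperm g^-1 b x => /=.
rewrite bx porbitV -{1}(tpermV b x) -invMg !porbitsV.
rewrite -porbit_sym xb /= addn0 addn1 => eq; rewrite /perm_length.
by rewrite eq subnSK // -eq card_porbits_le.
Qed.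

Lemma perm_length_notin (E : finType) (g : {perm E}) b x :
  x \notin porbit g b ->
  perm_length (g * tperm b x)%g = (perm_length g).+1.
Proof.
move=> xb; have bx : b != x by apply: contraNneq xb => <-; exact: porbit_id.
have := porbits_mul_tperm g^-1 b x => /=.
rewrite bx porbitV -{1}(tpermV b x) -invMg !porbitsV.
rewrite -porbit_sym xb /= addn1 addn2 => -[eq]; rewrite /perm_length.
by rewrite -[in RHS]eq subnSK // eq card_porbits_le.
Qed.

Lemma perm_length1 (E : finType) : perm_length (1 : {perm E})%g = 0%N.
Proof.
rewrite /perm_length /porbits card_imset ?cardE ?subnn // => x y /eqP.
rewrite eq_porbit_mem => /porbitP[i ->].
by rewrite expg1n perm1.
Qed.

(** * Decompositions of a graph into closed alternating walks *)

Lemma big_even_nat (F : nmodType) (G : nat -> F) p :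
  \sum_(0 <= k < 2 * p | ~~ odd k) G k = \sum_(0 <= q < p) G (2 * q)%N.
Proof.
elim: p => [|p IH]; first by rewrite muln0 !big_geq.
rewrite big_nat_recr //= -IH mulnS add2n big_mkcond /= [in RHS]big_mkcond /=.
by rewrite !big_nat_recr //= !mul2n odd_double /= addr0.
Qed.

Section ClosedWalks.
Variables (F : numFieldType) (E W : finType) (star : E -> bool).
Implicit Types (S : {set E}) (s t : E -> W) (g : {perm E}).

(** A decomposition of the graph into closed walks, oriented and with alternating
    stars: [g] sends an edge to the next one of its walk. The edges outside [S]
    are loops, each of them a walk by itself. *)
Definition alternating_walks S s t g : bool :=
  [&& perm_on S g, [forall e in S, star (g e) != star e]
    & [forall e, t e == s (g e)]].

Definition perm_weight g : F := \prod_(O in porbits g) cycle_weight F #|O|.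

(** The decompositions that reach the bound of [alternating_rank]. *)
Definition tight_walks S s t g : bool :=
  alternating_walks S s t g && (graph_rank s t == perm_length g).

(** The coefficient of the order [graph_rank s t] in 1/N of a moment of the
    graph, see [moment_leading]. *)
Definition leading S s t : F := \sum_(g | tight_walks S s t g) perm_weight g.

Lemma alternating_walksP S s t g :
  reflect [/\ perm_on S g, forall e, e \in S -> star (g e) = ~~ star e
            & forall e, t e = s (g e)] (alternating_walks S s t g).
Proof.
apply: (iffP and3P) => -[h1 h2 h3]; split=> //.
- move=> e eS; move/forall_inP: h2 => /(_ e eS); case: (star e);
  by case: (star _).
- by move=> e; apply/eqP; move/forallP: h3.
- by apply/forall_inP => e eS; rewrite h2 //; case: star.
- by apply/forallP => e; rewrite h3.
Qed.

Lemma alternating_rank S s t g :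
  alternating_walks S s t g -> (graph_rank s t <= perm_length g)%N.
Proof. by case/alternating_walksP=> _ _; apply: graph_rank_le_perm_length. Qed.

Lemma mulg_tpermK g b x : (g * tperm b x * tperm b x = g)%g.
Proof. by rewrite -mulgA tperm2 mulg1. Qed.

Lemma alternating_star_porbit S s t g b i :
  alternating_walks S s t g -> b \in S ->
  (g ^+ i)%g b \in S /\ star ((g ^+ i)%g b) = star b (+) odd i.
Proof.
move=> /alternating_walksP[gS gstar _] bS.
elim: i => [|i [iS IH]]; first by rewrite expg0 perm1 addbF.
rewrite expgSr permM (perm_closed _ gS); split=> //.
by rewrite gstar // IH /= addbN.
Qed.

(** The recursion of the cycle weights, read on a permutation: multiplying by
    [tperm b x] with [x] in the cycle of [b] cuts this cycle in two. *)
Lemma perm_weight_rec S s t g b : alternating_walks S s t g -> b \in S ->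
  perm_weight g = perm_weight (g * tperm b (g b))%g *+ (g (g b) == b) -
   \sum_(x in porbit g b | (x != b) && (star x == star b))
      perm_weight (g * tperm b x)%g.
Proof.
move=> gw bS; have stari i := (alternating_star_porbit i gw bS).2.
set n := #|porbit g b|.
have n_gt0 : (0 < n)%N by rewrite lt0n card_porbit_neq0.
have n_even : ~~ odd n.
  by have := stari n; rewrite porbit_exp_card; case: star; case: odd.
have [p nE] : exists p, n = (2 * p)%N.
  by exists n./2; rewrite mul2n -[LHS]odd_double_half (negPf n_even).
have p_gt0 : (0 < p)%N by rewrite lt0n; apply: contraTneq n_gt0; rewrite nE => ->.
pose rest := \prod_(O in porbits g :\ porbit g b) cycle_weight F #|O|.
have gE : perm_weight g = cycle_weight F n * rest.
  by rewrite /perm_weight (big_setD1 (porbit g b)) ?imset_f.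
have splitE k : (0 < k < n)%N -> perm_weight (g * tperm b ((g ^+ k)%g b))%g =
    cycle_weight F k * cycle_weight F (n - k) * rest.
  case/andP=> k0 kn; rewrite /perm_weight.
  by rewrite (splitting_prod k0 kn (cycle_weight F)).2.
have -> : perm_weight (g * tperm b (g b))%g *+ (g (g b) == b) =
          (p == 1%N)%:R * rest.
  have [p1|p1] := eqVneq p 1%N.
    have -> : g (g b) == b.
      have := porbit_exp_card g b; rewrite -/n nE p1 muln1 expgS expg1 permM.
      by move=> ->; rewrite eqxx.
    have := splitE 1%N; rewrite expg1 nE p1 => -> //.
    by rewrite cycle_weight1 mulr1.
  suff /negPf-> : g (g b) != b by rewrite mul0r.
  have := @porbit_exp_inj _ g b 2 0; rewrite -/n expg0 perm1 expgS expg1 permM.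
  by move=> -> //; rewrite nE; lia.
have -> : \sum_(x in porbit g b | (x != b) && (star x == star b))
      perm_weight (g * tperm b x)%g =
    \sum_(1 <= q < p) cycle_weight F (2 * q) * cycle_weight F (2 * (p - q)) * rest.
  rewrite (eq_bigl (fun x => (x \in traject g b n) &&
      ((x != b) && (star x == star b)))); last first.
    by move=> x; rewrite porbit_traject.
  rewrite big_mkcondr -big_uniq ?uniq_traject_porbit //= (big_nth b) size_traject.
  have -> : \sum_(1 <= q < p)
        cycle_weight F (2 * q) * cycle_weight F (2 * (p - q)) * rest =
      \sum_(0 <= q < p) (if (2 * q)%N == 0%N then 0 else
        cycle_weight F (2 * q) * cycle_weight F (2 * p - 2 * q) * rest).
    rewrite [in RHS](big_cat_nat (n := 1)) //= big_nat1 eqxx add0r.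
    apply: eq_big_nat => q /andP[q1 _]; rewrite mulnBr.
    by case: eqP => // q0; exfalso; lia.
  rewrite -(big_even_nat (fun k => if k == 0%N then 0 else
      cycle_weight F k * cycle_weight F (2 * p - k) * rest)) -nE.
  rewrite big_nat_cond [RHS]big_nat_cond.
  rewrite [RHS]big_mkcond [LHS]big_mkcond; apply: eq_bigr => k _.
  case: (boolP (0 <= k < n)%N) => //= kn; rewrite nth_traject // -permX stari.
  have -> : (star b (+) odd k == star b) = ~~ odd k.
    by case: star; case: odd.
  have := @porbit_exp_inj _ g b k 0 kn n_gt0; rewrite expg0 perm1 => ->.
  case: (eqVneq k 0%N) => //= k0; case: ifP => // _.
  by rewrite splitE // kn lt0n k0.
by rewrite -mulr_suml -mulrBl -cycle_weight_rec // -nE.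
Qed.

(** Edges [b] and [x] with the same star exchange their sources exactly when
    the walks through them exchange their continuations. *)
Lemma alternating_walks_swap S s t g b x :
  b \in S -> x \in S -> star x = star b ->
  alternating_walks S (s \o tperm b x) t (g * tperm b x)%g =
  alternating_walks S s t g.
Proof.
move=> bS xS sbx.
have tS : perm_on S (tperm b x).
  by apply/subsetP => e; rewrite inE; case: tpermP => [->|->|_ _ /eqP].
have st e : star (tperm b x e) = star e by case: tpermP => [->|->|].
have onE h : perm_on S h -> perm_on S (h * tperm b x)%g.
  by move=> hS; apply: perm_onM.
apply/alternating_walksP/alternating_walksP => -[h1 h2 h3]; split.
- by rewrite -(mulg_tpermK g b x); apply: onE.
- by move=> e eS; rewrite -h2 // permM st.
- by move=> e; rewrite h3 /= permM tpermK.
- exact: onE.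
- by move=> e eS; rewrite -h2 // permM st.
- by move=> e; rewrite h3 /= permM tpermK.
Qed.

(** Removing two opposite edges [a] and [b], turned into loops by the exchange of
    their sources, is removing a closed walk of length two. *)
Lemma alternating_walks_cut S s t g b a :
  b \in S -> star b ->
  [&& a \in S, ~~ star a, s a == t b, t a == s b &
    alternating_walks (S :\ b :\ a) (s \o tperm b a) t (g * tperm b a)%g] =
  [&& alternating_walks S s t g, g b == a & g a == b].
Proof.
move=> bS sb; apply/and5P/and3P.
  case=> aS sa /eqP sab /eqP tab /alternating_walksP[h1 h2 h3].
  have ne : b != a by apply: contraTneq sb => ->.
  have gb : g b = a.
    have : (g * tperm b a)%g b = b by apply: (out_perm h1); rewrite !inE eqxx andbF.
    by rewrite permM => /(congr1 (tperm b a)); rewrite tpermK tpermL.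
  have ga : g a = b.
    have : (g * tperm b a)%g a = a by apply: (out_perm h1); rewrite !inE eqxx.
    by rewrite permM => /(congr1 (tperm b a)); rewrite tpermK tpermR.
  have oE e : e != b -> e != a -> (g * tperm b a)%g e = g e.
    move=> eb ea; rewrite permM tpermD // eq_sym.
      by rewrite -ga (inj_eq perm_inj).
    by rewrite -gb (inj_eq perm_inj).
  split; rewrite ?gb ?ga //; apply/alternating_walksP; split.
  - apply/subsetP => e; rewrite inE.
    have [->//|eb] := eqVneq e b; have [->//|ea] := eqVneq e a.
    rewrite -oE // => ge; have : e \in S :\ b :\ a.
      by apply: (subsetP h1); rewrite inE.
    by rewrite !inE => /and3P[].
  - move=> e eS; have [->|eb] := eqVneq e b; first by rewrite gb sb (negPf sa).
    have [->|ea] := eqVneq e a; first by rewrite ga sb.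
    by rewrite -oE // h2 // !inE eb ea.
  - by move=> e; rewrite h3 /= permM tpermK.
case=> /alternating_walksP[h1 h2 h3] /eqP gb /eqP ga.
have aS : a \in S by rewrite -gb (perm_closed _ h1).
have sa : ~~ star a by rewrite -gb h2 // sb.
have ne : b != a by apply: contraTneq sb => ->.
have oE e : e != b -> e != a -> (g * tperm b a)%g e = g e.
  move=> eb ea; rewrite permM tpermD // eq_sym.
    by rewrite -ga (inj_eq perm_inj).
  by rewrite -gb (inj_eq perm_inj).
split=> //; first by rewrite h3 gb.
  by rewrite h3 ga.
apply/alternating_walksP; split.
- apply/subsetP => e; rewrite inE !inE.
  have [->|ea] := eqVneq e a; first by rewrite permM ga tpermL eqxx.
  have [->|eb] := eqVneq e b; first by rewrite permM gb tpermR eqxx.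
  by rewrite oE // => ge; apply: (subsetP h1); rewrite inE.
- by move=> e; rewrite !inE => /and3P[ea eb eS]; rewrite oE // h2.
- by move=> e; rewrite h3 /= permM tpermK.
Qed.

(** The exchange lowers the rank by at most one and changes the length by one,
    and the rank never exceeds the length. So if the rank goes down and the walks
    are tight afterwards, then they were tight before and a cycle was cut. *)
Lemma tight_swapE S s t g b x : b != x -> alternating_walks S s t g ->
  (forall f, t f = (s \o tperm b x) ((g * tperm b x)%g f)) ->
  ((graph_rank (s \o tperm b x) t).+1 == graph_rank s t) &&
  (graph_rank (s \o tperm b x) t == perm_length (g * tperm b x)%g) =
  (graph_rank s t == perm_length g) && (x \in porbit g b).
Proof.
move=> bx gw gtw.
have le := alternating_rank gw.
have le' := graph_rank_le_perm_length gtw.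
have sw := graph_rank_swap s t b x.
case: (boolP (x \in porbit g b)) => xb.
  have len := perm_length_mem bx xb; rewrite andbT.
  apply/andP/eqP => [[/eqP h1 /eqP h2]|h]; first by rewrite -h1 h2 len.
  split; apply/eqP; lia.
have len := perm_length_notin xb; rewrite andbF.
by apply/negP => /andP[/eqP h1 /eqP h2]; lia.
Qed.

(** The leading coefficient obeys the loop equation, truncated to the terms that
    lower the rank of the graph. *)
Lemma leading_rec S s t b : b \in S -> star b ->
  leading S s t =
  \sum_(a in S | [&& ~~ star a, s a == t b & t a == s b])
     leading (S :\ b :\ a) (s \o tperm b a) t *+
       ((graph_rank (s \o tperm b a) t).+1 == graph_rank s t)
  - \sum_(x in S | star x && (x != b)) leading S (s \o tperm b x) t *+
       ((graph_rank (s \o tperm b x) t).+1 == graph_rank s t).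
Proof.
move=> bS sb.
have shift (S' : {set E}) x :
    leading S' (s \o tperm b x) t *+
       ((graph_rank (s \o tperm b x) t).+1 == graph_rank s t) =
    \sum_(g : {perm E}) perm_weight (g * tperm b x)%g *+
       [&& alternating_walks S' (s \o tperm b x) t (g * tperm b x)%g,
        (graph_rank (s \o tperm b x) t).+1 == graph_rank s t &
        graph_rank (s \o tperm b x) t == perm_length (g * tperm b x)%g].
  rewrite /leading -sumrMnl (reindex_inj (mulIg (tperm b x))) /= big_mkcond.
  apply: eq_bigr => g _; rewrite /tight_walks.
  by case: (alternating_walks _ _ _ _); case: (_ == graph_rank s t);
    case: (_ == perm_length _).
under [X in _ = X - _]eq_bigr do rewrite shift.
under [X in _ = _ - X]eq_bigr do rewrite shift.
rewrite exchange_big [X in _ = _ - X]exchange_big -sumrB /= /leading big_mkcond.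
apply: eq_bigr => g _ /=.
have -> : \sum_(a in S | [&& ~~ star a, s a == t b & t a == s b])
     perm_weight (g * tperm b a)%g *+
       [&& alternating_walks (S :\ b :\ a) (s \o tperm b a) t (g * tperm b a)%g,
        (graph_rank (s \o tperm b a) t).+1 == graph_rank s t &
        graph_rank (s \o tperm b a) t == perm_length (g * tperm b a)%g] =
    (perm_weight (g * tperm b (g b))%g *+ (g (g b) == b)) *+ tight_walks S s t g.
  rewrite big_mkcond (bigD1 (g b)) //= big1 ?addr0 => [|a ne]; last first.
    have := alternating_walks_cut s t g a bS sb.
    rewrite [g b == a]eq_sym (negPf ne) andbF => /negbT.
    case: ifP => // /and4P[-> -> -> ->]; case: (alternating_walks _ _ _ _) => //.
  have := alternating_walks_cut s t g (g b) bS sb; rewrite eqxx /=.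
  case: ifP => [/and4P[-> sa -> ->]|/negbT].
    rewrite sa /= => -> ; rewrite -mulrnA mulnb /tight_walks.
    case: (boolP (alternating_walks S s t g)) => [gw|_] /=; last by rewrite andbF.
    have ne : b != g b by apply: contraTneq sb => ->.
    case: eqP => //= ggb; rewrite ?andbF //.
    rewrite (tight_swapE ne gw); last first.
      by move=> f; case/alternating_walksP: gw => _ _ ->; rewrite /= permM tpermK.
    by have := mem_porbit g 1 b; rewrite expg1 => ->; rewrite andbT.
  move=> h1 h2; rewrite /tight_walks -mulrnA mulnb.
  suff /negPf-> : ~~ ((g (g b) == b) &&
      (alternating_walks S s t g && (graph_rank s t == perm_length g))) by [].
  apply/negP => /and3P[h3 h4 _]; move: h2; rewrite h3 h4 /= => h2.
  by case/and5P: h2 h1 => -> -> -> ->.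
have -> : \sum_(x in S | star x && (x != b)) perm_weight (g * tperm b x)%g *+
       [&& alternating_walks S (s \o tperm b x) t (g * tperm b x)%g,
        (graph_rank (s \o tperm b x) t).+1 == graph_rank s t &
        graph_rank (s \o tperm b x) t == perm_length (g * tperm b x)%g] =
    (\sum_(x in porbit g b | (x != b) && (star x == star b))
      perm_weight (g * tperm b x)%g) *+ tight_walks S s t g.
  rewrite -sumrMnl big_mkcond [RHS]big_mkcond; apply: eq_bigr => x _ /=.
  rewrite sb eqb_id; case: (boolP (star x)) => sx; rewrite ?andbF //= andbT.
  case: (eqVneq x b) => [|xb]; rewrite ?andbF //= !andbT.
  case: (boolP (x \in S)) => xS.
    rewrite alternating_walks_swap ?sx ?sb // /tight_walks.
    case: (boolP (alternating_walks S s t g)) => /= gw; last first.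
      by rewrite !mulr0n; case: ifP.
    have bx : b != x by rewrite eq_sym.
    rewrite (tight_swapE bx gw); last first.
      by move=> f; case/alternating_walksP: gw => _ _ ->; rewrite /= permM tpermK.
    by case: (x \in porbit g b); rewrite ?andbT ?andbF.
  case: ifP => // /porbitP[i xi]; rewrite /tight_walks.
  case: (boolP (alternating_walks S s t g)) => //= gw.
  by move: xS; rewrite xi (alternating_star_porbit i gw bS).1.
case: (boolP (tight_walks S s t g)) => [/andP[gw _]|_].
  by rewrite !mulr1n; apply: perm_weight_rec gw bS.
by rewrite !mulr0n subrr.
Qed.

Lemma leading_set0 s t : (forall e, s e = t e) -> leading set0 s t = 1.
Proof.
move=> st; rewrite /leading (big_pred1 1%g).
  rewrite /perm_weight big1 // => O /imsetP[e _ ->].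
  suff -> : porbit 1%g e = [set e] by rewrite cards1 cycle_weight1.
  apply/setP => f; rewrite inE; apply/porbitP/eqP => [[i ->]|->].
    by rewrite expg1n perm1.
  by exists 0%N; rewrite expg0 perm1.
move=> g /=; rewrite /tight_walks; apply/andP/eqP => [[]|->].
  move=> /alternating_walksP[g0 _ _] _; apply/permP => e; rewrite perm1.
  by apply: (out_perm g0); rewrite inE.
split; last by rewrite graph_rank_loops // perm_length1.
apply/alternating_walksP; split => [||e]; rewrite ?perm1 ?st //.
  exact: perm_on1.
by move=> e; rewrite inE.
Qed.

Lemma leading_nostar S s t : S != set0 -> (forall e, e \in S -> ~~ star e) ->
  leading S s t = 0.
Proof.
case/set0Pn=> e eS nostar; rewrite /leading big_pred0 // => g.
apply/negP => /andP[/alternating_walksP[gS gstar _] _].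
have := nostar (g e); rewrite (perm_closed _ gS) gstar // => /(_ eS).
by rewrite nostar.
Qed.

End ClosedWalks.

(** * Ranks of disjoint unions and of images of connected graphs *)

Section TwoColours.
Variables (E W : finType) (s t : E -> W) (colour : W -> bool).
Hypothesis colour_edge : forall e, colour (s e) = colour (t e).
Variables (b x : E).
Hypothesis colour_bx : colour (s b) != colour (s x).

(** The edge vectors before the exchange are the images of those after it by the
    linear map [v |-> v + f v (s b + s x)], with [f] the sum of the coordinates on
    the vertices coloured like [s b]: [f] vanishes on all edges but the exchanged
    ones. *)
Lemma graph_rank_swap_colour :
  (graph_rank s t <= graph_rank (s \o tperm b x) t)%N.
Proof.
pose w : {ffun W -> ('F_2)^o} := vertex_vec (s b) + vertex_vec (s x).
pose f (v : {ffun W -> ('F_2)^o}) : 'F_2 :=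
  \sum_(u | colour u == colour (s b)) (v u : 'F_2).
pose g (v : {ffun W -> ('F_2)^o}) := v + f v *: w.
have g_lin : linear g.
  move=> a u v; rewrite /g.
  have -> : f (a *: u + v) = a * f u + f v.
    rewrite /f mulr_sumr -big_split; apply: eq_bigr => z _ /=.
    by rewrite !ffunE.
  by move: (w) => w'; rewrite [in RHS]scalerDr scalerA scalerDl addrACA.
pose gL := GRing.isLinear.Build _ _ _ _ g g_lin.
pose g' : {linear _ -> _} := HB.pack g gL.
have fE u : f (vertex_vec u) = (colour u == colour (s b))%:R.
  rewrite /f; case: (boolP (colour u == _)) => cu.
    rewrite (bigD1 u) //= ffunE eqxx big1 ?addr0 // => z /andP[_ /negPf nz].
    by rewrite ffunE nz.
  rewrite big1 // => z cz; rewrite ffunE; case: eqP => // zu.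
  by rewrite -zu cz in cu.
have fD u v : f (u + v) = f u + f v.
  by rewrite /f -big_split; apply: eq_bigr => z _; rewrite ffunE.
have F2 (c : 'F_2) : c + c = 0 by apply: (@addrr_pchar2 'F_2); exact: pchar_Fp.
have cancel (p q r : {ffun W -> ('F_2)^o}) : (p + q) + (q + r) = p + r.
  by rewrite addrA -[p + q + q]addrA ffunF2_addrr addr0.
have gE e : edge_vec s t e = g (edge_vec (s \o tperm b x) t e).
  rewrite /g /edge_vec fD !fE -colour_edge /=.
  have [->|eb] := eqVneq e b.
    rewrite tpermL eq_sym (negPf colour_bx) eqxx add0r scale1r.
    by rewrite /w [RHS]addrC cancel.
  have [->|ex] := eqVneq e x.
    rewrite tpermR eqxx eq_sym (negPf colour_bx) addr0 scale1r.
    by rewrite /w [RHS]addrC [vertex_vec (s b) + vertex_vec (s x)]addrC cancel.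
  by rewrite tpermD 1?eq_sym // F2 scale0r addr0.
have -> : graph_rank s t =
    \dim (linfun g' @: edge_span (s \o tperm b x) t setT)%VS.
  rewrite /graph_rank /edge_span limg_sum; congr (\dim _).
  by apply: eq_bigr => e _; rewrite limg_line lfunE /= gE.
by rewrite /graph_rank -(limg_ker_dim (linfun g') (edge_span _ _ _)) leq_addl.
Qed.

End TwoColours.

Section RankOfImage.
Variables (E V W : finType) (src tgt : E -> V) (phi : V -> W).
Let span := edge_span (phi \o src) (phi \o tgt) [set: E].
Let rank := graph_rank (phi \o src) (phi \o tgt).

Lemma dim_vertex_span (D : {set W}) :
  \dim (\sum_(u in D) <[vertex_vec u]>)%VS = #|D|.
Proof.
elim: {D}_.+1 {-2}D (ltnSn #|D|) => // n IH D; rewrite ltnS => Dn.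
have [->|[u uD]] := set_0Vmem D; first by rewrite big_set0 dimv0 cards0.
rewrite (big_setD1 u) //= dimv_disjoint_sum.
  rewrite dim_vline IH; last first.
    by rewrite [#|D|](cardsD1 u) uD in Dn.
  rewrite [RHS](cardsD1 u) uD; congr (_ + _)%N.
  apply/eqP; rewrite eqb1; apply/eqP => /ffunP/(_ u).
  by rewrite !ffunE eqxx => /eqP; rewrite oner_eq0.
apply/eqP; rewrite -subv0; apply/subvP => v; rewrite memv_cap => /andP[].
case/vlineP=> k -> /memv_sumP[w wP kE].
suff -> : k = 0 by rewrite scale0r mem0v.
have /ffunP/(_ u) := kE; rewrite !ffunE eqxx => kE1; rewrite -[k]mulr1; apply: etrans kE1 _.
rewrite sum_ffunE big1 // => z; rewrite !inE => /andP[zu zD].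
have /vlineP[l ->] : w z \in <[vertex_vec z]>%VS by apply: wP; rewrite !inE zu.
by rewrite !ffunE eq_sym (negPf zu) scaler0.
Qed.

Lemma connect_edge_span u v : connect (adjacent src tgt) u v ->
  vertex_vec (phi u) + vertex_vec (phi v) \in span.
Proof.
case/connectP=> p; elim: p u => [|w p IH] u /=; first by move=> _ ->;
  rewrite ffunF2_addrr mem0v.
case/andP=> /existsP[e uw] pw /(IH _ pw) wv.
have -> : vertex_vec (phi u) + vertex_vec (phi v) =
    (vertex_vec (phi u) + vertex_vec (phi w)) +
    (vertex_vec (phi w) + vertex_vec (phi v)).
  by rewrite addrA -[_ + _ + vertex_vec (phi w)]addrA ffunF2_addrr addr0.
apply: rpredD => //; have := mem_edge_span (phi \o src) (phi \o tgt) (in_setT e).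
by case/orP: uw => /andP[/eqP<- /eqP<-] //; rewrite addrC.
Qed.

(** The span of the edges and of [Z] contains all the vertices of the image. *)
Lemma card_image_le_rank (Z : {set W}) :
  (forall v, exists2 z, z \in Z & vertex_vec (phi v) + vertex_vec z \in span) ->
  (#|phi @: V| <= rank + #|Z|)%N.
Proof.
move=> Zspan; rewrite -dim_vertex_span -(dim_vertex_span Z).
apply: leq_trans (dimv_add_leqif _ _).1; apply/dimvS/subv_sumP => _ /imsetP[v _ ->].
have [z zZ vz] := Zspan v.
have -> : vertex_vec (phi v) =
    (vertex_vec (phi v) + vertex_vec z) + vertex_vec z.
  by rewrite -addrA ffunF2_addrr addr0.
by rewrite -memvE memv_add // memvE (sumv_sup z).
Qed.

(** The sums of a fixed vertex with the other ones form a basis of the span of a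
    connected graph. *)
Lemma rank_connected (v0 : V) :
  (forall u v, connect (adjacent src tgt) u v) -> rank.+1 = #|phi @: V|.
Proof.
move=> conn; apply/eqP; rewrite eqn_leq; apply/andP; split; last first.
  rewrite -addn1 -(cards1 (phi v0)); apply: card_image_le_rank => v.
  by exists (phi v0); [rewrite inE|exact: connect_edge_span].
rewrite (cardsD1 (phi v0)) imset_f //= ltnS.
pose U := (\sum_(u in (phi @: V) :\ phi v0)
   <[vertex_vec u + vertex_vec (phi v0)]>)%VS.
have mem v : vertex_vec (phi v) + vertex_vec (phi v0) \in U.
  have [->|ne] := eqVneq (phi v) (phi v0); first by rewrite ffunF2_addrr mem0v.
  by rewrite memvE /U (sumv_sup (phi v)) // !inE ne imset_f.
have le : (span <= U)%VS.
  apply: edge_spanP => e _.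
  have -> : edge_vec (phi \o src) (phi \o tgt) e =
      (vertex_vec (phi (src e)) + vertex_vec (phi v0)) +
      (vertex_vec (phi (tgt e)) + vertex_vec (phi v0)).
    by rewrite addrACA ffunF2_addrr addr0.
  exact: rpredD.
apply: leq_trans (dimvS le) _; apply: leq_trans (dimv_leq_sum _ _ _) _.
by rewrite -sum1_card leq_sum // => u _; rewrite dim_vline leq_b1.
Qed.

End RankOfImage.

(** * Asymptotics of the solutions of the loop equation *)

Section LoopAsymptotics.
Variables (F : numFieldType) (E : finType) (star : E -> bool).
Implicit Types (S : {set E}).

(** The properties of the moments of a Haar matrix of size [N] that determine
    their asymptotics. The estimates below are uniform in [N] and in the indices
    [s] and [t], in order to be summed over all maps from a graph to ['I_N]. *)
Record loop_moments (N : nat) (M : {set E} -> (E -> 'I_N) -> (E -> 'I_N) -> F) :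
    Prop := LoopMoments {
  loop_gt0 : (0 < N)%N;
  loop_ext : forall S s s' t, {in S, s =1 s'} -> M S s t = M S s' t;
  loop_bound : forall S s t, `|M S s t| <= 2;
  loop_set0 : forall s t, M set0 s t = 1;
  loop_nostar : forall S s t, S != set0 -> (forall e, e \in S -> ~~ star e) ->
    M S s t = 0;
  loop_eq : forall S s t b, b \in S -> star b ->
    N%:R * M S s t =
    \sum_(a in S | [&& ~~ star a, s a == t b & t a == s b])
       M (S :\ b :\ a) (s \o tperm b a) t
    - \sum_(x in S | star x && (x != b)) M S (s \o tperm b x) t
}.

Lemma norm_sum_le (I : finType) (Q : pred I) (f : I -> F) (c : F) : 0 <= c ->
  (forall i, Q i -> `|f i| <= c) -> `|\sum_(i | Q i) f i| <= #|I|%:R * c.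
Proof.
move=> c0 fc; apply: le_trans (ler_norm_sum _ _ _) _.
rewrite mulr_natl -sumr_const big_mkcond /=; apply: ler_sum => i _.
by case: ifP => // /fc.
Qed.

Lemma inv_nat_itv N : (0 < N)%N -> 0 <= (N%:R^-1 : F) <= 1.
Proof.
by move=> N0; rewrite invr_ge0 ler0n invf_le1 ?ltr0n // ler1n.
Qed.

Lemma swap_loops S (W : eqType) (s t : E -> W) b x : b \in S -> x \in S ->
  (forall e, e \notin S -> s e = t e) ->
  forall e, e \notin S -> (s \o tperm b x) e = t e.
Proof.
move=> bS xS st e eS /=; rewrite tpermD ?st //.
  by apply: contraNneq eS => <-.
by apply: contraNneq eS => <-.
Qed.

Lemma cut_loops S (W : eqType) (s t : E -> W) b a : s a = t b -> t a = s b ->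
  (forall e, e \notin S -> s e = t e) ->
  forall e, e \notin S :\ b :\ a -> (s \o tperm b a) e = t e.
Proof.
move=> sa ta st e eS /=; have [->|ea] := eqVneq e a; first by rewrite tpermR ta.
have [->|eb] := eqVneq e b; first by rewrite tpermL.
by rewrite tpermD 1?eq_sym // st //; move: eS; rewrite !inE ea eb.
Qed.

Section FixedSize.
Variables (N : nat) (M : {set E} -> (E -> 'I_N) -> (E -> 'I_N) -> F).
Hypothesis HM : loop_moments M.
Let q : F := N%:R^-1.

Lemma loop_eqV S s t b : b \in S -> star b ->
  M S s t =
  \sum_(a in S | [&& ~~ star a, s a == t b & t a == s b])
     q * M (S :\ b :\ a) (s \o tperm b a) t
  - \sum_(x in S | star x && (x != b)) q * M S (s \o tperm b x) t.
Proof.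
move=> bS sb; rewrite -!mulr_sumr -mulrBr -(loop_eq HM) //.
by rewrite mulKf // pnatr_eq0 -lt0n (loop_gt0 HM).
Qed.

Lemma ler_exp_inv m n : (n <= m)%N -> q ^+ m <= q ^+ n.
Proof.
have /andP[q0 q1] := inv_nat_itv (loop_gt0 HM).
by move=> nm; apply: ler_wiXn2l.
Qed.

Lemma exp_inv_ge0 m : 0 <= q ^+ m.
Proof. by have /andP[q0 q1] := inv_nat_itv (loop_gt0 HM); exact: exprn_ge0. Qed.

End FixedSize.

(** Each use of the loop equation gains a factor 1/N and loses at most one unit
    of rank. The edges removed by the loop equation are kept as loops, which do
    not contribute to the rank. *)
Lemma moment_decay m : exists C : nat, forall N M, @loop_moments N M ->
  forall S s t, (forall e, e \notin S -> s e = t e) ->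
  `|M S s t| <= C%:R * N%:R^-1 ^+ (minn (graph_rank s t) m).
Proof.
elim: m => [|m [C IH]].
  by exists 2%N => N M HM S s t _; rewrite minn0 expr0 mulr1 (loop_bound HM).
exists (1 + (#|E| * C + #|E| * C))%N => N M HM S s t st.
set q : F := N%:R^-1; have q0 k := exp_inv_ge0 HM k; rewrite -/q in q0.
have [S0|S0] := eqVneq S set0.
  rewrite S0 (loop_set0 HM) graph_rank_loops; last by move=> e; rewrite st // S0 inE.
  by rewrite min0n expr0 mulr1 normr1 ler1n.
case: (pickP [pred b in S | star b]) => [b /andP[/= bS sb]|nostar]; last first.
  rewrite (loop_nostar HM) ?normr0 ?mulr_ge0 ?ler0n // => e eS.
  by have /negbT := nostar e; rewrite /= eS.
rewrite (loop_eqV HM s t bS sb).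
set c := C%:R * q ^+ minn (graph_rank s t) m.+1.
have c0 : 0 <= c by rewrite mulr_ge0 ?ler0n.
have qM r' (M' : F) : (graph_rank s t <= r'.+1)%N ->
    `|M'| <= C%:R * q ^+ minn r' m -> `|q * M'| <= c.
  have q1 : 0 <= q by have := q0 1%N; rewrite expr1.
  move=> rr le; rewrite normrM (ger0_norm q1).
  apply: le_trans (ler_wpM2l q1 le) _.
  rewrite mulrCA -exprS ler_wpM2l ?ler0n // (ler_exp_inv HM) //.
  lia.
apply: le_trans (ler_normB _ _) _.
have -> : (1 + (#|E| * C + #|E| * C))%:R * q ^+ minn (graph_rank s t) m.+1 =
    q ^+ minn (graph_rank s t) m.+1 + (#|E|%:R * c + #|E|%:R * c).
  by rewrite /c natrD mulrDl mul1r natrD natrM mulrDl -mulrA.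
apply: le_trans (_ : _ <= #|E|%:R * c + #|E|%:R * c) _; last by rewrite lerDr.
apply: lerD; apply: norm_sum_le => // a.
  case/andP=> aS /and3P[sa /eqP sab /eqP tab].
  apply: (qM (graph_rank (s \o tperm b a) t)); first exact: graph_rank_swap.
  by apply: (IH _ _ HM); exact: cut_loops.
case/andP=> aS /andP[sa _].
apply: (qM (graph_rank (s \o tperm b a) t)); first exact: graph_rank_swap.
by apply: (IH _ _ HM); exact: swap_loops.
Qed.

Lemma graph_rank_le_edges (W : finType) (s t : E -> W) : (graph_rank s t <= #|E|)%N.
Proof. by rewrite -cardsT; exact: dim_edge_span. Qed.

Lemma moment_decay_rank : exists C : nat, forall N M, @loop_moments N M ->
  forall S s t, (forall e, e \notin S -> s e = t e) ->
  `|M S s t| <= C%:R * N%:R^-1 ^+ graph_rank s t.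
Proof.
have [C HC] := moment_decay #|E|; exists C => N M HM S s t st.
by have := HC N M HM S s t st; rewrite (minn_idPl (graph_rank_le_edges s t)).
Qed.

(** In the loop equation for a moment of rank [r], the terms of rank at least [r]
    are negligible by [moment_decay_rank], and the other terms are those of
    [leading_rec]. *)
Lemma moment_leading_lt m : exists C : nat, forall N M, @loop_moments N M ->
  forall S s t, (forall e, e \notin S -> s e = t e) -> (graph_rank s t < m)%N ->
  `|M S s t - N%:R^-1 ^+ graph_rank s t * leading F star S s t| <=
    C%:R * N%:R^-1 ^+ (graph_rank s t).+1.
Proof.
have [D HD] := moment_decay_rank.
elim: m => [|m [C IH]]; first by exists 0%N.
exists (#|E| * (C + D) + #|E| * (C + D))%N => N M HM S s t st rm.
set q : F := N%:R^-1; have q0 k := exp_inv_ge0 HM k; rewrite -/q in q0.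
have [S0|S0] := eqVneq S set0.
  have st' e : s e = t e by apply: st; rewrite S0 inE.
  rewrite S0 (loop_set0 HM) leading_set0 // graph_rank_loops //.
  by rewrite expr0 mulr1 subrr normr0 mulr_ge0 // ler0n.
case: (pickP [pred b in S | star b]) => [b /andP[/= bS sb]|nostar]; last first.
  have ns e : e \in S -> ~~ star e.
    by move=> eS; have /negbT := nostar e; rewrite /= eS.
  by rewrite (loop_nostar HM) // leading_nostar // mulr0 subrr normr0 mulr_ge0 // ler0n.
rewrite (loop_eqV HM s t bS sb) (leading_rec F s t bS sb).
set r := graph_rank s t; rewrite -/q.
set A1 := \sum_(a in S | _) _; set B1 := \sum_(x in S | _) _.
set A2 := \sum_(a in S | _) _; set B2 := \sum_(x in S | _) _.
have -> : A2 - B2 - q ^+ r * (A1 - B1) = (A2 - q ^+ r * A1) - (B2 - q ^+ r * B1).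
  by move: (q ^+ r) => qr; ring.
rewrite /A1 /A2 /B1 /B2 !mulr_sumr -!sumrB.
set c := (C + D)%:R * q ^+ r.+1.
have c0 : 0 <= c by rewrite mulr_ge0 ?ler0n.
have qM S' s' : (r <= (graph_rank s' t).+1)%N ->
    (forall e, e \notin S' -> s' e = t e) ->
    `|q * M S' s' t - q ^+ r * (leading F star S' s' t *+
      ((graph_rank s' t).+1 == r))| <= c.
  move=> rr s't; have q1 : 0 <= q by have := q0 1%N; rewrite expr1.
  have nq : `|q| = q by rewrite ger0_norm.
  case: eqP => [eq|ne].
    rewrite mulr1n -eq exprS -mulrA -mulrBr normrM nq.
    apply: le_trans (ler_wpM2l q1 (IH _ _ HM _ _ _ s't _)) _; first by lia.
    rewrite mulrCA -exprS /c eq ler_wpM2r // ler_nat; lia.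
  rewrite mulr0n mulr0 subr0 normrM nq.
  apply: le_trans (ler_wpM2l q1 (HD _ _ HM _ _ _ s't)) _.
  rewrite mulrCA -exprS /c; apply: ler_pM; rewrite ?ler0n //.
    by rewrite ler_nat; lia.
  by apply: (ler_exp_inv HM); lia.
apply: le_trans (ler_normB _ _) _.
rewrite natrD natrM mulrDl -mulrA; apply: lerD; apply: norm_sum_le => // a.
  case/andP=> aS /and3P[sa /eqP sab /eqP tab].
  by apply: qM; [exact: graph_rank_swap|exact: cut_loops].
case/andP=> aS /andP[sa _].
by apply: qM; [exact: graph_rank_swap|exact: swap_loops].
Qed.

Lemma moment_leading : exists C : nat, forall N M, @loop_moments N M ->
  forall S s t, (forall e, e \notin S -> s e = t e) ->
  `|M S s t - N%:R^-1 ^+ graph_rank s t * leading F star S s t| <=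
    C%:R * N%:R^-1 ^+ (graph_rank s t).+1.
Proof.
have [C HC] := moment_leading_lt #|E|.+1; exists C => N M HM S s t st.
by apply: HC; rewrite ?ltnS ?graph_rank_le_edges.
Qed.

(** The moment of a disjoint union and the product of the moments of its two
    parts obey the same loop equation, but for the exchanges between the two
    parts; these do not lower the rank, so they are negligible. *)
Lemma moment_decorrelation_min (c : E -> bool) m : exists C : nat,
  forall N M, @loop_moments N M -> forall (col : 'I_N -> bool) S s t,
  (forall e, e \notin S -> s e = t e) ->
  (forall e, col (s e) = c e) -> (forall e, col (t e) = c e) ->
  `|M S s t - M [set e in S | c e] s t * M [set e in S | ~~ c e] s t| <=
    C%:R * N%:R^-1 ^+ minn (graph_rank s t).+1 m.
Proof.
have [D HD] := moment_decay_rank.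
elim: m => [|m [C IH]].
  exists 6%N => N M HM col S s t _ _ _; rewrite minn0 expr0 mulr1.
  apply: le_trans (ler_normB _ _) _; rewrite normrM.
  have -> : 6%:R = 2 + 2 * 2 :> F by rewrite -natrM -natrD.
  by apply: lerD; [|apply: ler_pM => //]; exact: (loop_bound HM).
exists (#|E| * C + (#|E| * C + #|E| * D))%N => N M HM col S s t st cs ct.
set q : F := N%:R^-1; have q0 k := exp_inv_ge0 HM k; rewrite -/q in q0.
have q1 : 0 <= q by have := q0 1%N; rewrite expr1.
have nq : `|q| = q by rewrite ger0_norm.
have [S0|S0] := eqVneq S set0.
  have -> : [set e in S | c e] = set0 by apply/setP => e; rewrite S0 !inE.
  have -> : [set e in S | ~~ c e] = set0 by apply/setP => e; rewrite S0 !inE.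
  by rewrite S0 !(loop_set0 HM) mul1r subrr normr0 mulr_ge0 // ler0n.
case: (pickP [pred b in S | star b]) => [b /andP[/= bS sb]|nostar]; last first.
  have ns e : e \in S -> ~~ star e.
    by move=> eS; have /negbT := nostar e; rewrite /= eS.
  rewrite (loop_nostar HM) // sub0r normrN.
  suff -> : M [set e in S | c e] s t * M [set e in S | ~~ c e] s t = 0.
    by rewrite normr0 mulr_ge0 // ler0n.
  have [e eS] := set0Pn _ S0; case: (boolP (c e)) => ce.
    rewrite (loop_nostar HM) ?mul0r //; first by apply/set0Pn; exists e; rewrite inE eS.
    by move=> f; rewrite inE => /andP[/ns].
  rewrite [X in _ * X](loop_nostar HM) ?mulr0 //.
    by apply/set0Pn; exists e; rewrite inE eS.
  by move=> f; rewrite inE => /andP[/ns].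
pose S1 (T : {set E}) := [set e in T | c e == c b].
pose S2 (T : {set E}) := [set e in T | c e != c b].
have split12 (T : {set E}) s' : M [set e in T | c e] s' t * M [set e in T | ~~ c e] s' t =
    M (S1 T) s' t * M (S2 T) s' t.
  rewrite /S1 /S2; case: (c b).
    by congr (M _ _ _ * M _ _ _); apply/setP => e; rewrite !inE; case: (c e).
  by rewrite mulrC; congr (M _ _ _ * M _ _ _); apply/setP => e; rewrite !inE; case: (c e).
rewrite split12 (loop_eqV HM s t bS sb) (@loop_eqV _ _ HM (S1 S) s t b) //; last first.
  by rewrite !inE bS eqxx.
have s2 x : c x = c b -> forall T, M (S2 T) (s \o tperm b x) t = M (S2 T) s t.
  move=> cx T; apply: (loop_ext HM) => e; rewrite inE => /andP[_ ce] /=.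
  by rewrite tpermD //; apply: contraNneq ce => <-; rewrite ?cx.
set k := q ^+ minn (graph_rank s t).+1 m.+1.
have k0 : 0 <= k := q0 _.
have termD S' s' : (graph_rank s t <= (graph_rank s' t).+1)%N ->
    (forall e, e \notin S' -> s' e = t e) -> (forall e, col (s' e) = c e) ->
    `|q * M S' s' t - q * (M (S1 S') s' t * M (S2 S') s' t)| <= C%:R * k.
  move=> rr s't cs'; rewrite -mulrBr normrM nq -split12.
  apply: le_trans (ler_wpM2l q1 (IH _ _ HM col _ _ _ s't cs' ct)) _.
  rewrite mulrCA -exprS ler_wpM2l ?ler0n // (ler_exp_inv HM) //.
  lia.
have colsw x : c x = c b -> forall e, col ((s \o tperm b x) e) = c e.
  by move=> cx e /=; rewrite cs; case: tpermP => // ->.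
rewrite mulrBl !mulr_suml.
have -> : \sum_(a in S1 S | [&& ~~ star a, s a == t b & t a == s b])
    q * M (S1 S :\ b :\ a) (s \o tperm b a) t * M (S2 S) s t =
  \sum_(a in S | [&& ~~ star a, s a == t b & t a == s b])
    q * (M (S1 (S :\ b :\ a)) (s \o tperm b a) t *
         M (S2 (S :\ b :\ a)) (s \o tperm b a) t).
  apply: eq_big => a.
    rewrite inE; case: (boolP (s a == t b)) => sab; rewrite ?andbF //.
    by rewrite -(cs a) (eqP sab) ct eqxx andbT.
  case/andP=> _ /and3P[_ /eqP sab _].
  have ca : c a = c b by rewrite -(cs a) sab ct.
  rewrite s2 // -mulrA; congr (q * (M _ _ _ * _)).
    by apply/setP => e; rewrite !inE !andbA.
  congr M; apply/setP => e; rewrite !inE.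
  have [->|_] := eqVneq e a; first by rewrite ca eqxx andbF.
  by have [->|] := eqVneq e b; rewrite ?eqxx ?andbF.
have -> : \sum_(x in S1 S | star x && (x != b))
    q * M (S1 S) (s \o tperm b x) t * M (S2 S) s t =
  \sum_(x in S | star x && (x != b)) (if c x == c b then
    q * (M (S1 S) (s \o tperm b x) t * M (S2 S) (s \o tperm b x) t) else 0).
  rewrite [RHS]big_mkcond [LHS]big_mkcond; apply: eq_bigr => x _ /=.
  rewrite inE; case: (boolP (x \in S)) => //= xS.
  case: eqP => //= [cx|_]; last by case: ifP.
  by rewrite s2 // mulrA.
set A1 := \sum_(a in S | _) _; set B1 := \sum_(x in S | _) _.
set A2 := \sum_(a in S | _) _; set B2 := \sum_(x in S | _) _.
have -> : A1 - B1 - (A2 - B2) = (A1 - A2) - (B1 - B2) by ring.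
apply: le_trans (ler_normB _ _) _.
rewrite natrD natrM mulrDl -mulrA; apply: lerD.
  rewrite /A1 /A2 -sumrB; apply: norm_sum_le => [|a]; first by rewrite mulr_ge0 ?ler0n.
  case/andP=> aS /and3P[sa /eqP sab /eqP tab].
  apply: termD; [exact: graph_rank_swap|exact: cut_loops|].
  by apply: colsw; rewrite -(cs a) sab ct.
rewrite -mulnDr natrM -mulrA natrD.
rewrite /B1 /B2 -sumrB; apply: norm_sum_le => [|x].
  by rewrite mulr_ge0 // -natrD ler0n.
case/andP=> xS /andP[sx xb]; rewrite mulrDl.
case: eqP => cx.
  apply: le_trans (_ : _ <= C%:R * k) _; last by rewrite lerDl mulr_ge0 ?ler0n.
  apply: termD; [exact: graph_rank_swap|exact: swap_loops|exact: colsw].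
apply: le_trans (_ : _ <= D%:R * k) _; last by rewrite lerDr mulr_ge0 ?ler0n.
rewrite subr0 normrM nq.
have lp : forall e, e \notin S -> (s \o tperm b x) e = t e by exact: swap_loops.
apply: le_trans (ler_wpM2l q1 (HD _ _ HM _ _ _ lp)) _.
rewrite mulrCA -exprS ler_wpM2l ?ler0n // (ler_exp_inv HM) // geq_min ltnS.
rewrite (@graph_rank_swap_colour _ _ s t col) //; first by move=> e; rewrite cs ct.
by rewrite !cs eq_sym; apply/eqP.
Qed.

Lemma moment_decorrelation (c : E -> bool) : exists C : nat,
  forall N M, @loop_moments N M -> forall (col : 'I_N -> bool) S s t,
  (forall e, e \notin S -> s e = t e) ->
  (forall e, col (s e) = c e) -> (forall e, col (t e) = c e) ->
  `|M S s t - M [set e in S | c e] s t * M [set e in S | ~~ c e] s t| <=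
    C%:R * N%:R^-1 ^+ (graph_rank s t).+1.
Proof.
have [C HC] := moment_decorrelation_min c #|E|.+1.
exists C => N M HM col S s t st cs ct.
have := HC N M HM col S s t st cs ct.
by rewrite (minn_idPl _) // ltnS graph_rank_le_edges.
Qed.

End LoopAsymptotics.

(** * Sums over the maps from a graph to the indices *)

Section RateOneOverN.
Variable F : numFieldType.

Definition tends_fast (u : nat -> F) (l : F) : Prop :=
  exists K : nat, forall N, (0 < N)%N -> `|u N - l| <= K%:R * N%:R^-1.

Hypothesis nat_bound : forall z : F, exists K : nat, `|z| <= K%:R.

Lemma tends_fast_cst l : tends_fast (fun=> l) l.
Proof.
by exists 0%N => N N0; rewrite subrr normr0 mulr_ge0 // ?invr_ge0 ler0n.
Qed.

Lemma tends_fast_sum (I : Type) (r : seq I) (Q : pred I) (u : I -> nat -> F) (l : I -> F) :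
  (forall i, Q i -> tends_fast (u i) (l i)) ->
  tends_fast (fun N => \sum_(i <- r | Q i) u i N) (\sum_(i <- r | Q i) l i).
Proof.
move=> H; elim: r => [|i r [K IH]].
  by exists 0%N => N N0; rewrite !big_nil subrr normr0 mulr_ge0 // ?invr_ge0 ler0n.
case: (boolP (Q i)) => Qi; last first.
  by exists K => N N0; rewrite !big_cons (negPf Qi); exact: IH.
have [L uL] := H i Qi; exists (L + K)%N => N N0; rewrite !big_cons Qi.
rewrite opprD addrACA natrD mulrDl; apply: le_trans (ler_normD _ _) _.
by apply: lerD; [exact: uL|exact: IH].
Qed.

Lemma tends_fastM u v l m : tends_fast u l -> tends_fast v m ->
  tends_fast (fun N => u N * v N) (l * m).
Proof.
move=> [K uK] [L vL]; have [A lA] := nat_bound l; have [B mB] := nat_bound m.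
exists (K * (L + B) + A * L)%N => N N0.
have /andP[q0 q1] := inv_nat_itv F N0; set q : F := N%:R^-1 in q0 q1 *.
have -> : u N * v N - l * m = (u N - l) * v N + l * (v N - m) by ring.
rewrite natrD [leRHS]mulrDl; apply: le_trans (ler_normD _ _) _; apply: lerD.
  rewrite normrM natrM mulrAC; apply: ler_pM => //; first exact: uK.
  have -> : v N = (v N - m) + m by rewrite subrK.
  rewrite natrD; apply: le_trans (ler_normD _ _) _; apply: lerD => //.
  by apply: le_trans (vL _ N0) _; rewrite -[leRHS]mulr1 ler_wpM2l ?ler0n.
by rewrite normrM natrM -mulrA; apply: ler_pM => //; exact: vL.
Qed.

Lemma tends_fast_near (u v : nat -> F) l (K : nat) : tends_fast v l ->
  (forall N, (0 < N)%N -> `|u N - v N| <= K%:R * N%:R^-1) -> tends_fast u l.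
Proof.
move=> [L vL] uv; exists (K + L)%N => N N0.
have -> : u N - l = (u N - v N) + (v N - l) by rewrite addrA subrK.
rewrite natrD mulrDl; apply: le_trans (ler_normD _ _) _.
by apply: lerD; [exact: uv|exact: vL].
Qed.

Lemma tends_fast_ffact n : tends_fast (fun N => (N ^_ n)%:R * N%:R^-1 ^+ n) 1.
Proof.
elim: n => [|n [K IH]].
  by exists 0%N => N N0; rewrite ffactn0 expr0 mulr1 subrr normr0 mulr_ge0 //
    ?invr_ge0 ler0n.
exists ((1 + K) * n + K)%N => N N0.
have /andP[q0 q1] := inv_nat_itv F N0; set q : F := N%:R^-1 in q0 q1 *.
set x := (N ^_ n)%:R * q ^+ n.
have -> : (N ^_ n.+1)%:R * q ^+ n.+1 = x * ((N - n)%:R * q).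
  by rewrite ffactnSr natrM exprS /x; ring.
have -> : x * ((N - n)%:R * q) - 1 = x * ((N - n)%:R * q - 1) + (x - 1) by ring.
rewrite natrD [leRHS]mulrDl; apply: le_trans (ler_normD _ _) _; apply: lerD; last exact: IH.
rewrite normrM natrM -mulrA; apply: ler_pM => //.
  have -> : x = 1 + (x - 1) by rewrite addrC subrK.
  rewrite natrD; apply: le_trans (ler_normD _ _) _; rewrite normr1 lerD //.
  by apply: le_trans (IH _ N0) _; rewrite -[leRHS]mulr1 ler_wpM2l ?ler0n.
have Nq : N%:R * q = 1 by rewrite mulfV // pnatr_eq0 -lt0n.
have [Nn|nN] := ltnP N n.
  have -> : (N - n)%N = 0%N by apply/eqP; rewrite subn_eq0 ltnW.
  by rewrite mul0r sub0r normrN normr1 -[leLHS]Nq ler_wpM2r // ler_nat ltnW.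
rewrite natrB // mulrBl Nq addrC addrA addNr sub0r normrN.
by rewrite ger0_norm // mulr_ge0 ?ler0n.
Qed.

End RateOneOverN.

Section Kernel.
Variable V : finType.

(** The kernel of a map on [V]: each vertex is sent to a representative of its
    fibre, chosen as a function of the fibre alone. *)
Definition fun_kernel (W : eqType) (phi : V -> W) : {ffun V -> V} :=
  [ffun v => odflt v [pick u | phi u == phi v]].

Lemma fun_kernelE (W W' : eqType) (phi : V -> W) (psi : V -> W') :
  (forall u v, (phi u == phi v) = (psi u == psi v)) ->
  fun_kernel phi = fun_kernel psi.
Proof.
by move=> e; apply/ffunP => v; rewrite !ffunE (eq_pick (fun u => e u v)).
Qed.

Lemma fun_kernel_repr (W : eqType) (phi : V -> W) v : phi (fun_kernel phi v) = phi v.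
Proof. by rewrite ffunE; case: pickP => [u /eqP|]. Qed.

Lemma fun_kernel_eq (W : eqType) (phi : V -> W) u v :
  (fun_kernel phi u == fun_kernel phi v) = (phi u == phi v).
Proof.
apply/eqP/eqP => [e|e]; first by rewrite -(fun_kernel_repr phi u) e fun_kernel_repr.
rewrite !ffunE e; case: pickP => // /(_ v); rewrite eqxx //.
Qed.

Lemma card_image_kernel (W W' : finType) (phi : V -> W) (psi : V -> W') :
  (forall u v, (phi u == phi v) = (psi u == psi v)) ->
  #|phi @: V| = #|psi @: V|.
Proof.
move=> e.
have card (X : finType) (f : V -> X) : #|f @: V| = #|fun_kernel f @: V|.
  have -> : f @: V = f @: (fun_kernel f @: V).
    rewrite -imset_comp; apply: eq_imset => v /=; exact: esym (fun_kernel_repr _ _).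
  rewrite card_in_imset // => _ _ /imsetP[u _ ->] /imsetP[v _ ->].
  by rewrite !fun_kernel_repr => /eqP uv; apply/eqP; rewrite fun_kernel_eq.
by rewrite card [RHS]card (fun_kernelE e).
Qed.

(** The maps with kernel [kappa] are the injections of the image of [kappa],
    composed with [kappa]. *)
Lemma card_kernel_fibre (N : nat) (kappa : {ffun V -> V}) :
  fun_kernel kappa = kappa ->
  #|[set phi : {ffun V -> 'I_N} | fun_kernel phi == kappa]| =
  (N ^_ #|kappa @: V|)%N.
Proof.
move=> kk; pose D := {x | x \in kappa @: V}.
have memk v : kappa v \in kappa @: V by apply: imset_f.
pose emb v : D := Sub (kappa v) (memk v).
pose f (psi : {ffun D -> 'I_N}) : {ffun V -> 'I_N} := [ffun v => psi (emb v)].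
have embP (x : D) : exists v, x = emb v.
  case/imsetP: (valP x) => v _ xv; exists v; apply: val_inj; exact: xv.
have -> : [set phi : {ffun V -> 'I_N} | fun_kernel phi == kappa] =
    f @: [set psi : {ffun D -> 'I_N} | injectiveb psi].
  apply/setP => phi; rewrite inE; apply/eqP/imsetP => [kphi|[psi]].
    exists [ffun x : D => phi (val x)]; last first.
      by apply/ffunP => v; rewrite !ffunE /= -kphi fun_kernel_repr.
    rewrite inE; apply/injectiveP => x y; rewrite !ffunE.
    have [u ->] := embP x; have [v ->] := embP y => /= /eqP.
    have kE w : phi (kappa w) = phi w by rewrite -kphi fun_kernel_repr.
    have keq : (kappa u == kappa v) = (phi u == phi v) by rewrite -kphi fun_kernel_eq.
    by rewrite !kE => uv; apply: val_inj; apply/eqP; rewrite /= keq.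
  rewrite inE => /injectiveP psi_inj ->; rewrite -[RHS]kk; apply: fun_kernelE => u v.
  rewrite !ffunE; apply/eqP/eqP => [/psi_inj/(congr1 val) //|uv].
  by congr (psi _); apply: val_inj.
rewrite card_imset; last first.
  move=> psi psi' /ffunP e; apply/ffunP => x; have [v ->] := embP x.
  by have := e v; rewrite !ffunE.
by rewrite card_inj_ffuns card_ord card_sig; congr (_ ^_ _); apply: eq_card => x; rewrite !inE.
Qed.

Lemma card_kernel_fibre0 (N : nat) (kappa : {ffun V -> V}) :
  fun_kernel kappa != kappa ->
  #|[set phi : {ffun V -> 'I_N} | fun_kernel phi == kappa]| = 0%N.
Proof.
move=> kk; apply/eqP; rewrite cards_eq0; apply/eqP/setP => phi; rewrite !inE.
apply: contraNF kk => /eqP <-; apply/eqP; apply: fun_kernelE => u v.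
exact: fun_kernel_eq.
Qed.

Lemma sum_by_kernel (F : numFieldType) N (g : {ffun V -> V} -> F) :
  \sum_(phi : {ffun V -> 'I_N}) g (fun_kernel phi) =
  \sum_kappa #|[set phi : {ffun V -> 'I_N} | fun_kernel phi == kappa]|%:R * g kappa.
Proof.
rewrite (partition_big (fun phi : {ffun V -> 'I_N} => fun_kernel phi) predT) //=.
apply: eq_bigr => kappa _; rewrite (eq_bigr (fun=> g kappa)) => [|phi /eqP->//].
by rewrite sumr_const mulr_natl; congr (_ *+ _); apply: eq_card => phi; rewrite !inE.
Qed.

Lemma card_image_fun_kernel (W : finType) (phi : V -> W) :
  #|fun_kernel phi @: V| = #|phi @: V|.
Proof. by apply: card_image_kernel => u v; rewrite fun_kernel_eq. Qed.

(** There are O(N ^ k) maps with an image of [k] points, and finitely many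
    kernels. *)
Lemma sum_image_le (F : numFieldType) N : (0 < N)%N ->
  \sum_(phi : {ffun V -> 'I_N}) N%:R^-1 ^+ #|phi @: V| <= #|{ffun V -> V}|%:R :> F.
Proof.
move=> N0.
rewrite (eq_bigr (fun phi : {ffun V -> 'I_N} =>
   N%:R^-1 ^+ #|fun_kernel phi @: V|)) => [|phi _]; last by rewrite card_image_fun_kernel.
rewrite (sum_by_kernel N (fun kappa => N%:R^-1 ^+ #|kappa @: V|)).
rewrite -sum1_card natr_sum; apply: ler_sum => kappa _.
case: (eqVneq (fun_kernel kappa) kappa) => kk; last first.
  by rewrite card_kernel_fibre0 // mul0r ler01.
rewrite card_kernel_fibre // exprVn ler_pdivrMr ?exprn_gt0 ?ltr0n // mul1r.
rewrite -natrX ler_nat; elim: #|_| => // n IH.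
by rewrite ffactnSr expnSr leq_mul // leq_subr.
Qed.

End Kernel.

Section Traces.
Variables (F : numFieldType).
Hypothesis nat_bound : forall z : F, exists K : nat, `|z| <= K%:R.

(** For a connected graph the rank of an image is given by its number of
    vertices, and everything else only tests equalities of vertices. *)
Lemma leading_kernel (V E W W' : finType) (star : E -> bool) (src tgt : E -> V)
  (phi : V -> W) (psi : V -> W') (v0 : V) :
  (forall u v, connect (adjacent src tgt) u v) ->
  (forall u v, (phi u == phi v) = (psi u == psi v)) ->
  leading F star setT (phi \o src) (phi \o tgt) =
  leading F star setT (psi \o src) (psi \o tgt).
Proof.
move=> conn e; apply: eq_bigl => g; rewrite /tight_walks.
have -> : graph_rank (phi \o src) (phi \o tgt) =
          graph_rank (psi \o src) (psi \o tgt).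
  by apply: succn_inj; rewrite !(rank_connected _ v0 conn) (card_image_kernel e).
congr ([&& _, _ & _] && _); apply: eq_forallb => f; exact: e.
Qed.

Section ConnectedGraph.
Variables (V E : finType) (star : E -> bool) (src tgt : E -> V) (v0 : V).
Hypothesis conn : forall u v, connect (adjacent src tgt) u v.

Lemma moment_leading_trace : exists C : nat, forall N M, @loop_moments F E star N M ->
  forall phi : {ffun V -> 'I_N},
  `|N%:R^-1 * M setT (phi \o src) (phi \o tgt) -
    N%:R^-1 ^+ #|phi @: V| * leading F star setT (phi \o src) (phi \o tgt)| <=
  C%:R * N%:R^-1 * N%:R^-1 ^+ #|phi @: V|.
Proof.
have [C HC] := @moment_leading F E star; exists C => N M HM phi.
rewrite -(rank_connected phi v0 conn); set r := graph_rank _ _.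
have /andP[q0 q1] := inv_nat_itv F (loop_gt0 HM); set q : F := N%:R^-1 in q0 q1 *.
rewrite exprS -mulrA -mulrBr normrM ger0_norm //.
rewrite [leRHS]mulrAC [leRHS]mulrC.
rewrite ler_wpM2l // -exprS.
by apply: (HC _ _ HM setT (phi \o src) (phi \o tgt)) => e; rewrite inE.
Qed.

(** About [N ^ k] maps have a given kernel with image of size [k], and the moment
    of each of them is of order [k - 1] in 1/N: after division by [N], each kernel
    has a finite contribution in the limit. *)
Lemma trace_limit : exists L : F, exists K : nat, forall N M,
  @loop_moments F E star N M ->
  `|N%:R^-1 * (\sum_(phi : {ffun V -> 'I_N}) M setT (phi \o src) (phi \o tgt)) - L|
    <= K%:R * N%:R^-1.
Proof.
have [C HC] := moment_leading_trace.
pose lam (kappa : {ffun V -> V}) := leading F star setT (kappa \o src) (kappa \o tgt).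
pose u N : F := \sum_(kappa : {ffun V -> V})
  (#|[set phi : {ffun V -> 'I_N} | fun_kernel phi == kappa]|%:R *
   N%:R^-1 ^+ #|kappa @: V|) * lam kappa.
pose L : F := \sum_(kappa : {ffun V -> V}) (fun_kernel kappa == kappa)%:R * lam kappa.
have [K uK] : tends_fast u L.
  apply: tends_fast_sum => kappa _; apply: tends_fastM => //; last first.
    exact: tends_fast_cst.
  case: eqP => [kk|/eqP kk].
    have [K HK] := tends_fast_ffact F #|kappa @: V|; exists K => N N0.
    by rewrite card_kernel_fibre //; exact: HK.
  exists 0%N => N N0; rewrite card_kernel_fibre0 // mul0r subrr normr0.
  by rewrite mulr_ge0 // ?invr_ge0 ler0n.
exists L, (C * #|{ffun V -> V}| + K)%N => N M HM.
have N0 := loop_gt0 HM.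
have /andP[q0 q1] := inv_nat_itv F N0; set q : F := N%:R^-1 in q0 q1 *.
set X := q * _; have -> : X - L = (X - u N) + (u N - L) by rewrite addrA subrK.
rewrite natrD mulrDl; apply: le_trans (ler_normD _ _) _.
apply: lerD; last exact: uK.
have -> : u N = \sum_(phi : {ffun V -> 'I_N}) q ^+ #|phi @: V| *
    leading F star setT (phi \o src) (phi \o tgt).
  rewrite [RHS](eq_bigr (fun phi : {ffun V -> 'I_N} =>
      q ^+ #|fun_kernel phi @: V| * lam (fun_kernel phi))); last first.
    move=> phi _; rewrite card_image_fun_kernel; congr (_ * _).
    by apply: (leading_kernel _ v0 conn) => x y; rewrite fun_kernel_eq.
  rewrite (sum_by_kernel N (fun kappa => q ^+ #|kappa @: V| * lam kappa)).
  by apply: eq_bigr => kappa _; rewrite mulrA.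
rewrite /X mulr_sumr -sumrB; apply: le_trans (ler_norm_sum _ _ _) _.
apply: le_trans (ler_sum _ (fun phi _ => HC N M HM phi)) _.
rewrite -mulr_sumr natrM mulrAC ler_wpM2r //; apply: ler_wpM2l; first exact: ler0n.
exact: sum_image_le.
Qed.

Lemma injective_trace_limit : exists K : nat, forall N M,
  @loop_moments F E star N M ->
  `|N%:R^-1 * (\sum_(phi : {ffun V -> 'I_N} | injectiveb phi)
       M setT (phi \o src) (phi \o tgt)) - leading F star setT src tgt|
    <= K%:R * N%:R^-1.
Proof.
have [C HC] := moment_leading_trace; set L := leading _ _ _ _ _.
pose u N : F := (N ^_ #|V|)%:R * N%:R^-1 ^+ #|V| * L.
have [K uK] : tends_fast u L.
  rewrite -[L]mul1r; apply: tends_fastM => //; first exact: tends_fast_ffact.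
  exact: tends_fast_cst.
exists (C * #|{ffun V -> V}| + K)%N => N M HM.
have N0 := loop_gt0 HM.
have /andP[q0 q1] := inv_nat_itv F N0; set q : F := N%:R^-1 in q0 q1 *.
set X := q * _; have -> : X - L = (X - u N) + (u N - L) by rewrite addrA subrK.
rewrite natrD mulrDl; apply: le_trans (ler_normD _ _) _.
apply: lerD; last exact: uK.
have -> : u N = \sum_(phi : {ffun V -> 'I_N} | injectiveb phi) q ^+ #|phi @: V| *
    leading F star setT (phi \o src) (phi \o tgt).
  rewrite (eq_bigr (fun=> q ^+ #|V| * L)).
    have := card_inj_ffuns V 'I_N; rewrite card_ord => cardE.
    rewrite sumr_const -mulr_natl mulrA /u -cardE.
    by congr (_%:R * _ * _); apply: eq_card => phi; rewrite !inE.
  move=> phi /injectiveP phi_inj; rewrite card_imset //; congr (_ * _).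
  apply: (@leading_kernel _ _ _ _ star src tgt phi id v0) => // x y.
  by rewrite (inj_eq phi_inj).
rewrite /X mulr_sumr -sumrB; apply: le_trans (ler_norm_sum _ _ _) _.
apply: le_trans (ler_sum _ (fun phi _ => HC N M HM phi)) _.
rewrite -mulr_sumr natrM mulrAC ler_wpM2r //; apply: ler_wpM2l; first exact: ler0n.
apply: le_trans (sum_image_le V F N0).
rewrite [leRHS](bigID (fun phi : {ffun V -> 'I_N} => injectiveb phi)) /= lerDl.
by apply: sumr_ge0 => phi _; exact: exprn_ge0.
Qed.

End ConnectedGraph.

Definition is_inl (A B : Type) (x : A + B) := if x is inl _ then true else false.

Definition sum_map (A B A' B' : Type) (f : A -> A') (g : B -> B') (x : A + B) : A' + B' :=
  match x with inl a => inl (f a) | inr b => inr (g b) end.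

Section DisjointUnion.
Variables (V1 E1 V2 E2 : finType) (star : E1 + E2 -> bool).
Variables (src1 tgt1 : E1 -> V1) (src2 tgt2 : E2 -> V2).
Variables (Z : {set V1}) (v2 : V2).
Hypothesis Z_spans :
  forall v, exists2 z, z \in Z & connect (adjacent src1 tgt1) v z.
Hypothesis conn2 : forall u v, connect (adjacent src2 tgt2) u v.
Let VV : finType := (V1 + V2)%type.
Let src := sum_map src1 src2.
Let tgt := sum_map tgt1 tgt2.
Let star1 e := star (inl e).
Let star2 e := star (inr e).

Section PairOfMaps.
Variables (W : finType) (phi : V1 + V2 -> W).
Let phi1 := phi \o inl.
Let phi2 := phi \o inr.
Let span := edge_span (phi \o src) (phi \o tgt) [set: (E1 + E2)%type].

Lemma span_inl u z : connect (adjacent src1 tgt1) u z ->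
  vertex_vec (phi1 u) + vertex_vec (phi1 z) \in span.
Proof.
move/(connect_edge_span phi1); apply/subvP; apply: edge_spanP => e _.
exact: (mem_edge_span (phi \o src) (phi \o tgt) (in_setT (inl e))).
Qed.

Lemma span_inr u z : vertex_vec (phi2 u) + vertex_vec (phi2 z) \in span.
Proof.
move: (connect_edge_span phi2 (conn2 u z)); apply/subvP; apply: edge_spanP => e _.
exact: (mem_edge_span (phi \o src) (phi \o tgt) (in_setT (inr e))).
Qed.

(** The set [Z] meets all the components of the first graph and the second graph
    is connected, so the union has at most [#|Z|.+1] components, and one less when
    the images of the two graphs meet. *)
Lemma card_image_union :
  (#|phi @: VV| <= graph_rank (phi \o src) (phi \o tgt) + #|Z|.+1)%N.
Proof.
apply: leq_trans (_ : _ <= graph_rank (phi \o src) (phi \o tgt) +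
   #|phi2 v2 |: phi1 @: Z|)%N _.
  apply: card_image_le_rank => -[v|v].
    have [z zZ vz] := Z_spans v; exists (phi1 z); last exact: span_inl.
    by rewrite inE imset_f ?orbT.
  by exists (phi2 v2); [rewrite inE set11|exact: span_inr].
rewrite leq_add2l cardsU1; apply: leq_add (leq_b1 _) _; exact: leq_imset_card.
Qed.

Lemma card_image_union_meet u1 u2 : phi1 u1 = phi2 u2 ->
  (#|phi @: VV| <= graph_rank (phi \o src) (phi \o tgt) + #|Z|)%N.
Proof.
move=> u12.
apply: leq_trans (_ : _ <= graph_rank (phi \o src) (phi \o tgt) + #|phi1 @: Z|)%N _.
  apply: card_image_le_rank => -[v|v].
    have [z zZ vz] := Z_spans v; exists (phi1 z); last exact: span_inl.
    exact: imset_f.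
  have [z zZ vz] := Z_spans u1; exists (phi1 z); first exact: imset_f.
  have -> : vertex_vec (phi (inr v)) + vertex_vec (phi1 z) =
      (vertex_vec (phi2 v) + vertex_vec (phi2 u2)) +
      (vertex_vec (phi1 u1) + vertex_vec (phi1 z)).
    by rewrite u12 addrA -[_ + _ + vertex_vec (phi2 u2)]addrA ffunF2_addrr addr0.
  by apply: rpredD; [exact: span_inr|exact: span_inl].
by rewrite leq_add2l leq_imset_card.
Qed.

Lemma image_union : phi @: VV = (phi1 @: V1) :|: (phi2 @: V2).
Proof.
apply/setP => w; rewrite inE; apply/imsetP/orP => [[[v|v] _ ->]|].
- by left; rewrite (imset_f phi1).
- by right; rewrite (imset_f phi2).
by case=> /imsetP[v _ ->]; [exists (inl v)|exists (inr v)].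
Qed.

Lemma card_image1 : (#|phi1 @: V1| <= graph_rank (phi1 \o src1) (phi1 \o tgt1) + #|Z|)%N.
Proof.
apply: leq_trans (_ : _ <= graph_rank (phi1 \o src1) (phi1 \o tgt1) + #|phi1 @: Z|)%N _.
  apply: card_image_le_rank => v.
  have [z zZ vz] := Z_spans v; exists (phi1 z); first exact: imset_f.
  exact: connect_edge_span.
by rewrite leq_add2l leq_imset_card.
Qed.

End PairOfMaps.

(** Pairs of maps with disjoint images give decorrelated moments. For the other
    pairs, an image of [k] points has rank at least [k - #|Z|], one more than the
    general bound, and the sizes of the two images add up to more than [k]. *)
Lemma trace_decorrelation : exists K : nat, forall N M M1 M2,
  @loop_moments F (E1 + E2)%type star N M ->
  @loop_moments F E1 star1 N M1 -> @loop_moments F E2 star2 N M2 ->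
  (forall s t, M [set e | is_inl e] s t = M1 setT (s \o inl) (t \o inl)) ->
  (forall s t, M [set e | ~~ is_inl e] s t = M2 setT (s \o inr) (t \o inr)) ->
  N%:R^-1 ^+ #|Z|.+1 * `|\sum_(phi : {ffun VV -> 'I_N})
    (M setT (phi \o src) (phi \o tgt) -
     M1 setT (phi \o inl \o src1) (phi \o inl \o tgt1) *
     M2 setT (phi \o inr \o src2) (phi \o inr \o tgt2))| <= K%:R * N%:R^-1.
Proof.
have [C HC] := @moment_decorrelation F (E1 + E2)%type star (@is_inl E1 E2).
have [D HD] := @moment_decay_rank F (E1 + E2)%type star.
have [D1 HD1] := @moment_decay_rank F E1 star1.
have [D2 HD2] := @moment_decay_rank F E2 star2.
set K := (C + D + D1 * D2)%N.
exists (K * #|{ffun VV -> VV}|)%N => N M M1 M2 HM HM1 HM2 M1E M2E.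
have N0 := loop_gt0 HM.
have /andP[q0 q1] := inv_nat_itv F N0; set q : F := N%:R^-1 in q0 q1 *.
have qn n : 0 <= q ^+ n by exact: exprn_ge0.
apply: le_trans (ler_wpM2l (qn _) (ler_norm_sum _ _ _)) _; rewrite mulr_sumr.
apply: le_trans (_ : _ <= \sum_(phi : {ffun VV -> 'I_N}) K%:R * q * q ^+ #|phi @: VV|) _;
  last first.
  rewrite -mulr_sumr natrM mulrAC ler_wpM2r // ler_wpM2l ?ler0n //.
  exact: sum_image_le.
apply: ler_sum => phi _.
have arith1 (a z r : nat) : (a <= r + z)%N -> (a < z.+1 + r)%N by lia.
have arith2 (a a1 a2 z r1 r2 : nat) : (a < a1 + a2)%N -> (a1 <= r1 + z)%N ->
  r2.+1 = a2 -> (a < z.+1 + (r1 + r2))%N by lia.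
have arith3 (a z r : nat) : (a <= r + z.+1)%N -> (a < z.+1 + r.+1)%N by lia.
have final (k : nat) X n : (k <= K)%N -> (#|phi @: VV| < n)%N ->
    X <= k%:R * q ^+ n -> X <= K%:R * q * q ^+ #|phi @: VV|.
  move=> kK n1 /le_trans; apply; rewrite -mulrA -exprS.
  by apply: ler_pM; rewrite ?ler0n ?ler_nat // (ler_exp_inv HM).
have [/existsP[u1 /existsP[u2 /eqP u12]]|disj] :=
  boolP [exists u1 : V1, [exists u2 : V2, phi (inl u1) == phi (inr u2)]].
  set r := graph_rank (phi \o src) (phi \o tgt).
  have le_r := card_image_union_meet u12; rewrite -/r in le_r.
  have le1 := card_image1 phi; set r1 := graph_rank _ _ in le1.
  have eq2 := rank_connected (phi \o inr) v2 conn2; set r2 := graph_rank _ _ in eq2.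
  have le12 : (#|phi @: VV| < #|(phi \o inl) @: V1| + #|(phi \o inr) @: V2|)%N.
    have := cardsUI ((phi \o inl) @: V1) ((phi \o inr) @: V2).
    rewrite -image_union => <-; rewrite -[X in (X < _)%N]addn0 ltn_add2l card_gt0.
    apply/set0Pn; exists (phi (inl u1)); rewrite inE (imset_f (phi \o inl)) //=.
    by rewrite u12 (imset_f (phi \o inr)).
  apply: (final (D + D1 * D2)%N _ #|phi @: VV|.+1) => //; first by rewrite /K; lia.
  apply: le_trans (ler_wpM2l (qn _) (ler_normB _ _)) _.
  rewrite mulrDr natrD mulrDl; apply: lerD.
    have h : `|M setT (phi \o src) (phi \o tgt)| <= D%:R * q ^+ r.
      by apply: HD => // e; rewrite inE.
    apply: le_trans (ler_wpM2l (qn _) h) _; rewrite mulrCA -exprD.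
    by rewrite ler_wpM2l ?ler0n // (ler_exp_inv HM) //; exact: arith1 le_r.
  have h1 : `|M1 setT (phi \o inl \o src1) (phi \o inl \o tgt1)| <= D1%:R * q ^+ r1.
    by apply: HD1 => // e; rewrite inE.
  have h2 : `|M2 setT (phi \o inr \o src2) (phi \o inr \o tgt2)| <= D2%:R * q ^+ r2.
    by apply: HD2 => // e; rewrite inE.
  rewrite normrM; apply: le_trans (ler_wpM2l (qn _) (ler_pM _ _ h1 h2)) _ => //.
  rewrite mulrACA -natrM -exprD mulrCA -exprD.
  by rewrite ler_wpM2l ?ler0n // (ler_exp_inv HM) //; exact: arith2 le12 le1 eq2.
set r := graph_rank (phi \o src) (phi \o tgt).
have le_r := card_image_union phi; rewrite -/r in le_r.
apply: (final C _ (#|Z|.+1 + r.+1)%N); [by rewrite /K; lia|exact: arith3 le_r|].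
rewrite exprD mulrCA ler_wpM2l //.
pose col w := w \in (phi \o inl) @: V1.
have col1 v : col (phi (inl v)) by rewrite /col (imset_f (phi \o inl)).
have col2 v : ~~ col (phi (inr v)).
  apply/imsetP => -[u _ /= e]; move/negP: disj; apply; apply/existsP; exists u.
  by apply/existsP; exists v; rewrite e.
have cs e : col ((phi \o src) e) = is_inl e.
  by case: e => e /=; rewrite ?col1 // (negPf (col2 _)).
have ct e : col ((phi \o tgt) e) = is_inl e.
  by case: e => e /=; rewrite ?col1 // (negPf (col2 _)).
have := HC N M HM col setT (phi \o src) (phi \o tgt); rewrite -/r.
have -> : [set e in setT | is_inl e] = [set e : E1 + E2 | is_inl e].
  by apply/setP => e; rewrite !inE.
have -> : [set e in setT | ~~ is_inl e] = [set e : E1 + E2 | ~~ is_inl e].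
  by apply/setP => e; rewrite !inE.
by rewrite M1E M2E; apply=> // e; rewrite inE.
Qed.

End DisjointUnion.
End Traces.

(** * Tight closed walks and simple cycles *)

Lemma uniq_map_injective (A B : eqType) (f : A -> B) (s : seq A) :
  uniq (map f s) -> {in s &, injective f}.
Proof.
elim: s => // a s IH /= /andP[fa Us] x y; rewrite !inE.
case/predU1P=> [->|xs] /predU1P[->|ys] // fxy; last exact: IH.
  by move: fa; rewrite fxy map_f.
by move: fa; rewrite -fxy map_f.
Qed.

Lemma porbit_next (A : finType) (g : {perm A}) x : porbit g (g x) = porbit g x.
Proof. by have := porbit_perm g 1 x; rewrite expg1. Qed.

Section Cactus.
Variable T : testGraph.
Implicit Types (C : {set edge T}) (g : {perm edge T}) (e f : edge T).
Implicit Types (p : seq (vertex T * edge T)) (x y z : vertex T * edge T).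
Local Notation V := (vertex T).
Local Notation E := (edge T).
Local Notation src := (@src T).
Local Notation tgt := (@tgt T).
Local Notation star := (@star T).
Local Notation next_joins := (fun x y => joins x.2 x.1 y.1).
Local Notation tight g := (tight_walks star [set: E] src tgt g).

Lemma edge_vec_joins e u v : joins e u v ->
  edge_vec src tgt e = vertex_vec u + vertex_vec v.
Proof. by case/orP=> /andP[/eqP<- /eqP<-]; rewrite /edge_vec // addrC. Qed.

Lemma sum_edge_vec_path x p : path next_joins x p ->
  \sum_(y <- belast x p) edge_vec src tgt y.2 =
  vertex_vec x.1 + vertex_vec (last x p).1.
Proof.
elim: p x => [|y p IH] x /=; first by rewrite big_nil ffunF2_addrr.
case/andP=> xy yp; rewrite big_cons (edge_vec_joins xy) IH //.
by rewrite addrA -[_ + _ + vertex_vec y.1]addrA ffunF2_addrr addr0.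
Qed.

Lemma sum_edge_vec_simple_cycle C : simple_cycle C ->
  \sum_(e in C) edge_vec src tgt e = 0.
Proof.
case=> -[|x p] [/and4P[// _ _ Up cyc] ->].
have := sum_edge_vec_path cyc; rewrite belast_rcons last_rcons ffunF2_addrr => sum0.
rewrite -[RHS]sum0.
rewrite -(big_map (fun z => z.2) predT (edge_vec src tgt)) big_uniq //=.
by apply: eq_bigl => e; rewrite inE.
Qed.

Lemma simple_cycle_span C e : simple_cycle C -> e \in C ->
  edge_vec src tgt e \in edge_span src tgt (C :\ e).
Proof.
move=> /sum_edge_vec_simple_cycle; move=> sum0 eC; move: sum0.
rewrite (big_setD1 e) //= => /eqP; rewrite addr_eq0 ffunF2_oppr => /eqP ->.
by apply: rpred_sum => f fC; apply: mem_edge_span.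
Qed.

Lemma edge_spanS (A B : {set E}) : A \subset B ->
  (edge_span src tgt A <= edge_span src tgt B)%VS.
Proof.
by move=> AB; apply: edge_spanP => e eA; apply: mem_edge_span; apply: (subsetP AB).
Qed.

Lemma simple_cycle_dependent C (A : {set E}) : simple_cycle C -> C \subset A ->
  (\dim (edge_span src tgt A) < #|A|)%N.
Proof.
move=> sC CA; have [s [/and4P[s0 _ _ _] CE]] := sC.
case: s s0 CE => // x s _ CE; have xC : x.2 \in C by rewrite CE inE mem_head.
have xA := subsetP CA _ xC; rewrite (cardsD1 x.2 A) xA.
apply: leq_ltn_trans (_ : _ <= \dim (edge_span src tgt (A :\ x.2)))%N _; last first.
  exact: dim_edge_span.
apply/dimvS/edge_spanP => f fA; have [->|fx] := eqVneq f x.2.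
  by apply: (subvP (edge_spanS (setSD _ CA))); exact: simple_cycle_span.
by apply: mem_edge_span; rewrite !inE fx.
Qed.

(** A vertex begins one step of a simple closed path and ends one step of it. *)
Lemma simple_path_incident p x y : simple_closed_path p -> x \in p -> y \in p ->
  (src y.2 == (next p x).1) || (tgt y.2 == (next p x).1) ->
  y = next p x \/ y = x.
Proof.
case/and4P=> _ U1 _ cyc xp yp inc.
have Up : uniq p := map_uniq U1.
have inj1 := uniq_map_injective U1.
have := next_cycle cyc yp; rewrite /joins => jy.
have [e1|e2] : y.1 = (next p x).1 \/ (next p y).1 = (next p x).1.
  by case/orP: jy => /andP[/eqP h1 /eqP h2]; case/orP: inc => /eqP h;
     [left|right|right|left]; rewrite -h.
  by left; apply: inj1; rewrite ?mem_next.
right; apply: (can_inj (prev_next Up)).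
by apply: inj1; rewrite ?mem_next.
Qed.

Section TightWalks.
Variable g : {perm edge T}.
Hypothesis g_tight : tight g.

Let g_walks : alternating_walks star [set: E] src tgt g.
Proof. by case/andP: g_tight. Qed.

Let g_rank : graph_rank src tgt = perm_length g.
Proof. by case/andP: g_tight => _ /eqP. Qed.

Let g_next e : tgt e = src (g e).
Proof. by case/alternating_walksP: g_walks => _ _. Qed.

Let g_star e : star (g e) = ~~ star e.
Proof. by case/alternating_walksP: g_walks => _ + _; apply; rewrite inE. Qed.

(** Two passages of a closed walk at a vertex could be reconnected to cut the
    walk in two, with more walks than the rank allows. *)
Lemma tight_src_inj e f : f \in porbit g e -> src e = src f -> e = f.
Proof.
move=> fe sef; apply/eqP; apply: contraT => ne.
have := graph_rank_le_perm_length (g := (g * tperm e f)%g) (s := src) (t := tgt).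
rewrite g_rank (perm_length_mem ne fe) ltnn => /(_ _)/negP []; last by [].
move=> h; rewrite permM g_next.
by case: tpermP => [->|->|].
Qed.

Definition orbit_path e := [seq (src f, f) | f <- traject g e #|porbit g e|].

Lemma orbit_path_cycle (r : rel (V * E)) e :
  (forall f, r (src f, f) (src (g f), g f)) -> path.cycle r (orbit_path e).
Proof.
move=> rg; rewrite /orbit_path.
have := iter_porbit g e; have := card_porbit_neq0 g e.
case: #|_| => // n _ gn /=.
rewrite -map_rcons -[X in rcons _ X]gn iterSr -trajectSr.
apply: (@homo_path _ _ (fun f => (src f, f)) (frel g)) => [a b /eqP <-|] //.
exact: fpath_traject.
Qed.

Lemma orbit_path_edges e : unzip2 (orbit_path e) = traject g e #|porbit g e|.
Proof. by rewrite /unzip2 -map_comp map_id. Qed.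

Lemma orbit_path_set e : [set f in unzip2 (orbit_path e)] = porbit g e.
Proof. by apply/setP => f; rewrite inE orbit_path_edges porbit_traject. Qed.

Lemma orbit_path_simple e : simple_closed_path (orbit_path e).
Proof.
apply/and4P; split.
- have := card_porbit_neq0 g e; rewrite /orbit_path; by case: #|_|.
- rewrite /unzip1 -map_comp map_inj_in_uniq ?uniq_traject_porbit // => a b.
  rewrite -!porbit_traject => ae be /= sab; apply: tight_src_inj => //.
  by move: ae be; rewrite -!eq_porbit_mem => /eqP-> /eqP->.
- by rewrite orbit_path_edges uniq_traject_porbit.
- by apply: orbit_path_cycle => f /=; rewrite /joins eqxx g_next eqxx.
Qed.

Lemma orbit_simple_cycle e : simple_cycle (porbit g e).
Proof. by exists (orbit_path e); split; [exact: orbit_path_simple|rewrite orbit_path_set]. Qed.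

Lemma orbit_even e : ~~ odd #|porbit g e|.
Proof.
have [_] := alternating_star_porbit #|porbit g e| g_walks (in_setT e).
by rewrite porbit_exp_card; case: star; case: odd.
Qed.

Lemma orbit_oriented_alternating e : oriented_alternating_cycle (porbit g e).
Proof.
exists (orbit_path e); split.
- exact: orbit_path_simple.
- by rewrite orbit_path_set.
- by apply: orbit_path_cycle => f /=; rewrite eqxx g_next eqxx.
- exact: orbit_even.
- by apply: orbit_path_cycle => f /=; rewrite g_star; case: star.
Qed.

(** Removing one edge from each orbit leaves a forest, because the walks are
    tight. If each orbit had an edge outside [C], these edges could be the removed
    ones and the forest would contain [C]. *)
Lemma simple_cycle_contains_orbit C : simple_cycle C ->
  exists e, porbit g e \subset C.
Proof.
move=> sC; have [s [/and4P[s0 _ _ _] _]] := sC.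
case: s s0 => // x0 _ _.
pose c (O : {set E}) := if [pick f in O :\: C] is Some f then f else
  odflt x0.2 [pick f in O].
have cP e : c (porbit g e) \in porbit g e.
  rewrite /c; case: pickP => [f|_]; first by rewrite inE => /andP[].
  by case: pickP => //= /(_ e); rewrite porbit_id.
have [|none] := boolP [exists e, porbit g e \subset C].
  by move/existsP.
have CR : C \subset cut_orbits g c.
  apply/subsetP => e eC; rewrite inE; apply: contraTneq eC => ->.
  rewrite /c; case: pickP => [f|D0]; first by rewrite inE => /andP[].
  move/existsP: none => []; exists e; apply/subsetP => f fe.
  by have := D0 f; rewrite inE fe andbT => /negbFE.
have := simple_cycle_dependent sC CR.
rewrite (edge_span_cut_orbits g_next cP) -/(graph_rank src tgt) g_rank.
by rewrite card_cut_orbits // ltnn.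
Qed.

(** An orbit inside [C] is closed under taking the next edge of [C]: the walk goes
    through the common vertex by another edge, and [C] has no third edge there. *)
Lemma simple_cycle_orbit C e : simple_cycle C -> e \in C -> C = porbit g e.
Proof.
move=> sC eC; have [e0 OC] := simple_cycle_contains_orbit sC.
suff CE : C = porbit g e0.
  by rewrite CE in eC *; apply/eqP; rewrite eq_sym eq_porbit_mem.
have [p [sp CE]] := sC; have Up : uniq p by case/and4P: sp => _ /map_uniq.
apply/eqP; rewrite eqEsubset OC andbT; apply/subsetP => f.
have inC h : h \in C -> exists2 y, y \in p & y.2 = h.
  by rewrite CE inE => /mapP[y yp ->]; exists y.
have step x : x \in p -> x.2 \in porbit g e0 -> (next p x).2 \in porbit g e0.
  move=> xp xO.
  have cyc : path.cycle next_joins p by case/and4P: sp.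
  have h_of h : h \in porbit g e0 -> h != x.2 ->
      (src h == (next p x).1) || (tgt h == (next p x).1) ->
      (next p x).2 \in porbit g e0.
    move=> hO hx inc; have [y yp yh] := inC h (subsetP OC _ hO).
    rewrite -yh in inc hO hx.
    have [yE|yE] := simple_path_incident sp xp yp inc; first by rewrite -yE.
    by rewrite yE eqxx in hx.
  have gx h : star h != star x.2 -> h != x.2 by apply: contraNneq => ->.
  have := next_cycle cyc xp => /= /orP[|] /andP[/eqP h1 /eqP h2].
    apply: (h_of (g x.2)); last by rewrite -g_next h2 eqxx.
      by move: xO; rewrite -!eq_porbit_mem porbit_next.
    by apply: gx; rewrite g_star; case: star.
  apply: (h_of (g^-1 x.2)%g).
  - by move: xO; rewrite -!eq_porbit_mem -(porbit_next g (g^-1 x.2)%g) permKV.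
  - by apply: gx; rewrite -{2}[x.2](permKV g) g_star; case: star.
  - by rewrite g_next permKV h1 eqxx orbT.
move=> /inC[y yp <-]; have [x xp xe0] := inC e0 (subsetP OC _ (porbit_id g e0)).
have xy : fconnect (next p) x y.
  by rewrite (fconnect_cycle (cycle_next Up) xp).
rewrite -(iter_findex xy); elim: (findex _ _ _) => [|n IH] /=.
  by rewrite xe0 porbit_id.
apply: step => //; elim: n {IH} => //= n; rewrite mem_next //.
Qed.

Lemma tight_cactus : oriented_alternating_cactus T.
Proof.
split=> [e|C sC].
  exists (porbit g e); split; first by split; [exact: orbit_simple_cycle|exact: porbit_id].
  by move=> C [sC eC]; rewrite (simple_cycle_orbit sC eC).
have [s [/and4P[s0 _ _ _] CE]] := sC.
case: s s0 CE => // x s _ CE; have xC : x.2 \in C by rewrite CE inE mem_head.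
by rewrite (simple_cycle_orbit sC xC); exact: orbit_oriented_alternating.
Qed.

Lemma tight_prod_cycles (F : comRingType) (w : nat -> F) :
  \prod_(O in porbits g) w #|O| =
  \prod_(C : {set E} | boolp.asbool (simple_cycle C)) w #|C|.
Proof.
apply: eq_bigl => C; apply/imsetP/boolp.asboolP => [[e _ ->]|sC].
  exact: orbit_simple_cycle.
have [s [/and4P[s0 _ _ _] CE]] := sC.
case: s s0 CE => // x s _ CE; exists x.2 => //.
by apply: simple_cycle_orbit => //; rewrite CE inE mem_head.
Qed.

End TightWalks.

(** The orbits of both are the simple cycles, on which the source is injective. *)
Lemma tight_unique g h : tight g -> tight h -> g = h.
Proof.
move=> tg th; apply/permP => e.
have gE : porbit g e = porbit h e.
  by apply: (simple_cycle_orbit th); [exact: orbit_simple_cycle|exact: porbit_id].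
have [/andP[/alternating_walksP[_ _ gn] _] /andP[/alternating_walksP[_ _ hn] _]] :=
  (tg, th).
have m1 : g e \in porbit g e by have := mem_porbit g 1 e; rewrite expg1.
have m2 : h e \in porbit g e by rewrite gE; have := mem_porbit h 1 e; rewrite expg1.
apply: (tight_src_inj tg); last by rewrite -gn -hn.
by move: m1 m2; rewrite -!eq_porbit_mem => /eqP-> /eqP->.
Qed.

Definition adjacent_in (A : {set E}) : rel V :=
  fun u v => [exists e in A, joins e u v].

(** The indicator form of a connected component of [A] vanishes on the edge
    vectors of [A]. *)
Lemma span_connected (A : {set E}) e :
  edge_vec src tgt e \in edge_span src tgt A ->
  connect (adjacent_in A) (tgt e) (src e).
Proof.
move=> eA; pose comp := connect (adjacent_in A) (tgt e).
have sym : connect_sym (adjacent_in A).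
  apply: sym_connect_sym => u v; apply: eq_existsb => f.
  by rewrite /joins orbC.
pose form (v : {ffun V -> ('F_2)^o}) : 'F_2 := \sum_(u | comp u) (v u : 'F_2).
have formD v w : form (v + w) = form v + form w.
  by rewrite /form -big_split; apply: eq_bigr => u _; rewrite ffunE.
have formZ k v : form (k *: v) = k * form v.
  by rewrite /form mulr_sumr; apply: eq_bigr => u _; rewrite ffunE.
have form0 : form 0 = 0 by rewrite /form big1 // => u _; rewrite ffunE.
have form_vertex u : form (vertex_vec u) = (comp u)%:R.
  rewrite /form; case: (boolP (comp u)) => cu.
    rewrite (bigD1 u) //= ffunE eqxx big1 ?addr0 // => z /andP[_ /negPf nz].
    by rewrite ffunE nz.
  rewrite big1 // => z cz; rewrite ffunE; case: eqP => // zu.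
  by rewrite -zu cz in cu.
have form_edge f : f \in A -> form (edge_vec src tgt f) = 0.
  move=> fA; rewrite formD !form_vertex.
  have -> : comp (src f) = comp (tgt f).
    apply: (same_connect_r sym); apply: connect1; apply/existsP; exists f.
    by rewrite fA /joins !eqxx.
  by apply: (@addrr_pchar2 'F_2); exact: pchar_Fp.
have : form (edge_vec src tgt e) = 0.
  case/memv_sumP: eA => w wP ->.
  rewrite (big_morph form formD form0) big1 // => f fA.
  by have /vlineP[k ->] := wP f fA; rewrite formZ form_edge // mulr0.
rewrite formD !form_vertex /comp connect0.
by case: (connect _ _ (src e)) => //; rewrite add0r => /eqP; rewrite oner_eq0.
Qed.

(** The edges chosen for the steps of a simple path are distinct, because the
    first vertex of a step does not occur later. The step [z] leaving the last
    vertex is arbitrary, for the path to be closed by any further edge. *)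
Lemma path_edges (A : {set E}) u q : path (adjacent_in A) u q -> uniq (u :: q) ->
  exists p, [/\ unzip1 p = belast u q, uniq (unzip2 p),
    forall x, x \in p -> x.2 \in A,
    forall x, x \in p -> (src x.2 \in u :: q) && (tgt x.2 \in u :: q) &
    forall z, z.1 = last u q -> sorted next_joins (rcons p z)].
Proof.
elim: q u => [|v q IH] u; first by exists [::].
rewrite /= => /andP[/existsP[e /andP[eA euv]] vq] /andP[uvq Uvq].
have [p [p1 Up pA ends srt]] := IH v vq Uvq.
have inc f : f = e -> ~~ ((src f \in v :: q) && (tgt f \in v :: q)).
  move=> ->; case/orP: euv => /andP[/eqP h1 /eqP h2].
    by rewrite h1 (negPf uvq).
  by rewrite h2 (negPf uvq) andbF.
exists ((u, e) :: p); split=> /=; first by rewrite p1.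
- rewrite Up andbT; apply/mapP => -[x xp /esym xe].
  by have := inc _ xe; rewrite ends.
- by move=> x; rewrite inE => /predU1P[->|/pA].
- move=> x; rewrite inE => /predU1P[->|/ends /andP[h1 h2]] /=.
    by case/orP: euv => /andP[/eqP -> /eqP ->]; rewrite !inE !eqxx !orbT.
  by rewrite in_cons h1 orbT in_cons h2 orbT.
move=> z /[dup] zl /srt; have : unzip1 (rcons p z) = v :: q.
  by rewrite /unzip1 map_rcons -/(unzip1 p) p1 zl -lastI.
by case: (rcons p z) => // y ys [y1 _] /= ->; rewrite y1 euv.
Qed.

(** Remove edges until one is in the span of the others: it closes a path made of
    some of the others. *)
Lemma dependent_simple_cycle (A : {set E}) :
  (\dim (edge_span src tgt A) < #|A|)%N -> exists2 C, simple_cycle C & C \subset A.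
Proof.
elim: {A}_.+1 {-2}A (ltnSn #|A|) => // n IH A; rewrite ltnS => An dimA.
have [A0|[e eA]] := set_0Vmem A.
  by move: dimA; rewrite A0 cards0 ltn0.
have cardA : #|A| = #|A :\ e|.+1 by rewrite (cardsD1 e) eA.
have [dimA'|dimA'] := ltnP (\dim (edge_span src tgt (A :\ e))) #|A :\ e|.
  have [|C sC CA] := IH (A :\ e) _ dimA'; first by rewrite -cardA.
  by exists C => //; apply: subset_trans CA (subsetDl _ _).
have sub := edge_spanS (subsetDl A [set e]).
have eS : edge_vec src tgt e \in edge_span src tgt (A :\ e).
  have /eqP -> : edge_span src tgt (A :\ e) == edge_span src tgt A.
    by rewrite eqEdim sub (leq_trans _ dimA') // -ltnS -cardA.
  exact: mem_edge_span.
case/connectP: (span_connected eS) => q0 /shortenP[q adj_q Uq _] lastq {q0}.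
have [p [p1 Up pA _ srt]] := path_edges adj_q Uq.
pose z : V * E := (src e, e).
exists [set f in unzip2 (rcons p z)]; last first.
  apply/subsetP => f; rewrite inE => /mapP[x]; rewrite mem_rcons inE.
  case/predU1P=> [->|/pA xA] ->; first exact: eA.
  by move: xA; rewrite inE => /andP[].
exists (rcons p z); split=> //; apply/and4P.
have p1z : unzip1 (rcons p z) = tgt e :: q.
  by rewrite /unzip1 map_rcons -/(unzip1 p) p1 /z /= lastq -lastI.
split.
- by case: (p).
- by rewrite p1z.
- rewrite /unzip2 map_rcons rcons_uniq Up andbT; apply/mapP => -[x /pA xA /= xe].
  by move: xA; rewrite -xe !inE eqxx.
have := srt z lastq; move: p1z (last_rcons z p z).
case: (rcons p z) => //= y ys [y1 _] lastz ysP.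
by rewrite rcons_path ysP lastz /joins /= y1 !eqxx.
Qed.

Lemma oriented_cycle_tgt_inj C e f : oriented_alternating_cycle C ->
  e \in C -> f \in C -> tgt e = tgt f -> e = f.
Proof.
case=> p [/and4P[_ U1 _ _] -> orp _ _].
have Up : uniq p := map_uniq U1.
rewrite !inE => /mapP[x xp ->] /mapP[y yp ->].
have := next_cycle orp xp; have := next_cycle orp yp => /=.
move=> /andP[_ /eqP ->] /andP[_ /eqP ->] xy; congr _.2.
apply: (can_inj (prev_next Up)); apply: (uniq_map_injective U1) => //;
  by rewrite mem_next.
Qed.

Lemma oriented_cycle_next C e : oriented_alternating_cycle C -> e \in C ->
  exists f, [/\ f \in C, tgt e = src f & star f = ~~ star e].
Proof.
case=> p [sp -> orp _ alt]; rewrite inE => /mapP[x xp ->].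
have nxp : next p x \in p by rewrite mem_next.
exists (next p x).2; split; first by rewrite inE map_f.
  have /= /andP[_ /eqP->] := next_cycle orp xp.
  by have /= /andP[/eqP-> _] := next_cycle orp nxp.
by have /= := next_cycle alt xp; case: star; case: star.
Qed.

(** Each edge is followed by the next edge of its unique simple cycle. The walks
    are tight: a simple cycle left after the removal of an edge from each orbit
    would be the simple cycle of each of its edges, which contains the orbits of
    these edges, hence removed edges. *)
Lemma cactus_tight : oriented_alternating_cactus T ->
  (forall u v : V, connect (adjacent src tgt) u v) -> exists g, tight g.
Proof.
case=> cycles oriented conn.
have ex_cyc e : exists C : {set E}, [/\ simple_cycle C, e \in C &
    forall C', simple_cycle C' -> e \in C' -> C' = C].
  have [C [[sC eC] uC]] := cycles e; exists C; split=> // C' sC' eC'.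
  by symmetry; apply: uC.
have [cyc cycP] := boolp.choice ex_cyc.
have sc e : simple_cycle (cyc e) by case: (cycP e).
have cid e : e \in cyc e by case: (cycP e).
have cuniq e f : f \in cyc e -> cyc f = cyc e.
  by move=> fe; case: (cycP f) => _ _ u; symmetry; apply: u.
have ex_next e : exists f, [/\ f \in cyc e, tgt e = src f & star f = ~~ star e].
  exact: oriented_cycle_next (oriented _ (sc e)) (cid e).
have [g0 g0P] := boolp.choice ex_next.
have g0_inj : injective g0.
  move=> e f ef; have [ge te _] := g0P e; have [gf tf _] := g0P f.
  have cE : cyc e = cyc f by rewrite -(cuniq _ _ ge) ef (cuniq _ _ gf).
  apply: (oriented_cycle_tgt_inj (oriented _ (sc f))); rewrite -?cE //.
    by rewrite cE.
  by rewrite te tf ef.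
pose g : {perm E} := perm g0_inj.
have gE e : g e = g0 e by rewrite permE.
have g_next e : tgt e = src (g e) by rewrite gE; case: (g0P e).
have g_walks : alternating_walks star [set: E] src tgt g.
  apply/alternating_walksP; split=> // [|e _]; last by rewrite gE; case: (g0P e).
  by apply/subsetP => e _; rewrite inE.
exists g; rewrite /tight_walks g_walks /=.
have le := graph_rank_le_perm_length g_next.
rewrite eqn_leq le leqNgt; apply/negP => lt.
have orbit_cyc e i : (g ^+ i)%g e \in cyc e.
  elim: i => [|i IH]; first by rewrite expg0 perm1.
  by rewrite expgSr permM gE -(cuniq _ _ IH); case: (g0P ((g ^+ i)%g e)).
case: (pickP E) => [e0 _|E0]; last first.
  by move: lt; rewrite /perm_length (eq_card0 E0).
pose c (O : {set E}) := odflt e0 [pick f in O].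
have cP e : c (porbit g e) \in porbit g e.
  by rewrite /c; case: pickP => //= /(_ e); rewrite porbit_id.
have := @dependent_simple_cycle (cut_orbits g c).
rewrite (edge_span_cut_orbits g_next cP) card_cut_orbits //.
case=> [|D sD DR]; first exact: lt.
have [p [/and4P[p0 _ _ _] DE]] := sD; case: p p0 DE => // x p _ DE.
have xD : x.2 \in D by rewrite DE inE mem_head.
have DC : D = cyc x.2 by case: (cycP x.2) => _ _; apply.
have : c (porbit g x.2) \in D.
  have /porbitP[i ->] := cP x.2; rewrite DC; exact: orbit_cyc.
move/(subsetP DR); rewrite inE => /negP; apply.
apply/eqP; congr c; apply/eqP; by rewrite eq_sym eq_porbit_mem.
Qed.

End Cactus.

From mathcomp Require Import complex.
From mathcomp Require Import all_classical all_reals all_analysis.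
From mathcomp Require Import measurable_realfun.

Import numFieldNormedType.Exports.

Local Open Scope classical_set_scope.
Local Open Scope complex_scope.
Local Open Scope sesquilinear_scope.
Local Open Scope ring_scope.

(** * Bounded complex random variables *)

Section ComplexMeasurable.
Context {R : realType} {d : measure_display} {T : measurableType d}.
Implicit Types (X Y : T -> R[i]).
Local Notation Re := (@complex.Re R).
Local Notation Im := (@complex.Im R).

Definition complex_measurable X :=
  measurable_fun setT (Re \o X) /\ measurable_fun setT (Im \o X).

Lemma ReD (x y : R[i]) : Re (x + y) = Re x + Re y. Proof. by case: x; case: y. Qed.
Lemma ImD (x y : R[i]) : Im (x + y) = Im x + Im y. Proof. by case: x; case: y. Qed.
Lemma ReM (x y : R[i]) : Re (x * y) = Re x * Re y - Im x * Im y.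
Proof. by case: x; case: y. Qed.
Lemma ImM (x y : R[i]) : Im (x * y) = Re x * Im y + Im x * Re y.
Proof. by case: x => a b; case: y. Qed.

Lemma complex_measurable_cst c : complex_measurable (fun=> c).
Proof. by split; exact: measurable_cst. Qed.

Lemma complex_measurableD X Y : complex_measurable X -> complex_measurable Y ->
  complex_measurable (fun w => X w + Y w).
Proof.
move=> [X1 X2] [Y1 Y2]; split.
  rewrite (_ : _ \o _ = (Re \o X) \+ (Re \o Y)); first exact: measurable_funD.
  by apply/funext => w; exact: ReD.
rewrite (_ : _ \o _ = (Im \o X) \+ (Im \o Y)); first exact: measurable_funD.
by apply/funext => w; exact: ImD.
Qed.

Lemma complex_measurableM X Y : complex_measurable X -> complex_measurable Y ->
  complex_measurable (fun w => X w * Y w).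
Proof.
move=> [X1 X2] [Y1 Y2]; split.
  rewrite (_ : _ \o _ = ((Re \o X) \* (Re \o Y)) \- ((Im \o X) \* (Im \o Y))).
    by apply: measurable_funB; exact: measurable_funM.
  by apply/funext => w; exact: ReM.
rewrite (_ : _ \o _ = ((Re \o X) \* (Im \o Y)) \+ ((Im \o X) \* (Re \o Y))).
  by apply: measurable_funD; exact: measurable_funM.
by apply/funext => w; exact: ImM.
Qed.

Lemma complex_measurable_conj X : complex_measurable X ->
  complex_measurable (fun w => Num.conj (X w)).
Proof.
move=> [X1 X2]; split.
  by rewrite (_ : _ \o _ = Re \o X) //; apply/funext => w /=; case: (X w).
rewrite (_ : _ \o _ = \- (Im \o X)); first exact: measurable_funN.
by apply/funext => w /=; case: (X w).
Qed.

Lemma complex_measurable_sum I (r : seq I) (Q : pred I) (F : I -> T -> R[i]) :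
  (forall i, Q i -> complex_measurable (F i)) ->
  complex_measurable (fun w => \sum_(i <- r | Q i) F i w).
Proof.
move=> mF; elim: r => [|i r IH].
  by under eq_fun do rewrite big_nil; exact: complex_measurable_cst.
under eq_fun do rewrite big_cons.
by case: (boolP (Q i)) => Qi //; apply: complex_measurableD => //; exact: mF.
Qed.

Lemma complex_measurable_prod I (r : seq I) (Q : pred I) (F : I -> T -> R[i]) :
  (forall i, Q i -> complex_measurable (F i)) ->
  complex_measurable (fun w => \prod_(i <- r | Q i) F i w).
Proof.
move=> mF; elim: r => [|i r IH].
  by under eq_fun do rewrite big_nil; exact: complex_measurable_cst.
under eq_fun do rewrite big_cons.
by case: (boolP (Q i)) => Qi //; apply: complex_measurableM => //; exact: mF.
Qed.

End ComplexMeasurable.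

Section BoundedVariables.
Context {R : realType} {d : measure_display} {Omega : measurableType d}.
Variable P : probability Omega R.
Implicit Types (X Y : Omega -> R[i]).
Local Notation Re := (@complex.Re R).
Local Notation Im := (@complex.Im R).
Local Notation Ex := (complex_expectation P).

Definition bounded_variable X :=
  complex_measurable X /\ exists K : nat, forall w, `|X w| <= K%:R.

Lemma normc_Re_le (x : R[i]) (r : R) : `|x| <= r%:C -> `|Re x| <= r.
Proof.
by move=> xr; rewrite -lecR; apply: le_trans xr; exact: normc_ge_Re.
Qed.

Lemma normc_Im_le (x : R[i]) (r : R) : `|x| <= r%:C -> `|Im x| <= r.
Proof.
move=> xr; have -> : Im x = - Re (x * 'i) by case: {xr} x => a b; simpc.
rewrite normrN; apply: normc_Re_le; rewrite normrM.
by rewrite (_ : `|'i| = 1) ?mulr1 // normc_def /= expr0n expr1n add0r sqrtr1.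
Qed.

Lemma natr_complex (K : nat) : K%:R = (K%:R : R)%:C :> R[i].
Proof. by rewrite rmorph_nat. Qed.

Lemma bounded_Re_integrable X : bounded_variable X ->
  P.-integrable setT (EFin \o (Re \o X)).
Proof.
case=> -[mX _] [K XK]; apply: measurable_bounded_integrable => //.
  by apply: le_lt_trans (probability_le1 P measurableT) _; rewrite ltry.
exists K%:R; split; first exact: num_real.
move=> r Kr w _; apply: le_trans (ltW Kr); apply: normc_Re_le.
by rewrite -natr_complex.
Qed.

Lemma bounded_Im_integrable X : bounded_variable X ->
  P.-integrable setT (EFin \o (Im \o X)).
Proof.
case=> -[_ mX] [K XK]; apply: measurable_bounded_integrable => //.
  by apply: le_lt_trans (probability_le1 P measurableT) _; rewrite ltry.
exists K%:R; split; first exact: num_real.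
move=> r Kr w _; apply: le_trans (ltW Kr); apply: normc_Im_le.
by rewrite -natr_complex.
Qed.

Lemma nat_norm_bound (c : R[i]) : exists K : nat, `|c| <= K%:R.
Proof.
rewrite normc_def; set r := Num.sqrt _.
by exists (Num.bound r); rewrite natr_complex lecR ltW // archi_boundP ?sqrtr_ge0.
Qed.

Lemma bounded_cst c : bounded_variable (fun=> c).
Proof.
by split; [exact: complex_measurable_cst|have [K cK] := nat_norm_bound c; exists K].
Qed.

Lemma boundedD X Y : bounded_variable X -> bounded_variable Y ->
  bounded_variable (fun w => X w + Y w).
Proof.
move=> [mX [K XK]] [mY [L YL]]; split; first exact: complex_measurableD.
exists (K + L)%N => w; rewrite natrD; apply: le_trans (ler_normD _ _) _.
exact: lerD.
Qed.

Lemma boundedM X Y : bounded_variable X -> bounded_variable Y ->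
  bounded_variable (fun w => X w * Y w).
Proof.
move=> [mX [K XK]] [mY [L YL]]; split; first exact: complex_measurableM.
by exists (K * L)%N => w; rewrite natrM normrM ler_pM.
Qed.

Lemma bounded_conj X : bounded_variable X ->
  bounded_variable (fun w => Num.conj (X w)).
Proof.
move=> [mX [K XK]]; split; first exact: complex_measurable_conj.
by exists K => w; rewrite norm_conjC.
Qed.
Lemma bounded_sum I (r : seq I) (Q : pred I) (F : I -> Omega -> R[i]) :
  (forall i, Q i -> bounded_variable (F i)) ->
  bounded_variable (fun w => \sum_(i <- r | Q i) F i w).
Proof.
move=> mF; elim: r => [|i r IH].
  by under eq_fun do rewrite big_nil; exact: bounded_cst.
under eq_fun do rewrite big_cons.
by case: (boolP (Q i)) => Qi //; apply: boundedD => //; exact: mF.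
Qed.

Lemma bounded_prod I (r : seq I) (Q : pred I) (F : I -> Omega -> R[i]) :
  (forall i, Q i -> bounded_variable (F i)) ->
  bounded_variable (fun w => \prod_(i <- r | Q i) F i w).
Proof.
move=> mF; elim: r => [|i r IH].
  by under eq_fun do rewrite big_nil; exact: bounded_cst.
under eq_fun do rewrite big_cons.
by case: (boolP (Q i)) => Qi //; apply: boundedM => //; exact: mF.
Qed.

Lemma Rintegral_probability_cst (r : R) : \int[P]_(w in setT) r = r.
Proof.
by rewrite Rintegral_cst // [X in fine X](probability_setT P) mulr1.
Qed.

Lemma expectation_cst c : Ex (fun=> c) = c.
Proof.
by rewrite /complex_expectation !Rintegral_probability_cst; case: c.
Qed.

Lemma expectationD X Y : bounded_variable X -> bounded_variable Y ->
  Ex (fun w => X w + Y w) = Ex X + Ex Y.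
Proof.
move=> bX bY; rewrite /complex_expectation.
have -> : \int[P]_(w in setT) Re (X w + Y w) =
    \int[P]_(w in setT) Re (X w) + \int[P]_(w in setT) Re (Y w).
  rewrite -RintegralD //; [|exact: bounded_Re_integrable..].
  by apply: eq_Rintegral => w _; rewrite ReD.
have -> // : \int[P]_(w in setT) Im (X w + Y w) =
    \int[P]_(w in setT) Im (X w) + \int[P]_(w in setT) Im (Y w).
rewrite -RintegralD //; [|exact: bounded_Im_integrable..].
by apply: eq_Rintegral => w _; rewrite ImD.
Qed.

Lemma bounded_integrable_scale (f : Omega -> R) (r : R) :
  P.-integrable setT (EFin \o f) ->
  P.-integrable setT (EFin \o (fun w => r * f w)).
Proof.
by move=> fi; apply: (eq_integrable _ (fun w => r%:E * (EFin \o f) w)%E) => //;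
  exact: integrableZl.
Qed.

Lemma expectationZ c X : bounded_variable X ->
  Ex (fun w => c * X w) = c * Ex X.
Proof.
move=> bX; have i1 := bounded_Re_integrable bX.
have i2 := bounded_Im_integrable bX.
rewrite /complex_expectation.
have -> : \int[P]_(w in setT) Re (c * X w) =
    Re c * \int[P]_(w in setT) Re (X w) - Im c * \int[P]_(w in setT) Im (X w).
  rewrite -!RintegralZl // -RintegralB //; [|exact: bounded_integrable_scale..].
  by apply: eq_Rintegral => w _; rewrite ReM.
have -> : \int[P]_(w in setT) Im (c * X w) =
    Re c * \int[P]_(w in setT) Im (X w) + Im c * \int[P]_(w in setT) Re (X w).
  rewrite -!RintegralZl // -RintegralD //; [|exact: bounded_integrable_scale..].
  by apply: eq_Rintegral => w _; rewrite ImM.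
by case: c => a b; simpc.
Qed.

Lemma expectation_sum I (r : seq I) (Q : pred I) (F : I -> Omega -> R[i]) :
  (forall i, Q i -> bounded_variable (F i)) ->
  Ex (fun w => \sum_(i <- r | Q i) F i w) = \sum_(i <- r | Q i) Ex (F i).
Proof.
move=> bF; elim: r => [|i r IH].
  by under eq_fun do rewrite big_nil; rewrite expectation_cst big_nil.
under eq_fun do rewrite big_cons; rewrite big_cons -IH.
case: (boolP (Q i)) => Qi //; apply: expectationD; first exact: bF.
exact: bounded_sum.
Qed.

Lemma expectation_le (X : Omega -> R[i]) (K : nat) : complex_measurable X ->
  (forall w, `|X w| <= K%:R) -> `|Ex X| <= (2 * K)%:R.
Proof.
move=> mX XK; have bX : bounded_variable X by split => //; exists K.
have bound (f : Omega -> R) : P.-integrable setT (EFin \o f) ->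
    (forall w, `|f w| <= K%:R) -> `|\int[P]_(w in setT) f w| <= K%:R.
  move=> fi fK; apply: le_trans (le_normr_Rintegral measurableT fi) _.
  rewrite -[leRHS]Rintegral_probability_cst.
  apply: le_Rintegral => //; first exact: integrable_norm.
  by apply: (bounded_Re_integrable (bounded_cst (K%:R%:C : R[i]))).
rewrite /complex_expectation [X in `|X|]complexE /=.
apply: le_trans (ler_normD _ _) _; rewrite mul2n -addnn natrD.
have nC (r : R) : `|r%:C| = `|r|%:C :> R[i].
  by rewrite normc_def /= expr0n addr0 sqrtr_sqr.
apply: lerD.
  rewrite nC natr_complex lecR; apply: bound; first exact: bounded_Re_integrable.
  by move=> w; apply: normc_Re_le; rewrite -natr_complex.
rewrite normrM (_ : `|'i%C| = 1) ?mul1r; last first.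
  by rewrite normc_def /= expr0n expr1n add0r sqrtr1.
rewrite nC natr_complex lecR; apply: bound; first exact: bounded_Im_integrable.
by move=> w; apply: normc_Im_le; rewrite -natr_complex.
Qed.

End BoundedVariables.

(** * Invariance of the moments of a Haar matrix *)

(** The matrices, pointed in order to carry the sigma-algebra [mx_borel]. *)
Definition mx_space (R : realType) (N : nat) : Type := 'M[R[i]]_N.
HB.instance Definition _ (R : realType) N := Choice.on (mx_space R N).
HB.instance Definition _ (R : realType) N :=
  isPointed.Build (mx_space R N) (0 : 'M[R[i]]_N).

Section HaarInvariance.
Context {R : realType} {d : measure_display} {Omega : measurableType d}.
Variables (P : probability Omega R) (N : nat) (U : Omega -> 'M[R[i]]_N).
Hypothesis U_haar : unitary_haar P U.
Local Notation Re := (@complex.Re R).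
Local Notation Im := (@complex.Im R).
Local Notation Ex := (complex_expectation P).
Local Notation mxT := (g_sigma_algebraType (@mx_coordinate_sets R N : set (set (mx_space R N)))).

Lemma entry_measurable i j :
  complex_measurable (fun A : mxT => (A : 'M[R[i]]_N) i j).
Proof.
split=> _ S mS; rewrite setTI; apply: sub_sigma_algebra; exists i, j, S;
  split=> //; first [by left | by right].
Qed.

Lemma haar_entry_measurable i j : complex_measurable (fun w => U w i j).
Proof.
have [mU _ _] := U_haar.
split=> _ S mS; rewrite setTI.
  apply: (mU [set A : 'M[R[i]]_N | S (Re (A i j))]).
  by apply: sub_sigma_algebra; exists i, j, S; split=> //; left.
apply: (mU [set A : 'M[R[i]]_N | S (Im (A i j))]).
by apply: sub_sigma_algebra; exists i, j, S; split=> //; right.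
Qed.

Lemma translate_entry_measurable (V : 'M[R[i]]_N) i j :
  complex_measurable (fun w => (V *m U w) i j).
Proof.
under eq_fun do rewrite mxE.
apply: complex_measurable_sum => k _; apply: complex_measurableM.
  exact: complex_measurable_cst.
exact: haar_entry_measurable.
Qed.

Lemma measurable_to_mx (X : Omega -> 'M[R[i]]_N) :
  (forall i j, complex_measurable (fun w => X w i j)) ->
  measurable_fun setT (X : Omega -> mxT).
Proof.
move=> mX.
apply: (@measurability _ _ _ mxT _ _ (@mx_coordinate_sets R N : set (set mxT))) => //.
move=> _ [_ [i [j [S [mS [|] ->]]]] <-]; have [m1 m2] := mX i j.
  exact: m1.
exact: m2.
Qed.

Lemma haar_Rintegral (V : 'M[R[i]]_N) (f : mxT -> R) :
  V \is unitarymx -> measurable_fun setT f ->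
  P.-integrable setT (EFin \o (fun w => f (V *m U w))) ->
  P.-integrable setT (EFin \o (fun w => f (U w))) ->
  \int[P]_(w in setT) f (V *m U w) = \int[P]_(w in setT) f (U w).
Proof.
move=> VU mf i1 i2; have [_ _ inv] := U_haar.
have m1 : measurable_fun setT ((fun w => V *m U w) : Omega -> mxT).
  by apply: measurable_to_mx => i j; exact: translate_entry_measurable.
have m2 : measurable_fun setT (U : Omega -> mxT).
  by apply: measurable_to_mx => i j; exact: haar_entry_measurable.
have mF : measurable_fun setT (EFin \o f) by exact/measurable_EFinP.
rewrite /Rintegral; congr fine.
have := @integral_pushforward _ _ _ _ _ _ m1 P setT (EFin \o f) mF.
have := @integral_pushforward _ _ _ _ _ _ m2 P setT (EFin \o f) mF.
rewrite !preimage_setT => /(_ i2 measurableT) /= <- /(_ i1 measurableT) /= <-.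
apply: eq_measure_integral => B mB _.
exact: (inv V VU B mB).
Qed.

Lemma haar_expectation (V : 'M[R[i]]_N) (F : mxT -> R[i]) :
  V \is unitarymx -> complex_measurable F ->
  bounded_variable (fun w => F (V *m U w)) ->
  bounded_variable (fun w => F (U w)) ->
  Ex (fun w => F (V *m U w)) = Ex (fun w => F (U w)).
Proof.
move=> VU [m1 m2] b1 b2; rewrite /complex_expectation.
rewrite (haar_Rintegral VU m1); [|exact: bounded_Re_integrable b1
  |exact: bounded_Re_integrable b2].
by rewrite (haar_Rintegral VU m2); [|exact: bounded_Im_integrable b1
  |exact: bounded_Im_integrable b2].
Qed.

Lemma unitary_entry_le (A : 'M[R[i]]_N) i j : A \is unitarymx -> `|A i j| <= 1.
Proof.
move/unitarymxP => /matrixP/(_ i i); rewrite !mxE eqxx => AA.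
rewrite -(@expr_le1 _ 2) // normCK -[leRHS]AA (bigD1 j) //= !mxE lerDl.
by apply: sumr_ge0 => k _; rewrite !mxE mul_conjC_ge0.
Qed.

Lemma haar_entry_bounded (V : 'M[R[i]]_N) i j : V \is unitarymx ->
  bounded_variable (fun w => (V *m U w) i j).
Proof.
move=> VU; split; first exact: translate_entry_measurable.
by have [_ UU _] := U_haar; exists 1%N => w; apply: unitary_entry_le; apply: mul_unitarymx.
Qed.

Lemma haar_bounded i j : bounded_variable (fun w => U w i j).
Proof.
split; first exact: haar_entry_measurable.
by have [_ UU _] := U_haar; exists 1%N => w; apply: unitary_entry_le.
Qed.

End HaarInvariance.

Lemma deriv_prod (F : comNzRingType) (I : finType) (S : {set I}) (p : I -> {poly F}) :
  (\prod_(e in S) p e)^`() =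
  \sum_(e in S) (p e)^`() * \prod_(f in S :\ e) p f.
Proof.
elim: {S}_.+1 {-2}S (ltnSn #|S|) => // n IH S; rewrite ltnS => Sn.
have [->|[x xS]] := set_0Vmem S; first by rewrite !big_set0 derivC.
rewrite (big_setD1 x) //= derivM [RHS](big_setD1 x) //=; congr (_ + _).
rewrite IH; last by rewrite [#|S|](cardsD1 x) xS in Sn.
rewrite mulr_sumr; apply: eq_bigr => e; rewrite !inE => /andP[ex eS].
rewrite mulrCA; congr (_ * _); rewrite [RHS](big_setD1 x) ?inE 1?eq_sym ?ex //=.
by congr (_ * _); apply: eq_bigl => f; rewrite !inE andbCA.
Qed.

Section PolynomialExpectation.
Context {R : realType} {d : measure_display} {Omega : measurableType d}.
Variable P : probability Omega R.
Local Notation Ex := (complex_expectation P).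
Implicit Types p : Omega -> {poly R[i]}.

(** A condition for the expectation to commute with evaluation and derivation. *)
Definition bounded_poly p :=
  (forall k, bounded_variable (fun w => (p w)`_k)) /\
  exists m, forall w, (size (p w) <= m)%N.

Lemma bounded_polyM p q : bounded_poly p -> bounded_poly q ->
  bounded_poly (fun w => p w * q w).
Proof.
move=> [bp [m pm]] [bq [n qn]]; split=> [k|].
  under eq_fun do rewrite coefM.
  by apply: bounded_sum => i _; apply: boundedM.
exists (m + n)%N => w; apply: leq_trans (size_polyMleq _ _) _.
by rewrite (leq_trans (leq_pred _)) // leq_add.
Qed.

Lemma bounded_poly_linear (a b : Omega -> R[i]) :
  bounded_variable a -> bounded_variable b ->
  bounded_poly (fun w => (a w)%:P + b w *: 'X).
Proof.
move=> ba bb; split=> [k|].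
  under eq_fun do rewrite coefD coefC coefZ coefX.
  apply: boundedD; first by case: k => [//|k] /=; exact: bounded_cst.
  by apply: boundedM => //; exact: bounded_cst.
exists 2%N => w; apply: leq_trans (size_polyD _ _) _.
rewrite geq_max (leq_trans (size_polyC_leq1 _)) //=.
by rewrite (leq_trans (size_scale_leq _ _)) // size_polyX.
Qed.

Lemma bounded_poly_prod (I : finType) (S : {set I}) (p : I -> Omega -> {poly R[i]}) :
  (forall e, bounded_poly (p e)) ->
  bounded_poly (fun w => \prod_(e in S) p e w).
Proof.
move=> bp; suff : forall r : seq I, bounded_poly (fun w => \prod_(e <- r | e \in S) p e w).
  by apply.
elim=> [|e r IH].
  under eq_fun do rewrite big_nil; split=> [k|]; first exact: bounded_cst.
  by exists 1%N => w; rewrite size_poly1.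
under eq_fun do rewrite big_cons.
by case: (e \in S) => //; apply: bounded_polyM.
Qed.

Lemma expectation_poly p : bounded_poly p ->
  exists q : {poly R[i]},
    (forall z, q.[z] = Ex (fun w => (p w).[z])) /\
    (forall z, q^`().[z] = Ex (fun w => (p w)^`().[z])).
Proof.
move=> [bp [m pm]]; pose q := \poly_(k < m) Ex (fun w => (p w)`_k).
have qE k : q`_k = Ex (fun w => (p w)`_k).
  rewrite coef_poly; case: ltnP => // mk.
  under eq_fun => w do rewrite nth_default ?(leq_trans (pm w)) //.
  by rewrite expectation_cst.
exists q; split=> z.
  rewrite (horner_coef_wide _ (size_poly _ _)).
  have -> : (fun w => (p w).[z]) = fun w => \sum_(k < m) (p w)`_k * z ^+ k.
    by apply/funext => w; rewrite (horner_coef_wide _ (pm w)).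
  rewrite expectation_sum => [|k _]; last first.
    by apply: boundedM => //; exact: bounded_cst.
  apply: eq_bigr => k _; rewrite qE mulrC -expectationZ //.
  by congr complex_expectation; apply/funext => w; rewrite mulrC.
have le (r : {poly R[i]}) : (size r <= m)%N -> (size r^`() <= m)%N.
  by move=> rm; rewrite (leq_trans _ rm) // (leq_trans (size_poly _ _)) ?leq_pred.
rewrite (horner_coef_wide _ (le _ (size_poly _ _))).
have -> : (fun w => (p w)^`().[z]) =
    fun w => \sum_(k < m) (p w)^`()`_k * z ^+ k.
  by apply/funext => w; rewrite (horner_coef_wide _ (le _ (pm w))).
rewrite expectation_sum => [|k _]; last first.
  under eq_fun do rewrite coef_deriv -mulr_natr.
  by do 2![apply: boundedM; last exact: bounded_cst].
apply: eq_bigr => k _; rewrite coef_deriv qE -mulr_natr -mulrA mulrC -expectationZ //.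
congr complex_expectation; apply/funext => w.
by rewrite coef_deriv -mulr_natr; ring.
Qed.

End PolynomialExpectation.

(** * The loop equation *)

Lemma sum_delta (K : pzRingType) (I : finType) (c : I) (f : I -> K) :
  \sum_j (c == j)%:R * f j = f c.
Proof.
rewrite (bigD1 c) //= eqxx mul1r big1 ?addr0 // => j.
by rewrite eq_sym => /negPf->; rewrite mul0r.
Qed.

(** Polarization, with vectors supported by at most two points. *)
Lemma sesquilinear_form_eq0 (C : numClosedFieldType) N (c : 'I_N -> 'I_N -> C) :
  (forall v : 'I_N -> C, \sum_k v k * (v k)^* != 0 ->
    \sum_j \sum_k v j * (v k)^* * c j k = 0) ->
  forall a b, c a b = 0.
Proof.
move=> H.
have delta a (f : 'I_N -> C) : \sum_j (j == a)%:R * f j = f a.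
  by under eq_bigr do rewrite eq_sym; exact: sum_delta.
have two a b e (f : 'I_N -> C) :
    \sum_j ((j == a)%:R + e * (j == b)%:R) * f j = f a + e * f b.
  under eq_bigr do rewrite mulrDl -mulrA.
  by rewrite big_split /= -mulr_sumr !delta.
have form a b e : \sum_k ((k == a)%:R + e * (k == b)%:R) *
      ((k == a)%:R + e * (k == b)%:R)^* != 0 ->
    c a a + e^* * c a b + e * (c b a + e^* * c b b) = 0.
  move=> /H <-; rewrite (eq_bigr (fun j => ((j == a)%:R + e * (j == b)%:R) *
      (c j a + e^* * c j b))) ?two // => j _.
  under eq_bigr do rewrite -mulrA; rewrite -mulr_sumr; congr (_ * _).
  by under eq_bigr do rewrite rmorphD rmorphM /= !conjC_nat; rewrite two.
have norm (a b : 'I_N) (e : C) : a != b -> \sum_k ((k == a)%:R + e * (k == b)%:R) *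
      ((k == a)%:R + e * (k == b)%:R)^* = 1 + e * e^*.
  move=> ab; rewrite (two a b e (fun k => ((k == a)%:R + e * (k == b)%:R)^*)).
  rewrite !rmorphD !rmorphM /= !conjC_nat eqxx [b == a]eq_sym.
  by rewrite (negPf ab) eqxx mulr0 mulr1 addr0 add0r.
have normn0 (a b : 'I_N) (e : C) : a != b -> \sum_k ((k == a)%:R + e * (k == b)%:R) *
      ((k == a)%:R + e * (k == b)%:R)^* != 0.
  move=> ab; rewrite norm // gt_eqF // ltr_pwDl ?ltr01 //.
  exact: mul_conjC_ge0.
have diag a : c a a = 0.
  have := form a a 0; rewrite rmorph0 !mul0r !addr0; apply.
  rewrite (eq_bigr (fun k => (k == a)%:R * 1)) ?delta ?oner_eq0 // => k _.
  by rewrite mul0r addr0 conjC_nat; case: eqP; rewrite !(mulr1, mulr0).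
move=> a b; have [->|ab] := eqVneq a b; first exact: diag.
have h1 := form a b 1 (normn0 _ _ _ ab).
have hi := form a b 'i (normn0 _ _ _ ab).
move: h1 hi; rewrite !diag conjC1 conjCi !mulr0 !addr0 !add0r !mul1r => h1 hi.
have : 'i * (c b a - c a b) = 0 by rewrite -hi; ring.
move/eqP; rewrite mulf_eq0 (negPf (neq0Ci _)) /= subr_eq0 => /eqP eq.
move: h1; rewrite eq -mulr2n => /eqP; rewrite mulrn_eq0 /= => /eqP //.
Qed.

(** The Cayley transforms of the first [n] natural numbers. *)
Lemma unit_circle_points (C : numClosedFieldType) (n : nat) :
  exists rs : seq C, [/\ uniq rs, size rs = n & forall z, z \in rs -> z * z^* = 1].
Proof.
pose z (t : nat) : C := (1 + 'i * t%:R) / (1 - 'i * t%:R).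
have nz (t : nat) : 1 - 'i * t%:R != 0 :> C.
  have : (1 - 'i * t%:R) * (1 + 'i * t%:R) = (1 + t ^ 2)%:R :> C.
    transitivity (1 - 'i ^+ 2 * t%:R ^+ 2 : C); first by ring.
    by rewrite sqrCi mulN1r opprK natrD natrX.
  by move=> h; apply: contra_eqN h => /eqP->; rewrite mul0r eq_sym pnatr_eq0.
have nz' (t : nat) : 1 + 'i * t%:R != 0 :> C.
  rewrite -conjC_eq0 rmorphD rmorphM /= conjC1 conjCi conjC_nat mulNr; exact: nz.
exists [seq z t | t <- iota 0 n]; split.
- rewrite map_inj_uniq ?iota_uniq // => t u /eqP; rewrite /z eqr_div //.
  move/eqP => eq; have : 'i * 2 * (t%:R - u%:R) = 0 :> C.
    have -> : 'i * 2 * (t%:R - u%:R) = (1 + 'i * t%:R) * (1 - 'i * u%:R) -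
      (1 + 'i * u%:R) * (1 - 'i * t%:R) :> C by ring.
    by rewrite eq subrr.
  move/eqP; rewrite mulf_eq0 mulf_eq0 (negPf (neq0Ci _)) pnatr_eq0 /= subr_eq0.
  by rewrite eqr_nat => /eqP.
- by rewrite size_map size_iota.
move=> _ /mapP[t _ ->]; rewrite /z rmorphM fmorphV rmorphB rmorphD rmorphM /=.
rewrite conjC1 conjCi conjC_nat mulNr opprK.
by field; rewrite nz nz'.
Qed.

Section LoopEquation.
Context {R : realType} {d : measure_display} {Omega : measurableType d}.
Variables (P : probability Omega R) (N : nat) (U : Omega -> 'M[R[i]]_N).
Hypothesis U_haar : unitary_haar P U.
Variables (E : finType) (star : E -> bool).
Implicit Types (S : {set E}) (s t : E -> 'I_N) (A M Q : 'M[R[i]]_N).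
Local Notation Ex := (complex_expectation P).

Definition edge_factor s t A (e : E) : R[i] :=
  if star e then (A (s e) (t e))^* else A (t e) (s e).

Definition monomial S s t A : R[i] := \prod_(e in S) edge_factor s t A e.

Definition moment S s t : R[i] := Ex (fun w => monomial S s t (U w)).

Lemma bounded_factor s t e : bounded_variable (fun w => edge_factor s t (U w) e).
Proof.
rewrite /edge_factor; case: star; last exact: (haar_bounded U_haar).
by apply: bounded_conj; exact: (haar_bounded U_haar).
Qed.

Lemma bounded_monomial S s t : bounded_variable (fun w => monomial S s t (U w)).
Proof. by apply: bounded_prod => e _; exact: bounded_factor. Qed.

(** The derivative at [h = 0] of [monomial S s t] when [A] is replaced by
    [(1 + h M) A] and the conjugate of [A] by [(1 - h M^T)] times itself: for [M]
    hermitian and [h] imaginary these are conjugate, and extending this by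
    linearity in [M] allows matrix units. *)
Definition derivation S s t M A : R[i] := \sum_(e in S)
  (if star e then - \sum_k M k (s e) * (A k (t e))^*
   else \sum_k M (t e) k * A k (s e)) * \prod_(f in S :\ e) edge_factor s t A f.

(** For a projection [Q], the matrix 1 + (z - 1) Q is unitary when [z] is on the
    unit circle. Translating [A] by it multiplies the entries by polynomials of
    degree one in [z] or, for conjugate entries, in 1/z; the latter are multiplied
    by [z] here. *)
Definition rotation_factor s t Q A (e : E) : {poly R[i]} :=
  if star e then (((Q *m A) (s e) (t e))^*)%:P +
     ((A (s e) (t e))^* - ((Q *m A) (s e) (t e))^*) *: 'X
  else (A (t e) (s e) - (Q *m A) (t e) (s e))%:P + (Q *m A) (t e) (s e) *: 'X.

Lemma rotation_factor_horner s t Q A e z : z * z^* = 1 ->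
  (rotation_factor s t Q A e).[z] =
  (if star e then z else 1) *
  edge_factor s t ((1%:M + (z - 1) *: Q) *m A) e.
Proof.
move=> zz; rewrite /rotation_factor /edge_factor mulmxDl mul1mx -scalemxAl.
move: (Q *m A) => B.
case: star; rewrite hornerD hornerC hornerZ hornerX ?mul1r !mxE; last by ring.
rewrite rmorphD rmorphM rmorphB rmorph1 /=.
set x := (A _ _)^*; set y := (B _ _)^*.
have -> : z * (x + (z^* - 1) * y) = z * x + (z * z^* - z) * y by ring.
by rewrite zz; ring.
Qed.

Lemma rotation_factor_horner1 s t Q A e :
  (rotation_factor s t Q A e).[1] = edge_factor s t A e.
Proof.
have := @rotation_factor_horner s t Q A e 1.
rewrite mul1r conjC1 => /(_ erefl) ->; rewrite subrr scale0r addr0 mul1mx.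
by case: star; rewrite mul1r.
Qed.

Lemma rotation_deriv S s t Q A : Q^t* = Q ->
  ((\prod_(e in S) rotation_factor s t Q A e)^`()).[1] =
  #|[set e in S | star e]|%:R * monomial S s t A + derivation S s t Q A.
Proof.
move=> Qh; rewrite deriv_prod horner_sum.
have QE j k : (Q j k)^* = Q k j by rewrite -[in RHS]Qh !mxE.
have -> : #|[set e in S | star e]|%:R * monomial S s t A = \sum_(e in S)
    (if star e then edge_factor s t A e else 0) *
      \prod_(f in S :\ e) edge_factor s t A f.
  rewrite -sum1_card natr_sum mulr_suml big_mkcond [RHS]big_mkcond.
  apply: eq_bigr => e _; rewrite inE; case: (boolP (e \in S)) => //= eS.
  case: (boolP (star e)) => se; rewrite ?mul0r // mul1r.
  by rewrite /monomial (big_setD1 e).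
rewrite /derivation -big_split; apply: eq_bigr => e eS /=.
rewrite hornerM horner_prod.
under eq_bigr do rewrite rotation_factor_horner1.
rewrite -mulrDl; congr (_ * _).
rewrite /rotation_factor /edge_factor; case: star.
  rewrite derivD derivC add0r derivZ derivX hornerZ hornerC mulr1.
  congr (_ - _); rewrite mxE rmorph_sum; apply: eq_bigr => k _.
  by rewrite rmorphM /= QE.
by rewrite derivD derivC add0r derivZ derivX hornerZ hornerC mulr1 add0r mxE.
Qed.

Lemma rotation_unitary Q z : Q^t* = Q -> Q *m Q = Q -> z * z^* = 1 ->
  1%:M + (z - 1) *: Q \is unitarymx.
Proof.
move=> Qh QQ zz; apply/unitarymxP.
rewrite linearD linearZ /= trmx1 map_mxD map_mxZ map_mx1 Qh rmorphB /= conjC1.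
rewrite mulmxDl mul1mx mulmxDr mulmx1 -!scalemxAl -!scalemxAr QQ scalerA.
rewrite -!addrA -scalerDl -scalerDl.
have -> : z^* - 1 + (z - 1 + (z - 1) * (z^* - 1)) = z * z^* - 1 by ring.
by rewrite zz subrr scale0r addr0.
Qed.

Lemma bounded_rotation S s t Q :
  bounded_poly (fun w => \prod_(e in S) rotation_factor s t Q (U w) e).
Proof.
have bQ i j : bounded_variable (fun w => (Q *m U w) i j).
  under eq_fun do rewrite mxE.
  apply: bounded_sum => k _; apply: boundedM; first exact: bounded_cst.
  exact: (haar_bounded U_haar).
have bopp X : bounded_variable X -> bounded_variable (fun w : Omega => - X w : R[i]).
  by move=> bX; under eq_fun do rewrite -mulN1r; apply: boundedM => //;
    exact: bounded_cst.
apply: bounded_poly_prod => e; rewrite /rotation_factor; case: star.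
  apply: bounded_poly_linear; first by apply: bounded_conj.
  apply: boundedD; last by apply: bopp; apply: bounded_conj.
  by apply: bounded_conj; exact: (haar_bounded U_haar).
apply: bounded_poly_linear => //.
by apply: boundedD; [exact: (haar_bounded U_haar)|exact: bopp].
Qed.

Lemma bounded_derivation S s t M :
  bounded_variable (fun w => derivation S s t M (U w)).
Proof.
have bs (f : 'I_N -> R[i]) (g : Omega -> 'I_N -> R[i]) :
    (forall k, bounded_variable (g ^~ k)) ->
    bounded_variable (fun w => \sum_k f k * g w k).
  by move=> bg; apply: bounded_sum => k _; apply: boundedM => //; exact: bounded_cst.
apply: bounded_sum => e _; apply: boundedM; last first.
  by apply: bounded_prod => f _; exact: bounded_factor.
case: star; last by apply: bs => k; exact: (haar_bounded U_haar).
under eq_fun do rewrite -mulN1r.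
apply: boundedM; first exact: bounded_cst.
by apply: bs => k; apply: bounded_conj; exact: (haar_bounded U_haar).
Qed.

(** By invariance the polynomial of the previous lemmas has the expectation
    [z ^+ m * moment S s t] on the unit circle, hence everywhere. Differentiate at
    [z = 1]. *)
Lemma derivation_projection S s t Q : Q^t* = Q -> Q *m Q = Q ->
  Ex (fun w => derivation S s t Q (U w)) = 0.
Proof.
move=> Qh QQ; set m := #|[set e in S | star e]|.
have [q [qz qd]] := expectation_poly P (bounded_rotation S s t Q).
have q_circle z : z * z^* = 1 -> q.[z] = z ^+ m * moment S s t.
  move=> zz; rewrite qz /moment.
  have VU := rotation_unitary Qh QQ zz.
  have mono_m : complex_measurable (fun A : g_sigma_algebraType
      (@mx_coordinate_sets R N : set (set (mx_space R N))) => monomial S s t A).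
    apply: complex_measurable_prod => e _; rewrite /edge_factor.
    case: star; last exact: entry_measurable.
    by apply: complex_measurable_conj; exact: entry_measurable.
  have mono_b : bounded_variable
      (fun w => monomial S s t ((1%:M + (z - 1) *: Q) *m U w)).
    apply: bounded_prod => e _; rewrite /edge_factor.
    case: star; last exact: (haar_entry_bounded U_haar).
    by apply: bounded_conj; exact: (haar_entry_bounded U_haar).
  rewrite -(haar_expectation U_haar VU mono_m mono_b (bounded_monomial S s t)).
  rewrite -expectationZ //; congr complex_expectation; apply/funext => w.
  rewrite horner_prod (eq_bigr _ (fun e _ => rotation_factor_horner s t Q (U w) e zz)).
  rewrite big_split /=; congr (_ * _).
  rewrite -big_mkcondr /= prodr_const; congr (_ ^+ _).
  by apply: eq_card => e; rewrite !inE.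
have qE : q = moment S s t *: 'X^m.
  apply/eqP; rewrite -subr_eq0; apply: contraT => nz.
  have [rs [rs_uniq rs_size rs_circle]] :=
    unit_circle_points R[i] (size (q - moment S s t *: 'X^m)).
  have := max_poly_roots nz _ rs_uniq; rewrite rs_size ltnn; apply.
  apply/allP => z /rs_circle zz.
  by rewrite rootE hornerD hornerN hornerZ hornerXn q_circle // mulrC subrr.
have := qd 1; rewrite qE derivZ derivXn hornerZ hornerMn hornerXn expr1n.
have -> : Ex (fun w => (\prod_(e in S) rotation_factor s t Q (U w) e)^`().[1]) =
    Ex (fun w => m%:R * monomial S s t (U w) + derivation S s t Q (U w)).
  by congr complex_expectation; apply/funext => w; rewrite rotation_deriv.
rewrite expectationD; last exact: bounded_derivation.
  rewrite expectationZ; last exact: bounded_monomial.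
  rewrite -/(moment S s t) => eq; apply: (addrI (m%:R * moment S s t)).
  by rewrite addr0 -eq mulrC.
by apply: boundedM; [exact: bounded_cst|exact: bounded_monomial].
Qed.

Definition unit_derivation S s t a b A : R[i] := \sum_(e in S)
  (if star e then - ((s e == b)%:R * (A a (t e))^*)
   else (t e == a)%:R * A b (s e)) * \prod_(f in S :\ e) edge_factor s t A f.

Lemma derivation_unit S s t M A : derivation S s t M A =
  \sum_a \sum_b M a b * unit_derivation S s t a b A.
Proof.
under [RHS]eq_bigr do under eq_bigr do rewrite mulr_sumr.
under [RHS]eq_bigr do rewrite exchange_big /=.
rewrite exchange_big /=; apply: eq_bigr => e _.
under [RHS]eq_bigr do under eq_bigr do rewrite mulrA.
under [RHS]eq_bigr do rewrite -mulr_suml.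
rewrite -mulr_suml; congr (_ * _); case: star.
  rewrite -sumrN; apply: eq_bigr => a _.
  under eq_bigr do rewrite mulrN mulrCA.
  by rewrite sumrN sum_delta.
under [RHS]eq_bigr do under eq_bigr do rewrite mulrCA.
under [RHS]eq_bigr do rewrite -mulr_sumr.
by rewrite sum_delta.
Qed.

Lemma bounded_unit_derivation S s t a b :
  bounded_variable (fun w => unit_derivation S s t a b (U w)).
Proof.
apply: bounded_sum => e _; apply: boundedM; last first.
  by apply: bounded_prod => f _; exact: bounded_factor.
case: star.
  under eq_fun do rewrite -mulN1r.
  apply: boundedM; first exact: bounded_cst.
  apply: boundedM; first exact: bounded_cst.
  by apply: bounded_conj; exact: (haar_bounded U_haar).
by apply: boundedM; [exact: bounded_cst|exact: (haar_bounded U_haar)].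
Qed.

Lemma expectation_unit_derivation S s t a b :
  Ex (fun w => unit_derivation S s t a b (U w)) = 0.
Proof.
move: a b; apply: sesquilinear_form_eq0 => v n0.
set n := \sum_k _ in n0.
pose Q : 'M[R[i]]_N := \matrix_(j, k) (v j * (v k)^* / n).
have n_real : n^* = n.
  rewrite /n rmorph_sum; apply: eq_bigr => k _.
  by rewrite rmorphM /= conjCK mulrC.
have Qh : Q^t* = Q.
  apply/matrixP => j k; rewrite !mxE !rmorphM fmorphV /= n_real conjCK.
  by congr (_ * _); rewrite mulrC.
have QQ : Q *m Q = Q.
  apply/matrixP => j k; rewrite !mxE.
  rewrite (eq_bigr (fun l => (v j * (v k)^* / n / n) * (v l * (v l)^*))).
    by rewrite -mulr_sumr -/n divfK.
  by move=> l _; rewrite !mxE; ring.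
have := derivation_projection S s t Qh QQ.
have -> : Ex (fun w => derivation S s t Q (U w)) =
    \sum_a \sum_b Q a b * Ex (fun w => unit_derivation S s t a b (U w)).
  under eq_fun do rewrite derivation_unit.
  have bb a b : bounded_variable
      (fun w => Q a b * unit_derivation S s t a b (U w)).
    by apply: boundedM; [exact: bounded_cst|exact: bounded_unit_derivation].
  rewrite expectation_sum; last by move=> a _; apply: bounded_sum.
  apply: eq_bigr => a _; rewrite expectation_sum //; apply: eq_bigr => b _.
  by rewrite expectationZ //; exact: bounded_unit_derivation.
move=> Q0; rewrite -[LHS](divfK n0) -[RHS](mul0r n); congr (_ * _).
rewrite -[RHS]Q0 mulr_suml; apply: eq_bigr => a _; rewrite mulr_suml.
by apply: eq_bigr => b _; rewrite mxE mulrAC.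
Qed.

(** Without conjugates, the derivation along the identity matrix multiplies a
    monomial by its degree. *)
Lemma moment_nostar S s t : S != finset.set0 -> (forall e, e \in S -> ~~ star e) ->
  moment S s t = 0.
Proof.
move=> S0 nostar.
have : \sum_a Ex (fun w => unit_derivation S s t a a (U w)) = 0.
  by apply: big1 => a _; exact: expectation_unit_derivation.
rewrite -expectation_sum; last by move=> a _; exact: bounded_unit_derivation.
have -> : (fun w => \sum_a unit_derivation S s t a a (U w)) =
    fun w => #|S|%:R * monomial S s t (U w).
  apply/funext => w; rewrite exchange_big /= -sum1_card natr_sum mulr_suml.
  apply: eq_bigr => e eS; rewrite -mulr_suml (negPf (nostar e eS)) sum_delta mul1r.
  by rewrite /monomial (big_setD1 e eS) {2}/edge_factor (negPf (nostar e eS)).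
rewrite expectationZ; last exact: bounded_monomial.
by move/eqP; rewrite mulf_eq0 pnatr_eq0 cards_eq0 (negPf S0) => /eqP.
Qed.

Lemma eq_factor s s' t A e : s e = s' e ->
  edge_factor s t A e = edge_factor s' t A e.
Proof. by rewrite /edge_factor => ->. Qed.

(** Replace the source of [b] by [k], apply the derivation along the matrix unit
    [(s b, k)], and sum over [k]. Derived at [b], the monomial is recovered [N]
    times. Derived at another starred edge [x], it has the sources of [b] and [x]
    exchanged. Derived at an unstarred edge, it contains the product of two columns
    of a unitary matrix, which is 0 or 1. *)
Theorem loop_equation S s t b : b \in S -> star b ->
  N%:R * moment S s t =
  \sum_(a in S | [&& ~~ star a, s a == t b & t a == s b])
     moment (S :\ b :\ a) (s \o tperm b a) t
  - \sum_(x in S | star x && (x != b)) moment S (s \o tperm b x) t.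
Proof.
move=> bS sb; pose sk (k : 'I_N) e := if e == b then k else s e.
have : \sum_k Ex (fun w => unit_derivation S (sk k) t (s b) k (U w)) = 0.
  by apply: big1 => k _; exact: expectation_unit_derivation.
rewrite -expectation_sum; last by move=> k _; exact: bounded_unit_derivation.
have [_ UU _] := U_haar.
have pointwise w : \sum_k unit_derivation S (sk k) t (s b) k (U w) =
    \sum_(a in S | [&& ~~ star a, s a == t b & t a == s b])
        monomial (S :\ b :\ a) (s \o tperm b a) t (U w)
    + (- 1) * (\sum_(x in S | star x && (x != b))
        monomial S (s \o tperm b x) t (U w))
    + (- 1) * (N%:R * monomial S s t (U w)).
  set A := U w.
  have sk_ne k f : f != b -> edge_factor (sk k) t A f = edge_factor s t A f.
    by move=> fb; apply: eq_factor; rewrite /sk (negPf fb).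
  rewrite exchange_big /= (big_setD1 b) //= addrC; congr (_ + _); last first.
    rewrite sb mulN1r (eq_bigr (fun=> - monomial S s t A)); last first.
      move=> k _; rewrite {1}/sk eqxx eqxx mul1r /monomial (big_setD1 b bS) /=.
      rewrite {2}/edge_factor sb mulNr; congr (- (_ * _)).
      by apply: eq_bigr => f; rewrite !inE => /andP[fb _]; exact: sk_ne.
    by rewrite sumr_const card_ord mulr_natl mulNrn.
  have rest e : e \in S :\ b -> forall k,
      \prod_(f in S :\ e) edge_factor (sk k) t A f =
      (A k (t b))^* * \prod_(f in S :\ b :\ e) edge_factor s t A f.
    rewrite !inE => /andP[eb eS] k.
    rewrite (big_setD1 b) ?inE 1?eq_sym ?eb //=; congr (_ * _).
      by rewrite /edge_factor sb /sk eqxx.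
    rewrite (eq_bigl (mem (S :\ b :\ e))) => [|f]; last by rewrite !inE andbCA.
    by apply: eq_bigr => f; rewrite !inE => /and3P[_ fb _]; exact: sk_ne.
  have main e : e \in S :\ b -> \sum_k
      (if star e then - ((sk k e == k)%:R * (A (s b) (t e))^*)
       else (t e == s b)%:R * A k (sk k e)) *
        \prod_(f in S :\ e) edge_factor (sk k) t A f =
      if star e then - monomial S (s \o tperm b e) t A
      else if (s e == t b) && (t e == s b)
        then monomial (S :\ b :\ e) (s \o tperm b e) t A else 0.
    move=> eSb; have := eSb; rewrite !inE => /andP[eb eS].
    have prodE : \prod_(f in S :\ b :\ e) edge_factor s t A f =
        monomial (S :\ b :\ e) (s \o tperm b e) t A.
      apply: eq_bigr => f; rewrite !inE => /and3P[fe fb _]; apply: eq_factor.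
      by rewrite /= tpermD 1?eq_sym.
    case: (boolP (star e)) => se.
      under eq_bigr do rewrite (rest e eSb) /sk (negPf eb) mulNr -mulrA.
      rewrite sumrN sum_delta; congr (- _).
      rewrite prodE /monomial [RHS](big_setD1 b bS) [in RHS](big_setD1 e eSb) /=.
      rewrite -/(monomial _ _ _ _); move: (monomial _ _ _ _) => X.
      by rewrite /edge_factor sb se /= tpermL tpermR mulrCA.
    under eq_bigr do rewrite (rest e eSb) /sk (negPf eb) -mulrA.
    rewrite -mulr_sumr.
    rewrite prodE; under eq_bigr do rewrite mulrA.
    rewrite -mulr_suml.
    have -> : \sum_k A k (s e) * (A k (t b))^* = (s e == t b)%:R.
      have : A^T \is unitarymx by rewrite trmx_unitary; exact: UU.
      move/unitarymxP/matrixP => /(_ (s e) (t b)); rewrite mxE [RHS]mxE => <-.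
      by apply: eq_bigr => k _; rewrite !mxE.
    by case: (_ == t b); case: (_ == s b); rewrite !(mul1r, mul0r).
  rewrite (eq_bigr _ main) mulN1r -sumrN.
  rewrite [LHS]big_mkcond [X in _ = X + _]big_mkcond.
  rewrite [X in _ = _ + X]big_mkcond -big_split; apply: eq_bigr => e _ /=.
  rewrite !inE; case: (eqVneq e b) => [->|eb] /=.
    by rewrite sb /= !andbF addr0.
  case: (e \in S); rewrite /= ?addr0 // andbT.
  by case: (star e) => /=; rewrite ?add0r ?addr0.
have -> : (fun w => \sum_k unit_derivation S (sk k) t (s b) k (U w)) = fun w =>
    \sum_(a in S | [&& ~~ star a, s a == t b & t a == s b])
        monomial (S :\ b :\ a) (s \o tperm b a) t (U w)
    + (- 1) * (\sum_(x in S | star x && (x != b))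
        monomial S (s \o tperm b x) t (U w))
    + (- 1) * (N%:R * monomial S s t (U w)) by apply/funext.
have b1 : bounded_variable (fun w => N%:R * monomial S s t (U w)).
  by apply: boundedM; [exact: bounded_cst|exact: bounded_monomial].
have b2 : bounded_variable (fun w => \sum_(x in S | star x && (x != b))
        monomial S (s \o tperm b x) t (U w)).
  by apply: bounded_sum => x _; exact: bounded_monomial.
have b3 : bounded_variable (fun w =>
    \sum_(a in S | [&& ~~ star a, s a == t b & t a == s b])
        monomial (S :\ b :\ a) (s \o tperm b a) t (U w)).
  by apply: bounded_sum => x _; exact: bounded_monomial.
have bN X : bounded_variable X -> bounded_variable (fun w : Omega => -1 * X w : R[i]).
  by move=> bX; apply: boundedM => //; exact: bounded_cst.
rewrite expectationD; [|by apply: boundedD => //; exact: bN|exact: bN].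
rewrite expectationD; [|by []|exact: bN].
rewrite !expectationZ // ?expectation_sum; try by move=> *; exact: bounded_monomial.
by rewrite !mulN1r => /eqP; rewrite subr_eq0 => /eqP <-.
Qed.

(** The constant is 2 because real and imaginary parts are integrated apart. *)
Lemma moment_bound S s t : `|moment S s t| <= 2.
Proof.
have [mb _] := bounded_monomial S s t.
have := @expectation_le _ _ _ P _ 1 mb; rewrite muln1; apply => w.
have [_ UU _] := U_haar.
rewrite normr_prod; apply: prodr_ile1 => e _; rewrite normr_ge0 /=.
by rewrite /edge_factor; case: star; rewrite ?norm_conjC unitary_entry_le.
Qed.

Lemma moment_set0 s t : moment finset.set0 s t = 1.
Proof.
rewrite /moment; under eq_fun do rewrite /monomial big_set0.
exact: expectation_cst.
Qed.

End LoopEquation.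

(** * Limits of the traces of a Haar matrix *)

Lemma tends_fast_cvg (R : realType) (u : nat -> R[i]) (l : R[i]) :
  tends_fast u l -> (u : nat -> (R[i])^o) @ \oo --> (l : (R[i])^o).
Proof.
case=> K uK; apply/cvgrPdist_lt => e e0.
have eR : e = (complex.Re e)%:C.
  by rewrite RRe_real // gtr0_real.
have Re0 : 0 < complex.Re e by rewrite eR ltcR in e0.
pose n := Num.bound (K%:R / complex.Re e).
near=> N.
have N0 : (0 < N)%N by near: N; exact: nbhs_infty_gt.
rewrite distrC; apply: le_lt_trans (uK N N0) _.
rewrite eR !natr_complex -fmorphV -rmorphM ltcR /=.
rewrite ltr_pdivrMr ?ltr0n // mulrC -ltr_pdivrMr //.
apply: lt_le_trans (archi_boundP _) _; first by rewrite divr_ge0 // ltW.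
rewrite -/n ler_nat; near: N; exact: nbhs_infty_ge.
Unshelve. all: end_near.
Qed.

Section HaarMoments.
Context {R : realType} {d : measure_display} {Omega : measurableType d}.
Variables (P : probability Omega R) (N : nat) (U : Omega -> 'M[R[i]]_N).
Hypothesis U_haar : unitary_haar P U.
Hypothesis N_gt0 : (0 < N)%N.
Local Notation Ex := (complex_expectation P).

Lemma haar_loop_moments (E : finType) (star : E -> bool) :
  @loop_moments R[i] E star N (moment P U star).
Proof.
split=> //.
- move=> S s s' t ss'; congr complex_expectation; apply/funext => w.
  by apply: eq_bigr => e eS; apply: eq_factor; exact: ss'.
- by move=> S s t; exact: (moment_bound U_haar).
- by move=> s t; exact: moment_set0.
- by move=> S s t; exact: (moment_nostar U_haar).
- by move=> S s t b; exact: (loop_equation U_haar).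
Qed.

Lemma edge_weight_monomial (T : testGraph) A (phi : {ffun vertex T -> 'I_N}) :
  edge_weight A phi = monomial (@star T) [set: _]%SET (phi \o @src T) (phi \o @tgt T) A
  :> R[i].
Proof.
rewrite /edge_weight /monomial; apply: eq_big => [e|e _]; first by rewrite inE.
by rewrite /edge_factor /=; case: star => //; rewrite !mxE.
Qed.

Definition trace_sum (V E : finType) (star : E -> bool) (src tgt : E -> V) A : R[i] :=
  \sum_(phi : {ffun V -> 'I_N}) monomial star [set: _]%SET (phi \o src) (phi \o tgt) A.

Lemma Tr_trace_sum (T : testGraph) (A : 'M[R[i]]_N) :
  Tr A T = trace_sum (@star T) (@src T) (@tgt T) A.
Proof. by apply: eq_bigr => phi _; exact: edge_weight_monomial. Qed.

Lemma bounded_trace_sum (V E : finType) (star : E -> bool) (src tgt : E -> V) :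
  bounded_variable (fun w => trace_sum star src tgt (U w)).
Proof. by apply: bounded_sum => phi _; exact: (bounded_monomial U_haar). Qed.

Lemma expectation_trace_sum (V E : finType) (star : E -> bool) (src tgt : E -> V) :
  Ex (fun w => trace_sum star src tgt (U w)) =
  \sum_(phi : {ffun V -> 'I_N}) moment P U star [set: _]%SET (phi \o src) (phi \o tgt).
Proof. by rewrite expectation_sum // => phi _; exact: (bounded_monomial U_haar). Qed.

Lemma expectation_Tr (T : testGraph) :
  Ex (fun w => N%:R^-1 * Tr (U w) T) = N%:R^-1 *
  \sum_(phi : {ffun vertex T -> 'I_N})
     moment P U (@star T) [set: _]%SET (phi \o @src T) (phi \o @tgt T).
Proof.
under eq_fun do rewrite Tr_trace_sum.
by rewrite expectationZ ?expectation_trace_sum //; exact: bounded_trace_sum.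
Qed.

Lemma expectation_Tr_inj (T : testGraph) :
  Ex (fun w => N%:R^-1 * Tr_inj (U w) T) = N%:R^-1 *
  \sum_(phi : {ffun vertex T -> 'I_N} | injectiveb phi)
     moment P U (@star T) [set: _]%SET (phi \o @src T) (phi \o @tgt T).
Proof.
have bm (phi : {ffun vertex T -> 'I_N}) : bounded_variable (fun w => edge_weight (U w) phi).
  under eq_fun do rewrite edge_weight_monomial.
  exact: (bounded_monomial U_haar).
rewrite expectationZ; last by apply: bounded_sum.
rewrite expectation_sum //; congr (_ * _); apply: eq_bigr => phi _.
by under eq_fun do rewrite edge_weight_monomial.
Qed.

End HaarMoments.

Section Merging.
Variables (R : realType) (N : nat).

Lemma monomial_sum (E1 E2 : finType) (star : E1 + E2 -> bool) s t (A : 'M[R[i]]_N) :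
  monomial star [set: _]%SET s t A =
  monomial (star \o inl) [set: _]%SET (s \o inl) (t \o inl) A *
  monomial (star \o inr) [set: _]%SET (s \o inr) (t \o inr) A.
Proof.
rewrite /monomial big_sumType /=; congr (_ * _);
  by apply: eq_bigl => e; rewrite !inE.
Qed.

Lemma sum_ffun_sum (V1 V2 : finType) (F : {ffun V1 + V2 -> 'I_N} -> R[i])
  (F1 : {ffun V1 -> 'I_N} -> R[i]) (F2 : {ffun V2 -> 'I_N} -> R[i]) :
  (forall (phi : {ffun V1 + V2 -> 'I_N}) (phi1 : {ffun V1 -> 'I_N}) (phi2 : {ffun V2 -> 'I_N}),
    (forall v, phi (inl v) = phi1 v) -> (forall v, phi (inr v) = phi2 v) ->
    F phi = F1 phi1 * F2 phi2) ->
  \sum_phi F phi = (\sum_phi F1 phi) * (\sum_phi F2 phi).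
Proof.
move=> FE; rewrite big_distrlr pair_big /=.
pose h (p : {ffun V1 -> 'I_N} * {ffun V2 -> 'I_N}) : {ffun V1 + V2 -> 'I_N} :=
  [ffun v => match v with inl a => p.1 a | inr b => p.2 b end].
rewrite (reindex h) /=; last first.
  exists (fun phi => ([ffun a => phi (inl a)], [ffun b => phi (inr b)])).
    move=> [p1 p2] _; congr pair; apply/ffunP => v; by rewrite !ffunE.
  by move=> phi _; apply/ffunP => -[v|v]; rewrite !ffunE.
by apply: eq_bigr => -[p1 p2] _; apply: FE => v; rewrite ffunE.
Qed.

Lemma trace_sum_union (V1 V2 E1 E2 : finType) (star : E1 + E2 -> bool)
  (src1 tgt1 : E1 -> V1) (src2 tgt2 : E2 -> V2) (A : 'M[R[i]]_N) :
  trace_sum star (sum_map src1 src2) (sum_map tgt1 tgt2) A =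
  trace_sum (star \o inl) src1 tgt1 A * trace_sum (star \o inr) src2 tgt2 A.
Proof.
apply: sum_ffun_sum => phi phi1 phi2 h1 h2; rewrite monomial_sum.
congr (_ * _); apply: eq_bigr => e _; rewrite /edge_factor /=.
  by rewrite !h1.
by rewrite !h2.
Qed.

End Merging.

Lemma connect_homo (A B : finType) (e : rel A) (e' : rel B) (h : A -> B) x y :
  (forall u v, e u v -> e' (h u) (h v)) -> connect e x y -> connect e' (h x) (h y).
Proof.
move=> he /connectP[p xp ->]; apply/connectP; exists (map h p).
  by apply: (@homo_path _ _ h e) xp.
by rewrite last_map.
Qed.

(** Products of traces are traces of disjoint unions, which lets the factorization
    be proved by adding one graph at a time. *)
Lemma product_of_traces (R : realType) K (T : 'I_K -> testGraph) :
  exists (V E : finType) (star : E -> bool) (src tgt : E -> V) (Z : {set V}),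
  [/\ (#|Z| <= K)%N,
      forall v, exists2 z, z \in Z & connect (Defs.adjacent src tgt) v z &
      forall N (A : 'M[R[i]]_N),
        \prod_(k < K) Tr A (T k) = trace_sum star src tgt A].
Proof.
elim: K T => [|K IH] T.
  exists void, void, (fun=> false), (of_void _), (of_void _), finset.set0.
  split=> [||N A]; [by rewrite cards0|by case|].
  rewrite big_ord0 /trace_sum (eq_bigr (fun=> 1)).
    by rewrite sumr_const card_ffun card_void expn0.
  by move=> phi _; rewrite /monomial big1 // => -[].
have [V [E [star [src [tgt [Z [ZK Zspan TE]]]]]]] :=
  IH (fun k => T (widen_ord (leqnSn K) k)).
pose T' := T ord_max; have /card_gt0P[v0 _] := vertex_gt0 T'.
pose star' (e : E + edge T') := match e with inl e => star e | inr e => Defs.star e end.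
exists (V + vertex T')%type, (E + edge T')%type, star',
  (sum_map src (@Defs.src T')), (sum_map tgt (@Defs.tgt T')),
  (inr v0 |: (inl @: Z)).
split=> [|[v|v]|N A].
- rewrite cardsU1; apply: leq_trans (leq_add (leq_b1 _) (leq_imset_card _ _)) _.
  by rewrite add1n ltnS.
- have [z zZ vz] := Zspan v; exists (inl z); first by rewrite inE imset_f ?orbT.
  apply: connect_homo vz => a b /existsP[e abe]; apply/existsP; exists (inl e).
  exact: abe.
- exists (inr v0); first by rewrite inE set11.
  apply: connect_homo (connectedT v v0) => a b /existsP[e abe].
  by apply/existsP; exists (inr e).
by rewrite big_ord_recr /= TE Tr_trace_sum trace_sum_union.
Qed.

Section Limits.
Context {R : realType} {d : nat -> measure_display}.
Context {Omega : forall N, measurableType (d N)}.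
Variables (P : forall N, probability (Omega N) R).
Variables (U : forall N, Omega N -> 'M[R[i]]_N).
Arguments U : clear implicits.
Hypothesis U_haar : forall N, (0 < N)%N -> unitary_haar (P N) (U N).

Lemma tau_tends_fast (T : testGraph) : exists L : R[i], tends_fast (tau_ P U T) L.
Proof.
have /card_gt0P[v0 _] := vertex_gt0 T.
have [L [K LK]] := trace_limit (@nat_norm_bound R) (@star T) v0 (@connectedT T).
exists L, K => N N0; rewrite /tau_ (expectation_Tr (U_haar N0)).
exact: LK (haar_loop_moments (U_haar N0) N0 _).
Qed.

Lemma tau0_tends_fast (T : testGraph) :
  tends_fast (tau0_ P U T) (leading R[i] (@star T) [set: _]%SET (@src T) (@tgt T)).
Proof.
have /card_gt0P[v0 _] := vertex_gt0 T.
have [K LK] := injective_trace_limit (@nat_norm_bound R) (@star T) v0 (@connectedT T).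
exists K => N N0; rewrite /tau0_ (expectation_Tr_inj (U_haar N0)).
exact: LK (haar_loop_moments (U_haar N0) N0 _).
Qed.

Lemma tau_prod_tends_fast K (T : 'I_K -> testGraph) (L : 'I_K -> R[i]) :
  (forall k, tends_fast (tau_ P U (T k)) (L k)) ->
  tends_fast (tau_prod_ P U T) (\prod_(k < K) L k).
Proof.
elim: K T L => [|K IH] T L TL.
  exists 0%N => N N0; rewrite /tau_prod_ big_ord0.
  under eq_fun do rewrite big_ord0.
  by rewrite expectation_cst subrr normr0 mulr_ge0 // ?invr_ge0 ler0n.
rewrite big_ord_recr /=.
pose T0 (k : 'I_K) := T (widen_ord (leqnSn K) k); pose T' := T ord_max.
have lim := tends_fastM (@nat_norm_bound R)
  (IH T0 (fun k => L (widen_ord (leqnSn K) k)) (fun k => TL _)) (TL ord_max).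
have [V [E [st [sr [tg [Z [ZK Zspan TE]]]]]]] := product_of_traces R T0.
have /card_gt0P[v0 _] := vertex_gt0 T'.
pose st' (e : E + edge T') := match e with inl e => st e | inr e => star e end.
have [C HC] := @trace_decorrelation R[i] V E (vertex T') (edge T') st'
  sr tg (@src T') (@tgt T') Z v0 Zspan (@connectedT T').
apply: (tends_fast_near lim (K := C)) => N N0.
have UN := U_haar N0; set q : R[i] := N%:R^-1.
have /andP[q0 q1] := inv_nat_itv R[i] N0; rewrite -/q in q0 q1.
have prodE (X : 'M[R[i]]_N) : \prod_(k < K) (q * Tr X (T0 k)) =
    q ^+ K * trace_sum st sr tg X.
  by rewrite big_split /= prodr_const card_ord TE.
have bT (V' E' : finType) (s' : E' -> bool) (f g : E' -> V') :
    bounded_variable (fun w => trace_sum s' f g (U N w)).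
  exact: bounded_trace_sum UN _ _ _ _ _.
have -> : tau_prod_ P U T N = q ^+ K.+1 * complex_expectation (P N) (fun w =>
    trace_sum st' (sum_map sr (@src T')) (sum_map tg (@tgt T')) (U N w)).
  rewrite /tau_prod_ -expectationZ //; congr complex_expectation.
  apply/funext => w; rewrite big_ord_recr /= prodE Tr_trace_sum trace_sum_union.
  by rewrite exprSr mulrACA.
have -> : tau_prod_ P U T0 N = q ^+ K * complex_expectation (P N) (fun w =>
    trace_sum st sr tg (U N w)).
  rewrite /tau_prod_ -expectationZ //; congr complex_expectation.
  by apply/funext => w; rewrite prodE.
have -> : tau_ P U T' N = q * complex_expectation (P N) (fun w =>
    trace_sum (@star T') (@src T') (@tgt T') (U N w)).
  rewrite /tau_ -expectationZ //; congr complex_expectation.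
  by apply/funext => w; rewrite Tr_trace_sum.
rewrite mulrACA -exprSr -mulrBr normrM ger0_norm ?exprn_ge0 //.
rewrite !(expectation_trace_sum UN).
have <- : \sum_(phi : {ffun V + vertex T' -> 'I_N})
    moment (P N) (U N) st [set: _]%SET (phi \o inl \o sr) (phi \o inl \o tg) *
    moment (P N) (U N) (@star T') [set: _]%SET (phi \o inr \o @src T') (phi \o inr \o @tgt T') =
  (\sum_(phi : {ffun V -> 'I_N}) moment (P N) (U N) st [set: _]%SET (phi \o sr) (phi \o tg)) *
  (\sum_(phi : {ffun vertex T' -> 'I_N})
     moment (P N) (U N) (@star T') [set: _]%SET (phi \o @src T') (phi \o @tgt T')).
  apply: sum_ffun_sum => phi phi1 phi2 h1 h2.
  have -> : phi \o inl \o sr = phi1 \o sr by apply/funext => e; exact: h1.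
  have -> : phi \o inl \o tg = phi1 \o tg by apply/funext => e; exact: h1.
  have -> : phi \o inr \o @src T' = phi2 \o @src T' by apply/funext => e; exact: h2.
  have -> // : phi \o inr \o @tgt T' = phi2 \o @tgt T'.
  by apply/funext => e; exact: h2.
rewrite -sumrB.
apply: le_trans (HC N (moment (P N) (U N) st') (moment (P N) (U N) st)
  (moment (P N) (U N) (@star T')) _ _ _ _ _).
- by rewrite ler_wpM2r // ler_wiXn2l.
- exact: haar_loop_moments UN N0 _ _.
- exact: haar_loop_moments UN N0 _ _.
- exact: haar_loop_moments UN N0 _ _.
- move=> s t; congr complex_expectation; apply/funext => w.
  rewrite /monomial big_sumType /= [X in _ * X]big_pred0 ?mulr1; last first.
    by move=> e; rewrite inE.
  by apply: eq_bigl => e; rewrite !inE.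
- move=> s t; congr complex_expectation; apply/funext => w.
  rewrite /monomial big_sumType /= [X in X * _]big_pred0 ?mul1r; last first.
    by move=> e; rewrite inE.
  by apply: eq_bigl => e; rewrite !inE.
Qed.

Lemma tau0E (T : testGraph) :
  tau0 P U T = leading R[i] (@star T) [set: _]%SET (@src T) (@tgt T).
Proof.
by apply: (@cvg_lim (R[i])^o); [exact: norm_hausdorff|exact/tends_fast_cvg/tau0_tends_fast].
Qed.

Lemma tau_tends_fast_tau (T : testGraph) : tends_fast (tau_ P U T) (tau P U T).
Proof.
have [L TL] := tau_tends_fast T; suff -> : tau P U T = L by [].
by apply: (@cvg_lim (R[i])^o); [exact: norm_hausdorff|exact: tends_fast_cvg].
Qed.

End Limits.

(** There is only one summand. *)
Lemma leading_cactus (F : numFieldType) (T : testGraph) g :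
  tight_walks (@star T) [set: _]%SET (@src T) (@tgt T) g ->
  leading F (@star T) [set: _]%SET (@src T) (@tgt T) = perm_weight F g.
Proof.
move=> tg; rewrite /leading (big_pred1 g) // => h; apply/idP/eqP => [th|->//].
exact: tight_unique th tg.
Qed.

Local Open Scope classical_set_scope.
Local Open Scope ring_scope.
Local Open Scope complex_scope.

Theorem proposition3p7 (R : realType) (d : nat -> measure_display)
    (Omega : forall N, measurableType (d N))
    (P : forall N, probability (Omega N) R)
    (U : forall N, Omega N -> 'M[R[i]]_N)
    (U_haar : forall N, (0 < N)%N -> unitary_haar (P N) (U N)) :
  [/\ converges_in_traffic_distribution P U,
      factorization_property P U,
      forall T : testGraph, cvgn (tau0_ P U T),
      forall T : testGraph,
        tau0 P U T != 0 <-> oriented_alternating_cactus T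
    & forall T : testGraph, oriented_alternating_cactus T ->
        tau0 P U T =
        \prod_(C : {set edge T} | `[< simple_cycle C >])
           ((-1) ^+ (#|C| %/ 2 - 1) * catalan R (#|C| %/ 2 - 1))].
Proof.
split.
- move=> T; have [L TL] := tau_tends_fast U_haar T.
  by apply/cvg_ex; exists L; exact: tends_fast_cvg.
- move=> K T _; apply: tends_fast_cvg; apply: tau_prod_tends_fast => // k.
  exact: tau_tends_fast_tau.
- move=> T; apply/cvg_ex; eexists; apply: tends_fast_cvg.
  exact: tau0_tends_fast.
- move=> T; rewrite tau0E //; split=> [nz|cT].
    have [g tg|none] := pickP (tight_walks (@star T) [set: _]%SET (@src T) (@tgt T)).
      exact: tight_cactus tg.
    by move: nz; rewrite /leading big_pred0 // eqxx.
  have [g tg] := cactus_tight cT (@connectedT T).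
  rewrite (leading_cactus _ tg); apply/prodf_neq0 => O _.
  exact: cycle_weight_neq0.
move=> T cT; rewrite tau0E //; have [g tg] := cactus_tight cT (@connectedT T).
rewrite (leading_cactus _ tg) /perm_weight.
exact: (tight_prod_cycles tg (cycle_weight R[i])).
Qed.
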